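(* Let $0\le\alpha<1$ and $f\in\mathcal{K}(\alpha)$. Then the following hold. (i) For $|z|=r<1$, $$\frac{k_\alpha(-r)}{-r}\le\operatorname{Re}\frac{f(z)}{z}\le\frac{k_\alpha(r)}{r}.$$ (ii) When $0<\alpha<1/2$, the asymptotic lines of the boundary curve of $h_\alpha(\mathbb{D})$ are given, in the coordinates $u+iv$, by $$v=\pm\cot(\pi\alpha)\left(u-\frac{1}{2\alpha-1}\right).$$ In particular, the values of $f(z)/z$ for $z\in\mathbb{D}$ are contained in the sector $$S=\left\{u+iv:\ |v|<\cot(\pi\alpha)\left(u-\frac{1}{2\alpha-1}\right)\right\}.$$ (iii) When $1/2\le\alpha<1$, $$\left|\operatorname{Im}\frac{f(z)}{z}\right|<M(\alpha),\qquad z\in\mathbb{D},$$ where $$M(\alpha)=\sup_{0<\theta<\pi}\operatorname{Im}\left[e^{-i\theta}k_\alpha(e^{i\theta})\right]\le M(1/2)=\frac{\pi}{2}.$$ The estimate is sharp, i.e. for each $1/2\le\alpha<1$ the constant $M(\alpha)$ cannot be replaced by a smaller one valid for all $f\in\mathcal{K}(\alpha)$.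
   Context: $\mathbb{D}=\{z\in\mathbb{C}:|z|<1\}$. For $0\le\alpha<1$, $\mathcal{K}(\alpha)$ (convex functions of order $\alpha$) is the set of analytic functions $f$ on $\mathbb{D}$ with $f(0)=0$, $f'(0)=1$ and $\operatorname{Re}\left(1+\frac{zf''(z)}{f'(z)}\right)>\alpha$ for all $z\in\mathbb{D}$. The function $k_\alpha$ is given by $k_\alpha(z)=(1-2\alpha)^{-1}\left[(1-z)^{2\alpha-1}-1\right]$ if $\alpha\neq 1/2$ and $k_{1/2}(z)=-\log(1-z)$ (principal branches); it extends analytically across $\partial\mathbb{D}\setminus\{1\}$, so $k_\alpha(e^{i\theta})$ makes sense for $0<\theta<2\pi$. Put $h_\alpha(z)=k_\alpha(z)/z$. Functions of the form $f(z)/z$ with $f(0)=0$, $f'(0)=1$ (and $k_\alpha(\pm r)/(\pm r)$ at $r=0$) are given the value $1$ at the origin. The boundary curve of $h_\alpha(\mathbb{D})$ is $\theta\mapsto h_\alpha(e^{i\theta})$, $0<\theta<2\pi$; a line is an asymptotic line of it if the distance from the curve to the line tends to $0$ along one of the two ends ($\theta\to0^+$ or $\theta\to2\pi^-$) of the curve, along which the curve tends to infinity. *)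

(* Defs.v *)
From Stdlib Require Import Reals Lra.
From Coquelicot Require Import Coquelicot.

Open Scope R_scope.

Definition Cexp (z : C) : C := (exp (Re z) * cos (Im z), exp (Re z) * sin (Im z)).

(* Principal argument, with values in (-PI, PI]. *)
Definition Carg (z : C) : R :=
  if Rle_dec 0 (Im z) then acos (Re z / Cmod z) else - acos (Re z / Cmod z).

Definition Clog (z : C) : C := (ln (Cmod z), Carg z).

Definition Cpower (z : C) (b : R) : C := Cexp (RtoC b * Clog z)%C.

Definition in_disk (z : C) : Prop := Cmod z < 1.

Definition analytic_on_disk (f : C -> C) : Prop :=
  forall z0 : C, in_disk z0 ->
  exists (a : nat -> C) (rho : R), 0 < rho /\
    forall z : C, Cmod (z - z0)%C < rho ->
      @is_pseries C_AbsRing C_NormedModule a (z - z0)%C (f z).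

(* The quotient zf''/f' presupposes f' <> 0; division being total here, this is
   required explicitly. *)
Definition convex_of_order (alpha : R) (f : C -> C) : Prop :=
  analytic_on_disk f /\
  f (RtoC 0) = RtoC 0 /\
  C_derive f (RtoC 0) = RtoC 1 /\
  forall z : C, in_disk z ->
    C_derive f z <> RtoC 0 /\
    alpha < Re (RtoC 1 + z * C_derive (C_derive f) z / C_derive f z)%C.

(* f(z)/z, with the value 1 at the origin. *)
Definition over_z (f : C -> C) (z : C) : C :=
  if Ceq_dec z (RtoC 0) then RtoC 1 else (f z / z)%C.

Definition k_ (alpha : R) (z : C) : C :=
  if Req_dec_T alpha (1 / 2) then (- Clog (RtoC 1 - z))%C
  else (/ RtoC (1 - 2 * alpha) *
        (Cpower (RtoC 1 - z) (2 * alpha - 1) - RtoC 1))%C.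

Definition h_ (alpha : R) : C -> C := over_z (k_ alpha).

Definition cot (x : R) : R := cos x / sin x.

Definition boundary_curve (alpha : R) (theta : R) : C :=
  h_ alpha (Cexp (Ci * RtoC theta)%C).

Definition is_line (L : C -> Prop) : Prop :=
  exists p d : C, d <> RtoC 0 /\
    forall w : C, L w <-> exists t : R, w = (p + RtoC t * d)%C.

Definition dist_to (L : C -> Prop) (w : C) : R :=
  real (Glb_Rbar (fun x : R => exists p : C, L p /\ x = Cmod (w - p)%C)).

Definition asymptotic_along
    (F : (R -> Prop) -> Prop) (gamma : R -> C) (L : C -> Prop) : Prop :=
  filterlim (fun theta => Cmod (gamma theta)) F (Rbar_locally p_infty) /\
  filterlim (fun theta => dist_to L (gamma theta)) F (locally 0).

(* Here gamma is a curve parametrised by the open interval (0, 2 PI). *)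
Definition is_asymptotic_line (gamma : R -> C) (L : C -> Prop) : Prop :=
  is_line L /\
  (asymptotic_along (at_right 0) gamma L \/
   asymptotic_along (at_left (2 * PI)) gamma L).

Definition M_ (alpha : R) : Rbar :=
  Lub_Rbar (fun x : R => exists theta : R, 0 < theta < PI /\
    x = Im (Cexp (- Ci * RtoC theta) * k_ alpha (Cexp (Ci * RtoC theta)))%C).

Lemma Carg_bound (z : C) : z <> RtoC 0 -> - PI < Carg z <= PI.
Proof.
intros Hz. pose proof PI_RGT_0 as Hpi.
pose proof (acos_bound (Re z / Cmod z)) as [B1 B2].
unfold Carg; destruct (Rle_dec 0 (Im z)) as [H|H]; [lra|].
split; [|lra].
destruct B2 as [B2|B2]; [lra|exfalso].
assert (Hm : 0 < Cmod z) by (apply Cmod_gt_0; exact Hz).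
assert (Hle : -1 <= Re z / Cmod z <= 1).
{ pose proof (re_le_Cmod z) as Hr. apply Rabs_le_between in Hr.
  split; [apply Rle_div_r|apply Rle_div_l]; lra. }
pose proof (cos_acos _ Hle) as E. rewrite B2, cos_PI in E.
assert (E' : Re z = - Cmod z).
{ replace (Re z) with (Re z / Cmod z * Cmod z) by (field; lra). rewrite <- E; ring. }
pose proof (Cmod2_alt z) as S. rewrite E' in S. nra.
Qed.

Lemma Cexp_Clog (z : C) : z <> RtoC 0 -> Cexp (Clog z) = z.
Proof.
intros Hz.
assert (Hm : 0 < Cmod z) by (apply Cmod_gt_0; exact Hz).
assert (Hle : -1 <= Re z / Cmod z <= 1).
{ pose proof (re_le_Cmod z) as Hr. apply Rabs_le_between in Hr.
  split; [apply Rle_div_r|apply Rle_div_l]; lra. }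
assert (Hs : sin (acos (Re z / Cmod z)) = Rabs (Im z) / Cmod z).
{ rewrite sin_acos by exact Hle.
  replace (1 - (Re z / Cmod z)²) with ((Im z / Cmod z)²).
  - rewrite sqrt_Rsqr_abs, Rabs_div by lra. rewrite (Rabs_pos_eq (Cmod z)); lra.
  - pose proof (Cmod2_alt z) as S. unfold Rsqr.
    apply Rmult_eq_reg_r with (Cmod z ^ 2); [|nra]. field_simplify; lra. }
unfold Cexp, Clog, Carg; simpl. rewrite exp_ln by exact Hm.
transitivity (Re z, Im z); [|symmetry; apply surjective_pairing].
destruct (Rle_dec 0 (Im z)) as [H|H].
- rewrite cos_acos, Hs by exact Hle. rewrite Rabs_pos_eq by exact H.
  f_equal; field; lra.
- rewrite cos_neg, sin_neg, cos_acos, Hs by exact Hle.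
  rewrite Rabs_left by lra.
  f_equal; field; lra.
Qed.

Lemma h_real (alpha r : R) : r < 1 -> Im (h_ alpha (RtoC r)) = 0.
Proof.
intros Hr.
assert (HL : Clog (RtoC 1 - RtoC r)%C = RtoC (ln (1 - r))).
{ rewrite <- RtoC_minus. unfold Clog. rewrite Cmod_R, Rabs_pos_eq by lra.
  unfold RtoC; f_equal. unfold Carg; simpl.
  replace (Cmod (1 - r, 0)) with (1 - r)
    by (change (1 - r, 0) with (RtoC (1 - r)); rewrite Cmod_R, Rabs_pos_eq; lra).
  replace ((1 - r) / (1 - r)) with 1 by (field; lra).
  destruct (Rle_dec 0 0); rewrite acos_1; lra. }
assert (Hk : exists x : R, k_ alpha (RtoC r) = RtoC x).
{ unfold k_. destruct (Req_dec_T alpha (1 / 2)) as [E|E].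
  - exists (- ln (1 - r)). rewrite HL, RtoC_opp. reflexivity.
  - exists (/ (1 - 2 * alpha) * (exp ((2 * alpha - 1) * ln (1 - r)) - 1)).
    unfold Cpower. rewrite HL, <- RtoC_mult.
    rewrite <- RtoC_inv by lra.
    rewrite (RtoC_mult (/ (1 - 2 * alpha))), RtoC_minus.
    do 2 f_equal. unfold Cexp, RtoC; simpl.
    rewrite cos_0, sin_0. f_equal; ring. }
destruct Hk as [x Hk]. unfold h_, over_z.
destruct (Ceq_dec (RtoC r) (RtoC 0)) as [E|E]; [reflexivity|].
rewrite Hk, <- RtoC_div; [reflexivity|].
intros H; apply E; rewrite H; reflexivity.
Qed.

(* Main.v *)
Require Import Defs.
From Stdlib Require Import Reals Lra Lia Arith Classical_Prop.
From Coquelicot Require Import Coquelicot.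
Open Scope R_scope.

(** Put [p = 2 - 2 alpha].  The Herglotz representation of [1 + z f''/f'] exhibits [f'] as a
    limit of products of powers [(1 - y_j z)^(-a_j)] with [a_j > 0], [sum a_j = p] and
    [|y_j|] close to [1].  Since [(1-u)^(-a) (1-v)^(-b)] is a Beta average of
    [(1 - su - (1-s)v)^(-a-b)], such a product is an average of functions [(1-yz)^(-p)] with
    [y] in the convex hull of the [y_j].  Integrating along the segment from [0] to [z],
    [f(z)/z] lies in every closed half plane that contains the values of [h = k/z] on a
    slightly larger disk, so that only [h] itself has to be studied.  There
    [h(w)] is the mean of [(1-tw)^(-p)] over [0 <= t <= 1] and, with [q = p - 1],
    [q h(w) + 1] is [1 + q] times the mean of [((1-tw)/(1-w))^q]; this gives the bounds of
    the real part and the sector, while [Im h] strictly increases along radii in the upper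
    half disk when [p <= 1]. *)

(** * Differentiable curves and continuity in the complex plane *)


(** Finite products take the place of a representing measure: the masses of [N] arcs stand for it at
    a cost of order [1/N], and only real inequalities [Re (c * _) <= S] pass to the limit. Merging
    two powers adds their exponents, which is why the whole exponent [p] ends up on a single base
    point [y]. That [y] is the same for every point of the segment from [0] to [z], so the averaging
    commutes with the integration along it.

    The hull reached in this way is closed and is controlled only on disks of radius larger than
    [|z|]. Hence the bounds of the real part are recovered by letting the radius decrease to [|z|],
    while the strict inequalities come from gaps on a compact disk: a sector of half-angle below
    [q pi/2], or a maximum of [Im h] that is strictly exceeded further out on the same ray. The
    sector appears because [(1-tw)/(1-w) = t + (1-t)/(1-w)] has positive real part, so that its
    [q]-th power has argument below [q pi/2 = pi/2 - pi alpha]; the vertex is [-1/q]. *)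

Lemma is_derive_Rmult (f g : R -> R) (x a b : R) :
  is_derive f x a -> is_derive g x b ->
  is_derive (fun t => f t * g t) x (a * g x + f x * b).
Proof.
intros Hf Hg.
evar_last; [apply (is_derive_mult f g x a b Hf Hg); intros; apply Rmult_comm|reflexivity].
Qed.

Lemma is_derive_Rplus (f g : R -> R) (x a b : R) :
  is_derive f x a -> is_derive g x b -> is_derive (fun t => f t + g t) x (a + b).
Proof. intros Hf Hg. exact (is_derive_plus f g x a b Hf Hg). Qed.

Lemma is_derive_Ropp (f : R -> R) (x a : R) :
  is_derive f x a -> is_derive (fun t => - f t) x (- a).
Proof. intros Hf. exact (is_derive_opp f x a Hf). Qed.

Lemma is_derive_Rcomp (f g : R -> R) (x a b : R) :
  is_derive f (g x) a -> is_derive g x b -> is_derive (fun t => f (g t)) x (a * b).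
Proof.
intros Hf Hg. evar_last; [apply (is_derive_comp f g x a b Hf Hg)|].
unfold scal; simpl; unfold mult; simpl; ring.
Qed.

Lemma is_derive_eq (f : R -> R) (x a b : R) : is_derive f x a -> a = b -> is_derive f x b.
Proof. intros H <-; exact H. Qed.

(** Taken coordinatewise and as a relation, so that each rule reduces to real calculus; the
    algebraic shape of the derivative is adjusted afterwards by [cder_eq]. *)
Definition cder (u : R -> C) (t : R) (v : C) : Prop :=
  is_derive (fun s => Re (u s)) t (Re v) /\ is_derive (fun s => Im (u s)) t (Im v).

Lemma Ceq_ext (z w : C) : Re z = Re w -> Im z = Im w -> z = w.
Proof. destruct z, w; simpl; intros; subst; reflexivity. Qed.

Lemma cder_eq (u : R -> C) (t : R) (v w : C) : cder u t v -> v = w -> cder u t w.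
Proof. intros H <-; exact H. Qed.

Lemma cder_const (c : C) (t : R) : cder (fun _ => c) t (RtoC 0).
Proof. split; simpl; apply (is_derive_const (V := R_NormedModule)). Qed.

Lemma cder_RtoC (f : R -> R) (t a : R) : is_derive f t a -> cder (fun s => RtoC (f s)) t (RtoC a).
Proof. split; simpl; [exact H|apply (is_derive_const (V := R_NormedModule))]. Qed.

Lemma cder_id (t : R) : cder RtoC t (RtoC 1).
Proof. apply (cder_RtoC (fun s => s)), (is_derive_id (K := R_AbsRing)). Qed.

Lemma cder_plus (u v : R -> C) (t : R) (a b : C) :
  cder u t a -> cder v t b -> cder (fun s => u s + v s)%C t (a + b)%C.
Proof. intros [H1 H2] [H3 H4]; split; simpl; now apply is_derive_Rplus. Qed.

Lemma cder_opp (u : R -> C) (t : R) (a : C) : cder u t a -> cder (fun s => - u s)%C t (- a)%C.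
Proof. intros [H1 H2]; split; simpl; now apply is_derive_Ropp. Qed.

Lemma cder_minus (u v : R -> C) (t : R) (a b : C) :
  cder u t a -> cder v t b -> cder (fun s => u s - v s)%C t (a - b)%C.
Proof. intros H1 H2. apply cder_plus; [|apply cder_opp]; assumption. Qed.

Lemma cder_mult (u v : R -> C) (t : R) (a b : C) :
  cder u t a -> cder v t b -> cder (fun s => u s * v s)%C t (a * v t + u t * b)%C.
Proof.
intros [H1 H2] [H3 H4]; split; simpl.
- eapply is_derive_eq; [apply is_derive_Rplus; [|apply is_derive_Ropp]; apply is_derive_Rmult; eassumption|].
  unfold Re, Im; simpl; ring.
- eapply is_derive_eq; [apply is_derive_Rplus; apply is_derive_Rmult; eassumption|].
  unfold Re, Im; simpl; ring.
Qed.

Lemma cder_scal (c : C) (u : R -> C) (t : R) (a : C) :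
  cder u t a -> cder (fun s => c * u s)%C t (c * a)%C.
Proof.
intros H. eapply cder_eq; [apply cder_mult; [apply cder_const|exact H]|]. simpl; ring.
Qed.

(** The sum of squares has the shape to which the denominator of the complex inverse simplifies. *)
Lemma sqnorm_pos (z : C) : z <> RtoC 0 -> 0 < fst z * (fst z * 1) + snd z * (snd z * 1).
Proof.
intros H. destruct z as [x y]; simpl.
destruct (Req_dec x 0) as [->|Hx].
- destruct (Req_dec y 0) as [->|Hy]; [now contradict H|]. assert (0 < y * y) by nra. lra.
- assert (0 < x * x) by nra. nra.
Qed.

Lemma cder_inv (u : R -> C) (t : R) (a : C) :
  cder u t a -> u t <> RtoC 0 -> cder (fun s => / u s)%C t (- a / (u t * u t))%C.
Proof.
intros [H1 H2] H0. pose proof (sqnorm_pos _ H0) as Hp.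
assert (Hi : is_derive (fun s => / (fst (u s) * (fst (u s) * 1) + snd (u s) * (snd (u s) * 1))) t
  (- (2 * fst (u t) * fst a + 2 * snd (u t) * snd a) /
   (fst (u t) * (fst (u t) * 1) + snd (u t) * (snd (u t) * 1)) ^ 2)).
{ eapply is_derive_eq.
  - apply is_derive_inv; [|lra].
    apply is_derive_Rplus; apply is_derive_Rmult; try eassumption;
    apply is_derive_Rmult; try eassumption; apply (is_derive_const (V := R_NormedModule)).
  - change (@zero R_NormedModule) with 0. unfold Re, Im; simpl. field. nra. }
split.
- eapply is_derive_eq; [apply (is_derive_Rmult _ _ _ _ _ H1 Hi)|].
  destruct (u t) as [x y], a as [a b]; unfold Re, Im; simpl in *; field. split; nra.
- eapply is_derive_eq; [apply (is_derive_Rmult _ _ _ _ _ (is_derive_Ropp _ _ _ H2) Hi)|].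
  destruct (u t) as [x y], a as [a b]; unfold Re, Im; simpl in *; field. split; nra.
Qed.

Lemma cder_ext_loc (u v : R -> C) (t : R) (a : C) :
  locally t (fun s => u s = v s) -> cder u t a -> cder v t a.
Proof.
intros H [H1 H2]; split; (eapply is_derive_ext_loc; [|eassumption]);
  (eapply filter_imp; [|exact H]); simpl; intros s ->; reflexivity.
Qed.

Lemma cder_ext (u v : R -> C) (t : R) (a : C) :
  (forall s, u s = v s) -> cder u t a -> cder v t a.
Proof. intros H; apply cder_ext_loc, filter_forall, H. Qed.

Lemma cder_Cexp (u : R -> C) (t : R) (a : C) :
  cder u t a -> cder (fun s => Cexp (u s)) t (a * Cexp (u t))%C.
Proof.
intros [H1 H2].
assert (He : is_derive (fun s => exp (Re (u s))) t (exp (Re (u t)) * Re a))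
  by (apply (is_derive_Rcomp exp); [apply is_derive_exp|exact H1]).
split; simpl.
- eapply is_derive_eq; [apply (is_derive_Rmult _ (fun s => cos (Im (u s))) _ _ (- sin (Im (u t)) * Im a) He)|].
  + apply (is_derive_Rcomp cos); [apply is_derive_cos|exact H2].
  + unfold Re, Im; simpl; ring.
- eapply is_derive_eq; [apply (is_derive_Rmult _ (fun s => sin (Im (u s))) _ _ (cos (Im (u t)) * Im a) He)|].
  + apply (is_derive_Rcomp sin); [apply is_derive_sin|exact H2].
  + unfold Re, Im; simpl; ring.
Qed.

(* Agrees with [Clog] on the right half plane and is easier to differentiate; elsewhere a junk value. *)
Definition Log (z : C) : C :=
  (ln (Re z * Re z + Im z * Im z) / 2, atan (Im z / Re z)).

Lemma cder_Log (u : R -> C) (t : R) (a : C) :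
  cder u t a -> 0 < Re (u t) -> cder (fun s => Log (u s)) t (a / u t)%C.
Proof.
intros [H1 H2] H0.
assert (Hn : 0 < Re (u t) * Re (u t) + Im (u t) * Im (u t)) by nra.
split; simpl.
- eapply is_derive_eq.
  + apply is_derive_Rmult; [|apply (is_derive_const (V := R_NormedModule))].
    apply (is_derive_Rcomp ln); [apply is_derive_ln; exact Hn|].
    apply is_derive_Rplus; apply is_derive_Rmult; eassumption.
  + change (@zero R_NormedModule) with 0. unfold Re, Im in *; simpl.
    field. nra.
- eapply is_derive_eq.
  + apply (is_derive_Rcomp atan); [apply is_derive_atan|].
    apply is_derive_Rmult; [exact H2|]. apply is_derive_inv; [exact H1|lra].
  + unfold Rsqr. unfold Re, Im in *; simpl.
    field. repeat split; nra.
Qed.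

(** In the right half plane the angle lies between [-PI/2] and [PI/2]; there [acos] of its cosine
    returns it up to sign, and the sign is that of [Im z], on which [Carg] branches. *)
Lemma Clog_Log (z : C) : 0 < Re z -> Clog z = Log z.
Proof.
intros H. destruct z as [x y]; simpl in H.
set (z := (x, y)).
assert (Hz : z <> RtoC 0) by (intros E; injection E; lra).
assert (Hm : 0 < Cmod z) by (apply Cmod_gt_0; exact Hz).
assert (H2 : Cmod z ^ 2 = x * x + y * y) by (rewrite Cmod2_alt; simpl; ring).
unfold Clog, Log. change (Re z) with x; change (Im z) with y.
f_equal.
- rewrite <- H2. simpl. rewrite Rmult_1_r, ln_mult by exact Hm. field.
- assert (Ha : forall b, -PI/2 < b < PI/2 -> cos b = x / Cmod z ->
     0 <= b -> acos (x / Cmod z) = b).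
  { intros b Hb Hc Hp. rewrite <- Hc. apply acos_cos. lra. }
  assert (Hc : cos (atan (y / x)) = x / Cmod z).
  { rewrite cos_atan.
    replace (1 + (y / x)²) with ((Cmod z / x)²).
    - rewrite sqrt_Rsqr; [field; lra|]. apply Rlt_le, Rdiv_lt_0_compat; lra.
    - unfold Rsqr. replace (Cmod z / x * (Cmod z / x)) with (Cmod z ^ 2 / (x * x)) by (field; lra).
      rewrite H2. field. lra. }
  assert (Hs : 0 <= y -> 0 <= atan (y / x)).
  { intros Hy. destruct Hy as [Hy| <-].
    - rewrite <- atan_0. left. apply atan_increasing. apply Rdiv_lt_0_compat; lra.
    - unfold Rdiv. rewrite Rmult_0_l, atan_0. lra. }
  pose proof (atan_bound (y / x)) as Hb.
  unfold Carg. change (Re z) with x; change (Im z) with y.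
  destruct (Rle_dec 0 y) as [Hy|Hy].
  + apply Ha; [lra|exact Hc|auto].
  + assert (Hn : atan (y / x) < 0).
    { rewrite <- atan_0. apply atan_increasing.
      apply Rmult_lt_reg_r with x; [lra|]. unfold Rdiv. rewrite Rmult_assoc, Rinv_l; lra. }
    rewrite (Ha (- atan (y / x))); [lra|lra| |lra].
    rewrite cos_neg; exact Hc.
Qed.

(** The domain is arbitrary because three are needed: the line for integrands, the plane [R * R] for
    differentiation under the integral, and [C] for derivatives of holomorphic functions. *)
Definition cont {T : UniformSpace} (u : T -> C) (x : T) : Prop :=
  continuous (fun s => Re (u s)) x /\ continuous (fun s => Im (u s)) x.

Section Cont.
Context {T : UniformSpace}.
Implicit Types (u v : T -> C) (x : T).

Lemma cont_const (c : C) x : cont (fun _ : T => c) x.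
Proof. split; apply continuous_const. Qed.

Lemma cont_RtoC (f : T -> R) x : continuous f x -> cont (fun s => RtoC (f s)) x.
Proof. split; simpl; [exact H|apply continuous_const]. Qed.

Lemma continuous_Rplus (f g : T -> R) x :
  continuous f x -> continuous g x -> continuous (fun s => f s + g s) x.
Proof. intros; now apply (continuous_plus (V := R_NormedModule)). Qed.

Lemma continuous_Rmult (f g : T -> R) x :
  continuous f x -> continuous g x -> continuous (fun s => f s * g s) x.
Proof. intros; now apply (continuous_mult (K := R_AbsRing)). Qed.

Lemma continuous_Ropp (f : T -> R) x : continuous f x -> continuous (fun s => - f s) x.
Proof. intros; now apply (continuous_opp (V := R_NormedModule)). Qed.

Lemma continuous_Rcomp (g : R -> R) (f : T -> R) x :
  continuous f x -> continuous g (f x) -> continuous (fun s => g (f s)) x.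
Proof. intros; now apply continuous_comp. Qed.

Lemma continuous_inv (f : T -> R) x : continuous f x -> f x <> 0 -> continuous (fun s => / f s) x.
Proof. intros Hf H0. apply (continuous_Rcomp Rinv); [exact Hf|apply continuous_Rinv, H0]. Qed.

Lemma cont_plus u v x : cont u x -> cont v x -> cont (fun s => u s + v s)%C x.
Proof. intros [H1 H2] [H3 H4]; split; simpl; now apply continuous_Rplus. Qed.

Lemma cont_opp u x : cont u x -> cont (fun s => - u s)%C x.
Proof. intros [H1 H2]; split; simpl; now apply continuous_Ropp. Qed.

Lemma cont_minus u v x : cont u x -> cont v x -> cont (fun s => u s - v s)%C x.
Proof. intros H1 H2; apply cont_plus; [|apply cont_opp]; assumption. Qed.

Lemma cont_mult u v x : cont u x -> cont v x -> cont (fun s => u s * v s)%C x.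
Proof.
intros [H1 H2] [H3 H4]; split.
- apply continuous_Rplus; [|apply continuous_Ropp]; apply continuous_Rmult; assumption.
- apply continuous_Rplus; apply continuous_Rmult; assumption.
Qed.

Lemma cont_inv u x : cont u x -> u x <> RtoC 0 -> cont (fun s => / u s)%C x.
Proof.
intros [H1 H2] H0. pose proof (sqnorm_pos _ H0) as Hp.
assert (Hi : continuous (fun s => / (fst (u s) * (fst (u s) * 1) + snd (u s) * (snd (u s) * 1))) x).
{ apply continuous_inv; [|lra].
  apply continuous_Rplus; apply continuous_Rmult; try assumption;
  apply continuous_Rmult; try assumption; apply continuous_const. }
split; simpl; apply continuous_Rmult; try assumption. now apply continuous_Ropp.
Qed.

Lemma cont_Cexp u x : cont u x -> cont (fun s => Cexp (u s)) x.
Proof.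
intros [H1 H2]; split; simpl; apply continuous_Rmult.
- apply (continuous_Rcomp exp); [assumption|apply continuous_exp].
- apply (continuous_Rcomp cos); [assumption|apply continuous_cos].
- apply (continuous_Rcomp exp); [assumption|apply continuous_exp].
- apply (continuous_Rcomp sin); [assumption|apply continuous_sin].
Qed.

Lemma cont_Log u x : cont u x -> 0 < Re (u x) -> cont (fun s => Log (u s)) x.
Proof.
intros [H1 H2] H0; split; simpl.
- apply continuous_Rmult; [|apply continuous_const].
  apply (continuous_Rcomp ln).
  + apply continuous_Rplus; now apply continuous_Rmult.
  + apply continuous_ln. nra.
- apply (continuous_Rcomp atan); [|apply continuous_atan].
  apply continuous_Rmult; [assumption|]. apply continuous_inv; [assumption|lra].
Qed.

Lemma cont_comp (g : C -> C) u x : cont u x -> cont g (u x) -> cont (fun s => g (u s)) x.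
Proof.
intros [H1 H2] [H3 H4].
assert (Hu : continuous u x).
{ apply filterlim_locally. intros eps.
  pose proof (proj1 (filterlim_locally _ _) H1 eps) as E1.
  pose proof (proj1 (filterlim_locally _ _) H2 eps) as E2.
  generalize (filter_and _ _ E1 E2). apply filter_imp. intros s [A B]; split; assumption. }
split.
- exact (continuous_comp u (fun z => Re (g z)) x Hu H3).
- exact (continuous_comp u (fun z => Im (g z)) x Hu H4).
Qed.

Lemma cont_Cmod u x : cont u x -> continuous (fun s => Cmod (u s)) x.
Proof.
intros [H1 H2]. unfold Cmod. apply (continuous_Rcomp sqrt); [|apply continuous_sqrt].
apply continuous_Rplus; simpl; (apply continuous_Rmult; [assumption|]);
  (apply continuous_Rmult; [assumption|apply continuous_const]).
Qed.

End Cont.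

Lemma cder_cont (u : R -> C) (t : R) (a : C) : cder u t a -> cont u t.
Proof.
intros [H1 H2]; split; (apply (ex_derive_continuous (V := R_NormedModule)); eexists; eassumption).
Qed.

(** * Mean value inequalities and complex integrals *)


Lemma is_derive_continuity_pt (f : R -> R) (x l : R) : is_derive f x l -> continuity_pt f x.
Proof.
intros H. apply continuity_pt_filterlim.
apply (ex_derive_continuous (V := R_NormedModule)). eexists; exact H.
Qed.

Lemma derive_le (f df : R -> R) (a b : R) : a <= b ->
  (forall t, a <= t <= b -> is_derive f t (df t)) ->
  (forall t, a <= t <= b -> 0 <= df t) -> f a <= f b.
Proof.
intros Hab Hd Hp.
destruct (MVT_gen f a b df) as [c [Hc E]].
- rewrite Rmin_left, Rmax_right by lra. intros x Hx. apply Hd. lra.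
- rewrite Rmin_left, Rmax_right by lra. intros x Hx.
  eapply is_derive_continuity_pt, Hd; lra.
- rewrite Rmin_left, Rmax_right in Hc by lra. specialize (Hp c Hc). nra.
Qed.

Lemma derive_lt (f df : R -> R) (a b : R) : a < b ->
  (forall t, a <= t <= b -> is_derive f t (df t)) ->
  (forall t, a < t < b -> 0 < df t) -> f a < f b.
Proof.
intros Hab Hd Hp.
destruct (MVT_cor2 f df a b Hab) as [c [E Hc]].
- intros c Hc. apply is_derive_Reals, Hd, Hc.
- assert (0 < df c) by (apply Hp; lra). nra.
Qed.

Lemma Re_le_Cmod (z : C) : Re z <= Cmod z.
Proof. pose proof (re_le_Cmod z) as H. apply Rabs_le_between in H. lra. Qed.

Lemma Im_le_Cmod (z : C) : Rabs (Im z) <= Cmod z.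
Proof.
pose proof (Rmax_Cmod z) as H. eapply Rle_trans; [|exact H]. apply Rmax_r.
Qed.

Lemma Re_scal (a : R) (z : C) : Re (RtoC a * z)%C = a * Re z.
Proof. unfold Re, Im; simpl; ring. Qed.

Lemma Im_scal (a : R) (z : C) : Im (RtoC a * z)%C = a * Im z.
Proof. unfold Re, Im; simpl; ring. Qed.

Lemma Re_conj_mult (z : C) : Re (Cconj z * z)%C = Cmod z * Cmod z.
Proof.
pose proof (Cmod2_alt z) as H. destruct z as [x y]; simpl in *.
unfold Re, Im in *; simpl in *. lra.
Qed.

(** The choice [c = Cconj z] gives [|z|^2 <= |z| K]. Estimates of moduli thereby reduce to estimates
    of real functions [Re (c * _)] with [c] fixed. *)
Lemma Cmod_le_dual (z : C) (K : R) : 0 <= K ->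
  (forall c : C, Re (c * z)%C <= Cmod c * K) -> Cmod z <= K.
Proof.
intros HK H. specialize (H (Cconj z)). rewrite Re_conj_mult, Cmod_conj in H.
pose proof (Cmod_ge_0 z). nra.
Qed.

Lemma cder_scal_Re (c : C) (u : R -> C) (t : R) (a : C) :
  cder u t a -> is_derive (fun s => Re (c * u s)%C) t (Re (c * a)%C).
Proof. intros H. exact (proj1 (cder_scal c _ _ _ H)). Qed.

(** The mean value theorem fails for curves, but it applies to [Re (c * u t)] for each [c]; the
    intermediate point depends on [c], the bound does not. *)
Lemma cder_bound (u du : R -> C) (a b K : R) : a <= b ->
  (forall t, a <= t <= b -> cder u t (du t)) ->
  (forall t, a <= t <= b -> Cmod (du t) <= K) ->
  Cmod (u b - u a)%C <= K * (b - a).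
Proof.
intros Hab Hd HK.
assert (K0 : 0 <= K) by (eapply Rle_trans; [apply Cmod_ge_0|apply (HK a); lra]).
apply Cmod_le_dual; [apply Rmult_le_pos; lra|]. intros c.
destruct (MVT_gen (fun t => Re (c * u t)%C) a b (fun t => Re (c * du t)%C)) as [x [Hx E]].
- rewrite Rmin_left, Rmax_right by lra. intros x Hx. apply cder_scal_Re, Hd; lra.
- rewrite Rmin_left, Rmax_right by lra. intros x Hx.
  eapply is_derive_continuity_pt, cder_scal_Re, Hd; lra.
- rewrite Rmin_left, Rmax_right in Hx by lra.
  replace (Re (c * (u b - u a))%C) with (Re (c * u b)%C - Re (c * u a)%C)
    by (unfold Re; simpl; ring).
  rewrite E. rewrite <- Rmult_assoc. apply Rmult_le_compat_r; [lra|].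
  eapply Rle_trans; [apply Re_le_Cmod|]. rewrite Cmod_mult.
  apply Rmult_le_compat_l; [apply Cmod_ge_0|apply HK, Hx].
Qed.

Lemma Cmod_minus_0 (a b : C) : Cmod (a - b)%C <= 0 -> a = b.
Proof.
intros H. assert (E : Cmod (a - b)%C = 0) by (pose proof (Cmod_ge_0 (a - b)%C); lra).
apply Cmod_eq_0 in E. replace a with (a - b + b)%C by ring. rewrite E; ring.
Qed.

Lemma cder_zero (u : R -> C) (a b : R) : a <= b ->
  (forall t, a <= t <= b -> cder u t (RtoC 0)) -> u b = u a.
Proof.
intros Hab H. apply Cmod_minus_0.
eapply Rle_trans; [apply (cder_bound u (fun _ => RtoC 0) a b 0); auto|lra].
intros; rewrite Cmod_0; lra.
Qed.

(** * Riemann sums with an explicit error *)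

Fixpoint csum (f : nat -> C) (n : nat) : C :=
  match n with O => RtoC 0 | S m => (csum f m + f m)%C end.

Lemma csum_ext (f g : nat -> C) (n : nat) :
  (forall k, (k < n)%nat -> f k = g k) -> csum f n = csum g n.
Proof.
induction n; intros H; simpl; [reflexivity|]. rewrite IHn, H; auto.
Qed.

Lemma csum_scal (c : C) (f : nat -> C) (n : nat) :
  csum (fun k => c * f k)%C n = (c * csum f n)%C.
Proof. induction n; simpl; [ring|rewrite IHn; ring]. Qed.

(** On a cell with left end [a], the function [u t - t * du a] has derivative [du t - du a], of
    modulus at most [M] times the cell length. Each of the [N] cells therefore contributes at most
    [M / N^2]. *)
Lemma riemann_sum (u du ddu : R -> C) (M : R) (n : nat) :
  (forall t, 0 <= t <= 1 -> cder u t (du t)) ->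
  (forall t, 0 <= t <= 1 -> cder du t (ddu t)) ->
  (forall t, 0 <= t <= 1 -> Cmod (ddu t) <= M) ->
  Cmod (u 1 - u 0 - csum (fun k => RtoC (/ INR (S n)) * du (INR k / INR (S n))%R)%C (S n))%C
    <= M / INR (S n).
Proof.
intros H1 H2 H3. set (N := INR (S n)).
assert (HN : 0 < N) by (apply lt_0_INR; lia).
assert (M0 : 0 <= M) by (eapply Rle_trans; [apply Cmod_ge_0|apply (H3 0); lra]).
assert (Hcell : forall a b, 0 <= a <= b -> b <= 1 ->
  Cmod (u b - u a - RtoC (b - a) * du a)%C <= M * (b - a) * (b - a)).
{ intros a b Hab Hb.
  replace (u b - u a - RtoC (b - a) * du a)%C
    with ((u b - RtoC b * du a) - (u a - RtoC a * du a))%C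
    by (rewrite RtoC_minus; ring).
  apply (cder_bound (fun t => u t - RtoC t * du a)%C (fun t => du t - du a)%C); [lra| |].
  - intros t Ht. apply cder_minus; [apply H1; lra|].
    eapply cder_eq; [apply cder_mult; [apply cder_id|apply cder_const]|cbv beta; ring].
  - intros t Ht. eapply Rle_trans.
    + apply (cder_bound du ddu a t M); [lra| |]; intros s Hs; [apply H2|apply H3]; lra.
    + apply Rmult_le_compat_l; lra. }
assert (Hind : forall m, (m <= S n)%nat ->
  Cmod (u (INR m / N)%R - u 0 - csum (fun k => RtoC (/ N) * du (INR k / N)%R)%C m)%C
    <= M * INR m / (N * N)).
{ induction m; intros Hm.
  - simpl. unfold Rdiv. rewrite Rmult_0_l, Rmult_0_r, Rmult_0_l.
    replace (u 0 - u 0 - 0)%C with (RtoC 0) by ring. rewrite Cmod_0; lra.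
  - assert (Hm1 : INR (S m) <= N) by (apply le_INR; lia).
    pose proof (pos_INR m) as Hm0.
    specialize (IHm ltac:(lia)).
    specialize (Hcell (INR m / N) (INR (S m) / N)).
    rewrite S_INR in *.
    assert (E : (INR m + 1) / N - INR m / N = / N) by (field; lra).
    rewrite E in Hcell.
    change (csum (fun k => RtoC (/ N) * du (INR k / N)%R)%C (S m))
      with (csum (fun k => RtoC (/ N) * du (INR k / N)%R)%C m + RtoC (/ N) * du (INR m / N)%R)%C.
    replace (u ((INR m + 1) / N)%R - u 0 -
      (csum (fun k => RtoC (/ N) * du (INR k / N)%R)%C m + RtoC (/ N) * du (INR m / N)%R))%C
    with ((u (INR m / N)%R - u 0 - csum (fun k => RtoC (/ N) * du (INR k / N)%R)%C m) +
      (u ((INR m + 1) / N)%R - u (INR m / N)%R - RtoC (/ N) * du (INR m / N)%R))%C by ring.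
    eapply Rle_trans; [apply Cmod_triangle|].
    replace (M * (INR m + 1) / (N * N)) with (M * INR m / (N * N) + M * / N * / N)
      by (field; lra).
    apply Rplus_le_compat; [exact IHm|].
    apply Hcell.
    + split; [apply Rle_mult_inv_pos; lra|].
      apply Rmult_le_compat_r; [apply Rlt_le, Rinv_0_lt_compat; lra|lra].
    + apply Rmult_le_reg_r with N; [lra|]. unfold Rdiv. rewrite Rmult_assoc, Rinv_l; lra. }
specialize (Hind (S n) (Nat.le_refl _)). fold N in Hind.
replace (N / N) with 1 in Hind by (field; lra).
replace (M * N / (N * N)) with (M / N) in Hind by (field; lra).
exact Hind.
Qed.

(** * Integrals of complex-valued functions of a real variable *)

Definition CInt (u : R -> C) (a b : R) : C :=
  (RInt (fun t => Re (u t)) a b, RInt (fun t => Im (u t)) a b).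

Lemma ex_RInt_on (f : R -> R) (a b : R) : a <= b ->
  (forall t, a <= t <= b -> continuous f t) -> ex_RInt f a b.
Proof.
intros Hab H. apply (ex_RInt_continuous (V := R_CompleteNormedModule)).
rewrite Rmin_left, Rmax_right by lra. exact H.
Qed.

Lemma ex_RInt_cont (u : R -> C) (a b : R) : a <= b -> (forall t, a <= t <= b -> cont u t) ->
  ex_RInt (fun t => Re (u t)) a b /\ ex_RInt (fun t => Im (u t)) a b.
Proof.
intros Hab H. split; apply ex_RInt_on; auto; intros t Ht.
- exact (proj1 (H t Ht)).
- exact (proj2 (H t Ht)).
Qed.

(** The bridge to real integrals: together with [Ceq_dual] and [Cmod_le_dual] it yields complex
    linearity and the bound of the modulus. *)
Lemma CInt_Re_scal (c : C) (u : R -> C) (a b : R) : a <= b ->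
  (forall t, a <= t <= b -> cont u t) ->
  Re (c * CInt u a b)%C = RInt (fun t => Re (c * u t)%C) a b.
Proof.
intros Hab H.
destruct (ex_RInt_cont u a b Hab H) as [E1 E2].
symmetry. apply is_RInt_unique.
apply (RInt_correct (V := R_CompleteNormedModule)) in E1, E2.
exact (is_RInt_minus (V := R_NormedModule) _ _ _ _ _ _
  (is_RInt_scal (V := R_NormedModule) _ _ _ (Re c) _ E1)
  (is_RInt_scal (V := R_NormedModule) _ _ _ (Im c) _ E2)).
Qed.

Lemma Ceq_dual (z w : C) : (forall c : C, Re (c * z)%C = Re (c * w)%C) -> z = w.
Proof.
intros H. apply Ceq_ext.
- specialize (H (RtoC 1)). unfold Re in *; simpl in H. lra.
- specialize (H Ci). unfold Re, Im in *; simpl in H. lra.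
Qed.

Lemma cont_scal_Re {T : UniformSpace} (c : C) (u : T -> C) (x : T) :
  cont u x -> continuous (fun t => Re (c * u t)%C) x.
Proof. intros H. exact (proj1 (cont_mult _ _ _ (cont_const c x) H)). Qed.

Lemma CInt_scal (c : C) (u : R -> C) (a b : R) : a <= b ->
  (forall t, a <= t <= b -> cont u t) ->
  CInt (fun t => c * u t)%C a b = (c * CInt u a b)%C.
Proof.
intros Hab H. apply Ceq_dual. intros d.
rewrite CInt_Re_scal; [|lra|intros; apply cont_mult; [apply cont_const|auto]].
rewrite Cmult_assoc, CInt_Re_scal by auto.
apply RInt_ext. intros. f_equal; ring.
Qed.

Lemma CInt_plus (u v : R -> C) (a b : R) : a <= b ->
  (forall t, a <= t <= b -> cont u t) -> (forall t, a <= t <= b -> cont v t) ->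
  CInt (fun t => u t + v t)%C a b = (CInt u a b + CInt v a b)%C.
Proof.
intros Hab Hu Hv.
destruct (ex_RInt_cont u a b Hab Hu). destruct (ex_RInt_cont v a b Hab Hv).
apply Ceq_ext; simpl; now apply (RInt_plus (V := R_CompleteNormedModule)).
Qed.

Lemma CInt_ext (u v : R -> C) (a b : R) : a <= b ->
  (forall t, a <= t <= b -> u t = v t) -> CInt u a b = CInt v a b.
Proof.
intros Hab H. unfold CInt. f_equal; apply RInt_ext; rewrite Rmin_left, Rmax_right by lra;
  intros t Ht; rewrite H; auto; lra.
Qed.

Lemma CInt_const (c : C) (a b : R) : CInt (fun _ => c) a b = (RtoC (b - a) * c)%C.
Proof.
apply Ceq_ext; simpl; rewrite (RInt_const (V := R_CompleteNormedModule)); unfold scal; simpl;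
  unfold mult; simpl; ring_simplify; unfold Re, Im; ring.
Qed.

Lemma CInt_bound (u : R -> C) (g : R -> R) (a b : R) : a <= b ->
  (forall t, a <= t <= b -> cont u t) -> (forall t, a <= t <= b -> continuous g t) ->
  (forall t, a <= t <= b -> Cmod (u t) <= g t) ->
  Cmod (CInt u a b) <= RInt g a b.
Proof.
intros Hab Hu Hg H.
assert (Eg : ex_RInt g a b) by now apply ex_RInt_on.
apply Cmod_le_dual.
- apply RInt_ge_0; [lra|exact Eg|]. intros. eapply Rle_trans; [apply Cmod_ge_0|apply H; lra].
- intros c. rewrite CInt_Re_scal by auto.
  replace (Cmod c * RInt g a b) with (RInt (fun t => Cmod c * g t) a b)
    by exact (RInt_scal (V := R_CompleteNormedModule) g a b (Cmod c) Eg).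
  apply RInt_le; [lra| | |].
  + apply ex_RInt_on; [lra|]. intros; apply cont_scal_Re; auto.
  + apply ex_RInt_on; [lra|]. intros; apply continuous_Rmult; [apply continuous_const|auto].
  + intros t Ht. eapply Rle_trans; [apply Re_le_Cmod|]. rewrite Cmod_mult.
    apply Rmult_le_compat_l; [apply Cmod_ge_0|apply H; lra].
Qed.

Lemma CInt_bound_const (u : R -> C) (K a b : R) : a <= b ->
  (forall t, a <= t <= b -> cont u t) ->
  (forall t, a <= t <= b -> Cmod (u t) <= K) ->
  Cmod (CInt u a b) <= K * (b - a).
Proof.
intros Hab Hu H. eapply Rle_trans.
- apply (CInt_bound u (fun _ => K)); auto. intros; apply continuous_const.
- rewrite (RInt_const (V := R_CompleteNormedModule)). unfold scal; simpl; unfold mult; simpl. lra.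
Qed.

Lemma CInt_Chasles (u : R -> C) (a b c : R) : a <= b -> b <= c ->
  (forall t, a <= t <= c -> cont u t) ->
  CInt u a c = (CInt u a b + CInt u b c)%C.
Proof.
intros Hab Hbc H.
destruct (ex_RInt_cont u a b Hab) as [A1 A2]; [intros; apply H; lra|].
destruct (ex_RInt_cont u b c Hbc) as [B1 B2]; [intros; apply H; lra|].
apply Ceq_ext; simpl; symmetry; now apply (RInt_Chasles (V := R_CompleteNormedModule)).
Qed.

Lemma CInt_FTC (Z d : R -> C) (a b : R) : a <= b ->
  (forall t, a <= t <= b -> cder Z t (d t)) ->
  (forall t, a <= t <= b -> cont d t) ->
  CInt d a b = (Z b - Z a)%C.
Proof.
intros Hab Hz Hc.
apply Ceq_ext; simpl; apply is_RInt_unique.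
- apply (is_RInt_derive (V := R_CompleteNormedModule) (fun t => Re (Z t)) (fun t => Re (d t)));
  rewrite Rmin_left, Rmax_right by lra; intros t Ht; [apply Hz|apply Hc]; lra.
- apply (is_RInt_derive (V := R_CompleteNormedModule) (fun t => Im (Z t)) (fun t => Im (d t)));
  rewrite Rmin_left, Rmax_right by lra; intros t Ht; [apply Hz|apply Hc]; lra.
Qed.

(** Differentiation under the integral sign. The hypotheses live on an open rectangle around [{x} *
    [a,b]], which supplies the neighbourhoods needed at the end points too. *)
Lemma is_derive_param (f d : R -> R -> R) (lo hi a' b' a b x : R) :
  lo < x < hi -> a' < a -> a <= b -> b < b' ->
  (forall y t, lo < y < hi -> a' < t < b' -> is_derive (fun y => f y t) y (d y t)) ->
  (forall t, a' < t < b' -> continuous (fun q : R * R => d (fst q) (snd q)) (x, t)) ->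
  (forall y t, lo < y < hi -> a' < t < b' -> continuous (fun t => f y t) t) ->
  is_derive (fun y => RInt (f y) a b) x (RInt (d x) a b).
Proof.
intros Hx Ha Hab Hb Hd Hc Hf.
assert (Hl : locally x (fun y => lo < y < hi)).
{ apply (open_and (fun y => lo < y) (fun y => y < hi)); [apply open_gt|apply open_lt|exact Hx]. }
replace (RInt (d x) a b) with (RInt (fun t => Derive (fun u => f u t) x) a b).
- apply (is_derive_RInt_param f a b x).
  + eapply filter_imp; [|exact Hl]. rewrite Rmin_left, Rmax_right by lra.
    intros y Hy t Ht. exists (d y t). apply Hd; lra.
  + rewrite Rmin_left, Rmax_right by lra. intros t Ht.
    apply (continuity_2d_pt_ext_loc d).
    * apply locally_2d_locally.
      assert (Hl' : locally t (fun s => a' < s < b')).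
      { apply (open_and (fun y => a' < y) (fun y => y < b')); [apply open_gt|apply open_lt|lra]. }
      destruct Hl as [e1 E1], Hl' as [e2 E2].
      assert (He : 0 < Rmin e1 e2) by (apply Rmin_glb_lt; [apply e1|apply e2]).
      exists (mkposreal _ He). intros [u v] [B1 B2]. simpl in *.
      symmetry. apply is_derive_unique, Hd.
      -- apply E1. eapply ball_le; [|exact B1]. apply Rmin_l.
      -- apply E2. eapply ball_le; [|exact B2]. apply Rmin_r.
    * apply continuity_2d_pt_filterlim. apply Hc. lra.
  + eapply filter_imp; [|exact Hl]. intros y Hy. apply ex_RInt_on; [lra|].
    intros t Ht. apply Hf; lra.
- apply RInt_ext. rewrite Rmin_left, Rmax_right by lra. intros t Ht.
  apply is_derive_unique, Hd; lra.
Qed.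

(* If [f dt + Z dx] is closed, the integral of [f] over [a,b] changes with [x] only
   through the end values of [Z]. *)
Lemma homotopy (f Z d : R -> R -> C) (lo hi a' b' a b x0 x1 K : R) :
  lo < x0 -> x0 <= x1 -> x1 < hi -> a' < a -> a <= b -> b < b' ->
  (forall x t, lo < x < hi -> a' < t < b' -> cder (fun x => f x t) x (d x t)) ->
  (forall x t, lo < x < hi -> a' < t < b' -> cder (fun t => Z x t) t (d x t)) ->
  (forall x t, lo < x < hi -> a' < t < b' ->
     cont (fun q : R * R => d (fst q) (snd q)) (x, t)) ->
  (forall x t, lo < x < hi -> a' < t < b' -> cont (fun t => f x t) t) ->
  (forall x, x0 <= x <= x1 -> Cmod (Z x b - Z x a)%C <= K) ->
  Cmod (CInt (f x1) a b - CInt (f x0) a b)%C <= K * (x1 - x0).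
Proof.
intros H0 H01 H1 Ha Hab Hb Hf Hz Hd Hc HK.
assert (Hd' : forall x t, lo < x < hi -> a' < t < b' -> cont (d x) t).
{ intros x t Hx Ht. destruct (Hd x t Hx Ht) as [D1 D2].
  split.
  - apply (continuous_comp_2 (fun _ => x) (fun t => t) (fun x t => Re (d x t)));
      [apply continuous_const|apply continuous_id|exact D1].
  - apply (continuous_comp_2 (fun _ => x) (fun t => t) (fun x t => Im (d x t)));
      [apply continuous_const|apply continuous_id|exact D2]. }
apply (cder_bound (fun x => CInt (f x) a b) (fun x => CInt (d x) a b)); [exact H01| |].
- intros x Hx. split; simpl.
  + apply (is_derive_param (fun x t => Re (f x t)) (fun x t => Re (d x t)) lo hi a' b'); try lra.
    * intros y t Hy Ht. exact (proj1 (Hf y t Hy Ht)).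
    * intros t Ht. exact (proj1 (Hd x t ltac:(lra) Ht)).
    * intros y t Hy Ht. exact (proj1 (Hc y t Hy Ht)).
  + apply (is_derive_param (fun x t => Im (f x t)) (fun x t => Im (d x t)) lo hi a' b'); try lra.
    * intros y t Hy Ht. exact (proj2 (Hf y t Hy Ht)).
    * intros t Ht. exact (proj2 (Hd x t ltac:(lra) Ht)).
    * intros y t Hy Ht. exact (proj2 (Hc y t Hy Ht)).
- intros x Hx. rewrite (CInt_FTC (Z x) (d x)); [apply HK; exact Hx|lra| |].
  + intros t Ht. apply Hz; lra.
  + intros t Ht. apply Hd'; lra.
Qed.

(** * Powers of 1 - w and Dirichlet averaging *)


Lemma Cexp_plus (z w : C) : Cexp (z + w)%C = (Cexp z * Cexp w)%C.
Proof.
unfold Cexp. apply Ceq_ext; simpl; unfold Re, Im; simpl;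
  rewrite exp_plus, ?cos_plus, ?sin_plus; ring.
Qed.

Lemma Cexp_0 : Cexp (RtoC 0) = RtoC 1.
Proof. unfold Cexp; simpl. rewrite exp_0, cos_0, sin_0. apply Ceq_ext; simpl; ring. Qed.

Lemma Cmod_Cexp (z : C) : Cmod (Cexp z) = exp (Re z).
Proof.
unfold Cmod, Cexp; simpl.
replace (_ + _) with ((exp (Re z))²).
- rewrite sqrt_Rsqr; [reflexivity|]. left; apply exp_pos.
- pose proof (sin2_cos2 (Im z)) as H. unfold Rsqr in *.
  set (x := exp (Re z)) in *. set (s := sin (Im z)) in *. set (c := cos (Im z)) in *.
  replace (x * c * (x * c * 1) + x * s * (x * s * 1)) with (x * x * (s * s + c * c)) by ring.
  rewrite H; ring.
Qed.

Lemma Re_pos_neq0 (z : C) : 0 < Re z -> z <> RtoC 0.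
Proof. intros H ->. simpl in H. lra. Qed.

Lemma Cexp_Log (z : C) : 0 < Re z -> Cexp (Log z) = z.
Proof. intros H. rewrite <- Clog_Log by exact H. apply Cexp_Clog, Re_pos_neq0, H. Qed.

Lemma Re_Log (z : C) : 0 < Re z -> Re (Log z) = ln (Cmod z).
Proof. intros H. rewrite <- Clog_Log by exact H. reflexivity. Qed.

(** The power [(1-w)^(-a)], meaningful for [Re w < 1]. The laws in the exponent use only the
    exponential and so hold for all [w]. *)
Definition invpow (a : R) (w : C) : C := Cexp (RtoC (- a) * Log (RtoC 1 - w))%C.

Lemma invpow_plus (a b : R) (w : C) : invpow (a + b) w = (invpow a w * invpow b w)%C.
Proof.
unfold invpow. rewrite <- Cexp_plus. f_equal. rewrite Ropp_plus_distr, RtoC_plus. ring.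
Qed.

Lemma invpow_0 (w : C) : invpow 0 w = RtoC 1.
Proof. unfold invpow. rewrite Ropp_0, Cmult_0_l. apply Cexp_0. Qed.

Lemma invpow_opp (a : R) (w : C) : (invpow a w * invpow (- a) w)%C = RtoC 1.
Proof. rewrite <- invpow_plus, Rplus_opp_r. apply invpow_0. Qed.

Lemma invpow_neq0 (a : R) (w : C) : invpow a w <> RtoC 0.
Proof.
intros H. pose proof (invpow_opp a w) as H1. rewrite H, Cmult_0_l in H1.
apply (f_equal Re) in H1. simpl in H1. lra.
Qed.

Lemma Re_1_minus (w : C) : Re w < 1 -> 0 < Re (RtoC 1 - w)%C.
Proof. intros H. unfold Re in *; simpl. lra. Qed.

Lemma invpow_1 (w : C) : Re w < 1 -> (invpow 1 w * (RtoC 1 - w))%C = RtoC 1.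
Proof.
intros H. pose proof (Re_1_minus _ H) as H1.
rewrite <- (Cexp_Log (RtoC 1 - w)%C) at 1 by exact H1.
unfold invpow. rewrite <- Cexp_plus.
replace (RtoC (- (1)) * Log (RtoC 1 - w) + Log (RtoC 1 - w))%C with (RtoC 0).
- apply Cexp_0.
- rewrite RtoC_opp; ring.
Qed.

Lemma invpow_pred (a : R) (w : C) : Re w < 1 -> invpow (a - 1) w = (invpow a w * (RtoC 1 - w))%C.
Proof.
intros H. replace a with (a - 1 + 1) at 2 by ring. rewrite invpow_plus.
rewrite <- Cmult_assoc, invpow_1 by exact H. ring.
Qed.

Lemma invpow_at_0 (a : R) : invpow a (RtoC 0) = RtoC 1.
Proof.
unfold invpow. replace (RtoC 1 - RtoC 0)%C with (RtoC 1) by ring.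
replace (Log (RtoC 1)) with (RtoC 0); [rewrite Cmult_0_r; apply Cexp_0|].
unfold Log; apply Ceq_ext; simpl.
- rewrite Rmult_0_l, Rplus_0_r, Rmult_1_l, ln_1. lra.
- unfold Rdiv. rewrite Rmult_0_l, atan_0. reflexivity.
Qed.

Lemma cder_invpow (a : R) (u : R -> C) (t : R) (v : C) :
  cder u t v -> Re (u t) < 1 ->
  cder (fun s => invpow a (u s)) t (RtoC a * v * invpow (a + 1) (u t))%C.
Proof.
intros Hu H. pose proof (Re_1_minus _ H) as H1.
unfold invpow. eapply cder_eq.
- apply cder_Cexp, cder_scal, cder_Log; [|exact H1].
  apply cder_minus; [apply cder_const|exact Hu].
- cbv beta. fold (invpow a (u t)). fold (invpow (a + 1) (u t)).
  rewrite invpow_plus. pose proof (invpow_1 _ H) as H2. pose proof (Re_pos_neq0 _ H1) as H3.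
  replace (invpow 1 (u t)) with (/ (RtoC 1 - u t))%C.
  + rewrite RtoC_opp. field. exact H3.
  + apply (f_equal (fun x => x * / (RtoC 1 - u t))%C) in H2.
    rewrite <- Cmult_assoc, Cinv_r, Cmult_1_r, Cmult_1_l in H2 by exact H3. now symmetry.
Qed.

Lemma cont_invpow {T : UniformSpace} (a : R) (u : T -> C) (x : T) :
  cont u x -> Re (u x) < 1 -> cont (fun s => invpow a (u s)) x.
Proof.
intros Hu H. unfold invpow. apply cont_Cexp, cont_mult; [apply cont_const|].
apply cont_Log; [|apply Re_1_minus, H]. apply cont_minus; [apply cont_const|exact Hu].
Qed.

Lemma Re_lt_1 (w : C) : Cmod w < 1 -> Re w < 1.
Proof. intros H. pose proof (Re_le_Cmod w). lra. Qed.

Lemma Cmod_rev_triangle (z w : C) : Cmod z - Cmod w <= Cmod (z - w)%C.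
Proof.
pose proof (Cmod_triangle (z - w)%C w) as H.
replace (z - w + w)%C with z in H by ring. lra.
Qed.

Lemma Cmod_minus_le (z w : C) : Cmod (z - w)%C <= Cmod z + Cmod w.
Proof. unfold Cminus. rewrite <- (Cmod_opp w). apply Cmod_triangle. Qed.

Lemma Cmod_invpow (a : R) (w : C) : Re w < 1 -> Cmod (invpow a w) = exp (- a * ln (Cmod (RtoC 1 - w)%C)).
Proof.
intros H. unfold invpow. rewrite Cmod_Cexp, Re_scal, Re_Log; [reflexivity|apply Re_1_minus, H].
Qed.

(** From [1 - r <= |1-w| <= 1 + r <= 1/(1-r)] the logarithm of [|1-w|] has absolute value at most
    [- ln (1-r)], which serves both signs of [a]. *)
Lemma invpow_bound (a r : R) (w : C) : r < 1 -> Cmod w <= r ->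
  Cmod (invpow a w) <= exp (Rabs a * - ln (1 - r)).
Proof.
intros Hr Hw. assert (H : Re w < 1) by (apply Re_lt_1; lra).
rewrite Cmod_invpow by exact H.
assert (H1 : 1 - r <= Cmod (RtoC 1 - w)%C).
{ eapply Rle_trans; [|apply Cmod_rev_triangle]. rewrite Cmod_1. lra. }
assert (H2 : Cmod (RtoC 1 - w)%C <= 1 + r).
{ eapply Rle_trans; [apply Cmod_minus_le|]. rewrite Cmod_1; lra. }
pose proof (Cmod_ge_0 w) as Hw0.
assert (H3 : Rabs (ln (Cmod (RtoC 1 - w)%C)) <= - ln (1 - r)).
{ apply Rabs_le. rewrite Ropp_involutive. split.
  - apply ln_le; lra.
  - rewrite <- ln_Rinv by lra. apply ln_le; [lra|].
    apply Rmult_le_reg_r with (1 - r); [lra|]. rewrite Rinv_l by lra. nra. }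
assert (H4 : - a * ln (Cmod (RtoC 1 - w)%C) <= Rabs a * - ln (1 - r)).
{ eapply Rle_trans; [apply Rle_abs|]. rewrite Rabs_mult, Rabs_Ropp.
  apply Rmult_le_compat_l; [apply Rabs_pos|exact H3]. }
destruct H4 as [H4|H4]; [left; now apply exp_increasing|right; now rewrite H4].
Qed.

(** * Real powers and the Beta weight *)

Lemma is_derive_Rpower (a x : R) : 0 < x ->
  is_derive (fun s => Rpower s a) x (a * Rpower x (a - 1)).
Proof.
intros H. apply is_derive_Reals. apply derivable_pt_lim_power, H.
Qed.

Lemma continuous_Rpower {T : UniformSpace} (a : R) (f : T -> R) (x : T) :
  continuous f x -> 0 < f x -> continuous (fun s => Rpower (f s) a) x.
Proof.
intros Hf H. unfold Rpower. apply (continuous_Rcomp exp); [|apply continuous_exp].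
apply continuous_Rmult; [apply continuous_const|].
apply (continuous_Rcomp ln); [exact Hf|apply continuous_ln, H].
Qed.

(** The Beta density without its normalising factor. It is unbounded at an end when the
    corresponding exponent is below 1, so all integrals against it are truncated to [[e, 1-e]]. *)
Definition beta_weight (a b s : R) : R := Rpower s (a - 1) * Rpower (1 - s) (b - 1).

Lemma beta_weight_pos (a b s : R) : 0 < beta_weight a b s.
Proof. apply Rmult_lt_0_compat; apply exp_pos. Qed.

Lemma continuous_beta_weight {T : UniformSpace} (a b : R) (f : T -> R) (x : T) :
  continuous f x -> 0 < f x < 1 -> continuous (fun s => beta_weight a b (f s)) x.
Proof.
intros Hf H. unfold beta_weight. apply continuous_Rmult; apply continuous_Rpower; try tauto; try lra.
apply continuous_Rplus; [apply continuous_const|now apply continuous_Ropp].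
Qed.

Lemma Rpower_succ (s a : R) : 0 < s -> Rpower s a = s * Rpower s (a - 1).
Proof.
intros H. rewrite <- (Rpower_1 s) at 2 by exact H. rewrite <- Rpower_plus. f_equal; ring.
Qed.

Lemma Rpower_le_1 (s a : R) : 0 < s <= 1 -> 0 <= a -> Rpower s a <= 1.
Proof.
intros Hs Ha. rewrite <- (Rpower_O s) by lra.
unfold Rpower. assert (H : ln s <= 0) by (rewrite <- ln_1; apply ln_le; lra).
assert (H1 : a * ln s <= 0 * ln s) by nra.
destruct H1 as [H1|H1]; [left; now apply exp_increasing|right; now rewrite H1].
Qed.

Lemma Rpower_anti (s a b : R) : 0 < s <= 1 -> a <= b -> Rpower s b <= Rpower s a.
Proof.
intros Hs Hab. replace b with (a + (b - a)) by ring. rewrite Rpower_plus.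
pose proof (Rpower_le_1 s (b - a) Hs ltac:(lra)).
pose proof (exp_pos (a * ln s)). unfold Rpower at 1 3. nra.
Qed.

Lemma Cmod_RtoC_pos (x : R) : 0 <= x -> Cmod (RtoC x) = x.
Proof. intros H. rewrite Cmod_R. now apply Rabs_pos_eq. Qed.

(** Runs from [w1] at [s = 0] to [w0] at [s = 1], so that the factor [s^(a-1)] of the weight goes
    with [w0]. *)
Definition seg (w0 w1 : C) (s : R) : C := (w1 + RtoC s * (w0 - w1))%C.

Lemma seg_bound (w0 w1 : C) (r s : R) : Cmod w0 <= r -> Cmod w1 <= r -> 0 <= s <= 1 ->
  Cmod (seg w0 w1 s) <= r.
Proof.
intros H0 H1 Hs. unfold seg.
replace (w1 + RtoC s * (w0 - w1))%C with (RtoC (1 - s) * w1 + RtoC s * w0)%C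
  by (rewrite RtoC_minus; ring).
eapply Rle_trans; [apply Cmod_triangle|]. rewrite !Cmod_mult, !Cmod_RtoC_pos by lra. nra.
Qed.

(** Slightly outside [[0,1]] the absolute values of the coefficients [s] and [1 - s] add up to less
    than [2 - r], and [r (2 - r) < 1]. The margin provides the open parameter interval that
    [homotopy] asks for. *)
Lemma seg_Re (w0 w1 : C) (r s : R) : r < 1 -> Cmod w0 <= r -> Cmod w1 <= r ->
  - ((1 - r) / 2) < s < 1 + (1 - r) / 2 -> Re (seg w0 w1 s) < 1.
Proof.
intros Hr H0 H1 Hs.
assert (A0 : - r <= Re w0 <= r) by (apply Rabs_le_between; eapply Rle_trans; [apply re_le_Cmod|exact H0]).
assert (A1 : - r <= Re w1 <= r) by (apply Rabs_le_between; eapply Rle_trans; [apply re_le_Cmod|exact H1]).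
replace (Re (seg w0 w1 s)) with ((1 - s) * Re w1 + s * Re w0)
  by (unfold seg, Re; simpl; ring).
destruct (Rle_lt_dec s 0); [|destruct (Rle_lt_dec s 1)]; nra.
Qed.

Section Merge.
Variables (a b r : R) (w0 w1 : C).
Hypotheses (Ha : 0 < a) (Hb : 0 < b) (Hr : r < 1) (H0 : Cmod w0 <= r) (H1 : Cmod w1 <= r).

Let dl := (w0 - w1)%C.
(** At [x = 1] this is [(1-w0)^a] times the integrand of the Beta average; at [x = 0] the powers
    collapse to [(1-w1)^(-b)]. Its [x]-derivative [d] is also the [s]-derivative of [Z], which
    contains the factor [s^a (1-s)^b] and so nearly vanishes at the ends. *)
Let f (x s : R) : C :=
  (RtoC (beta_weight a b s) * (invpow (- a) (seg w0 w1 x) * invpow (a + b) (seg w0 w1 (x * s))))%C.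
Let Z (x s : R) : C :=
  (- dl * invpow (1 - a) (seg w0 w1 x) *
   (RtoC (Rpower s a * Rpower (1 - s) b) * invpow (a + b) (seg w0 w1 (x * s))))%C.
Let d (x s : R) : C :=
  (RtoC (beta_weight a b s) * (dl *
    (RtoC (- a) * invpow (1 - a) (seg w0 w1 x) * invpow (a + b) (seg w0 w1 (x * s)) +
     RtoC ((a + b) * s) * invpow (- a) (seg w0 w1 x) * invpow (a + b + 1) (seg w0 w1 (x * s)))))%C.

Lemma cder_seg (g : R -> R) (t g' : R) : is_derive g t g' ->
  cder (fun t => seg w0 w1 (g t)) t (RtoC g' * dl)%C.
Proof.
intros Hg. unfold seg. eapply cder_eq.
- apply cder_plus; [apply cder_const|]. apply cder_mult; [apply cder_RtoC, Hg|apply cder_const].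
- unfold dl; ring.
Qed.

Lemma cont_seg {T : UniformSpace} (g : T -> R) (t : T) : continuous g t ->
  cont (fun t => seg w0 w1 (g t)) t.
Proof.
intros Hg. unfold seg. apply cont_plus; [apply cont_const|].
apply cont_mult; [apply cont_RtoC, Hg|apply cont_const].
Qed.

(** The truncated Beta average. Deforming [x] from [0] to [1] changes the integral only by values of
    [Z] at [e] and [1 - e], of order [e^(min a b)]; multiplication by [(1-w0)^(-a)] then removes the
    factor present at [x = 1]. The constant does not depend on [e]. *)
Lemma merge_pointwise : exists K : R, 0 <= K /\
  forall e, 0 < e <= 1 / 4 ->
  Cmod (RtoC (RInt (beta_weight a b) e (1 - e)) * (invpow a w0 * invpow b w1) -
        CInt (fun s => RtoC (beta_weight a b s) * invpow (a + b) (seg w0 w1 s)) e (1 - e))%C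
    <= K * Rpower e (Rmin a b).
Proof.
set (eta := (1 - r) / 2).
set (C1 := exp (Rabs (1 - a) * - ln (1 - r))).
set (C2 := exp (Rabs (a + b) * - ln (1 - r))).
set (C3 := exp (Rabs a * - ln (1 - r))).
assert (P1 : 0 < C1) by apply exp_pos. assert (P2 : 0 < C2) by apply exp_pos.
assert (P3 : 0 < C3) by apply exp_pos.
pose proof (Cmod_ge_0 dl) as Pd.
exists (C3 * (2 * (Cmod dl * C1 * C2))). split.
{ repeat apply Rmult_le_pos; lra. }
intros e He.
assert (Re1 : forall x, - eta < x < 1 + eta -> Re (seg w0 w1 x) < 1).
{ intros x Hx. apply seg_Re with r; auto. }
assert (Re2 : forall x s, - eta < x < 1 + eta -> 0 < s < 1 -> Re (seg w0 w1 (x * s)) < 1).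
{ intros x s Hx Hs. apply Re1. assert (0 < eta) by (unfold eta; lra).
  destruct (Rle_lt_dec x 0); nra. }
assert (Hm : Cmod (CInt (f 1) e (1 - e) - CInt (f 0) e (1 - e))%C <=
  2 * (Cmod dl * C1 * C2) * Rpower e (Rmin a b) * (1 - 0)).
{ apply (homotopy f Z d (- eta) (1 + eta) 0 1); try (unfold eta; lra).
  - intros x s Hx Hs. unfold f. eapply cder_eq.
    + apply cder_scal. apply cder_mult; apply cder_invpow.
      * apply (cder_seg (fun x => x)). apply (is_derive_id (K := R_AbsRing)).
      * apply Re1, Hx.
      * apply (cder_seg (fun x => x * s)). apply is_derive_Rmult;
        [apply (is_derive_id (K := R_AbsRing))|apply (is_derive_const (V := R_NormedModule))].
      * apply Re2; assumption.
    + cbv beta. unfold d. change (@one R_AbsRing) with 1. change (@zero R_NormedModule) with 0.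
      replace (- a + 1) with (1 - a) by ring.
      rewrite !RtoC_plus, !RtoC_mult, !RtoC_plus. ring.
  - intros x s Hx Hs. unfold Z. eapply cder_eq.
    + apply cder_scal. apply cder_mult; [apply cder_RtoC|apply cder_invpow].
      * apply is_derive_Rmult; [apply is_derive_Rpower; lra|].
        apply (is_derive_Rcomp (fun y => Rpower y b)); [apply is_derive_Rpower; lra|].
        apply is_derive_Rplus; [apply (is_derive_const (V := R_NormedModule))|].
        apply is_derive_Ropp, (is_derive_id (K := R_AbsRing)).
      * apply (cder_seg (fun s => x * s)). apply is_derive_Rmult;
        [apply (is_derive_const (V := R_NormedModule))|apply (is_derive_id (K := R_AbsRing))].
      * apply Re2; assumption.
    + cbv beta. unfold d. change (@one R_AbsRing) with 1. change (@zero R_NormedModule) with 0.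
      (* Once every power is expressed through the exponents [1 - a], [a + b + 1] and the real
         powers [s^(a-1)], [(1-s)^(b-1)], the equality of the two derivatives is a polynomial
         identity. *)
      assert (E1 : invpow (- a) (seg w0 w1 x) = (invpow (1 - a) (seg w0 w1 x) * (RtoC 1 - seg w0 w1 x))%C).
      { rewrite <- invpow_pred by (apply Re1; assumption). f_equal; ring. }
      assert (E2 : invpow (a + b) (seg w0 w1 (x * s)) =
        (invpow (a + b + 1) (seg w0 w1 (x * s)) * (RtoC 1 - seg w0 w1 (x * s)))%C).
      { rewrite <- invpow_pred by (apply Re2; assumption). f_equal; ring. }
      rewrite E1, E2. unfold beta_weight.
      rewrite (Rpower_succ s a), (Rpower_succ (1 - s) b) by lra.
      set (X := invpow (a + b + 1) (seg w0 w1 (x * s))). set (Y := invpow (1 - a) (seg w0 w1 x)).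
      set (p1 := Rpower s (a - 1)). set (p2 := Rpower (1 - s) (b - 1)).
      unfold seg, dl.
      repeat first [rewrite RtoC_plus|rewrite RtoC_mult|rewrite RtoC_minus|rewrite RtoC_opp].
      ring.
  - intros x s Hx Hs. unfold d.
    assert (Cx : continuous (fun q : R * R => fst q) (x, s)) by apply continuous_fst.
    assert (Cs : continuous (fun q : R * R => snd q) (x, s)) by apply continuous_snd.
    assert (Cxs : continuous (fun q : R * R => fst q * snd q) (x, s)) by (apply continuous_Rmult; assumption).
    apply cont_mult; [apply cont_RtoC, continuous_beta_weight; simpl; auto|].
    apply cont_mult; [apply cont_const|].
    assert (CE1 : forall e, cont (fun q : R * R => invpow e (seg w0 w1 (fst q))) (x, s))
      by (intros; apply cont_invpow; [now apply cont_seg|now apply Re1]).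
    assert (CE2 : forall e, cont (fun q : R * R => invpow e (seg w0 w1 (fst q * snd q))) (x, s))
      by (intros; apply cont_invpow; [now apply cont_seg|now apply Re2]).
    apply cont_plus; (apply cont_mult; [|apply CE2]); (apply cont_mult; [|apply CE1]).
    + apply cont_const.
    + apply cont_RtoC, continuous_Rmult; [apply continuous_const|assumption].
  - intros x s Hx Hs. unfold f.
    assert (Cxs : continuous (fun s => x * s) s)
      by (apply continuous_Rmult; [apply continuous_const|apply continuous_id]).
    apply cont_mult; [apply cont_RtoC, (continuous_beta_weight a b (fun s => s)); [apply continuous_id|auto]|].
    apply cont_mult; [apply cont_const|].
    apply cont_invpow; [apply cont_seg; assumption|apply Re2; assumption].
  - intros x Hx.
    (* At either end one of the factors [s^a], [(1-s)^b] is at most 1 and the other is a power of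
       [e] with exponent at least [Rmin a b]. *)
    assert (Zb : forall s, 0 < s < 1 -> Rpower s a * Rpower (1 - s) b <= Rpower e (Rmin a b) ->
      Cmod (Z x s) <= Cmod dl * C1 * C2 * Rpower e (Rmin a b)).
    { intros s Hs Hp. unfold Z. rewrite !Cmod_mult, Cmod_opp, Cmod_RtoC_pos
        by (apply Rlt_le, Rmult_lt_0_compat; apply exp_pos).
      assert (B1 : Cmod (invpow (1 - a) (seg w0 w1 x)) <= C1) by (apply invpow_bound; [lra|apply seg_bound; auto]).
      assert (B2 : Cmod (invpow (a + b) (seg w0 w1 (x * s))) <= C2)
        by (apply invpow_bound; [lra|apply seg_bound; auto; nra]).
      replace (Cmod dl * C1 * C2 * Rpower e (Rmin a b)) with
        (Cmod dl * C1 * (Rpower e (Rmin a b) * C2)) by ring.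
      apply Rmult_le_compat.
      - apply Rmult_le_pos; apply Cmod_ge_0.
      - apply Rmult_le_pos; [|apply Cmod_ge_0]. apply Rlt_le, Rmult_lt_0_compat; apply exp_pos.
      - apply Rmult_le_compat_l; assumption.
      - apply Rmult_le_compat; auto using Cmod_ge_0.
        apply Rlt_le, Rmult_lt_0_compat; apply exp_pos. }
    eapply Rle_trans; [apply Cmod_minus_le|].
    assert (Q : forall u c, 0 < u <= 1 -> 0 <= c -> 0 < Rpower u c <= 1).
    { intros u c Hu Hc. split; [apply exp_pos|now apply Rpower_le_1]. }
    assert (Z1 : Cmod (Z x (1 - e)) <= Cmod dl * C1 * C2 * Rpower e (Rmin a b)).
    { apply Zb; [lra|]. replace (1 - (1 - e)) with e by ring.
      pose proof (Q (1 - e) a ltac:(lra) ltac:(lra)).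
      pose proof (Rpower_anti e (Rmin a b) b ltac:(lra) (Rmin_r _ _)).
      pose proof (exp_pos (b * ln e)). change (0 < Rpower e b) in H3. nra. }
    assert (Z2 : Cmod (Z x e) <= Cmod dl * C1 * C2 * Rpower e (Rmin a b)).
    { apply Zb; [lra|].
      pose proof (Q (1 - e) b ltac:(lra) ltac:(lra)).
      pose proof (Rpower_anti e (Rmin a b) a ltac:(lra) (Rmin_l _ _)).
      pose proof (exp_pos (a * ln e)). change (0 < Rpower e a) in H3. nra. }
    lra. }
assert (Ce : forall t, e <= t <= 1 - e ->
   cont (fun s => RtoC (beta_weight a b s) * invpow (a + b) (seg w0 w1 s))%C t).
{ intros t Ht. apply cont_mult.
  - apply cont_RtoC, (continuous_beta_weight a b (fun s => s)); [apply continuous_id|lra].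
  - apply cont_invpow; [apply (cont_seg (fun s => s)), continuous_id|]. apply Re1. unfold eta; lra. }
assert (F1 : CInt (f 1) e (1 - e) = (invpow (- a) w0 *
  CInt (fun s => RtoC (beta_weight a b s) * invpow (a + b) (seg w0 w1 s)) e (1 - e))%C).
{ rewrite <- CInt_scal; [|lra|exact Ce]. apply CInt_ext; [lra|].
  intros t Ht. unfold f. rewrite Rmult_1_l.
  replace (seg w0 w1 1) with w0 by (unfold seg; ring). ring. }
assert (F0 : CInt (f 0) e (1 - e) = (RtoC (RInt (beta_weight a b) e (1 - e)) * invpow b w1)%C).
{ transitivity (invpow b w1 * CInt (fun s => RtoC (beta_weight a b s)) e (1 - e))%C.
  - rewrite <- CInt_scal; [|lra|].
    + apply CInt_ext; [lra|]. intros t Ht. unfold f. rewrite Rmult_0_l.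
      replace (seg w0 w1 0) with w1 by (unfold seg; ring).
      rewrite <- invpow_plus. replace (- a + (a + b)) with b by ring. ring.
    + intros t Ht. apply cont_RtoC, (continuous_beta_weight a b (fun s => s)); [apply continuous_id|lra].
  - rewrite Cmult_comm. f_equal. unfold CInt; simpl. unfold RtoC. f_equal.
    rewrite (RInt_const (V := R_CompleteNormedModule)). unfold scal; simpl; unfold mult; simpl. ring. }
rewrite F1, F0 in Hm. rewrite Rminus_0_r, Rmult_1_r in Hm.
set (I := CInt _ _ _) in *. set (B := RInt _ _ _) in *.
replace (RtoC B * (invpow a w0 * invpow b w1) - I)%C with
  (- (invpow a w0 * (invpow (- a) w0 * I - RtoC B * invpow b w1)))%C.
- rewrite Cmod_opp, Cmod_mult. rewrite Rmult_assoc.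
  apply Rmult_le_compat; [apply Cmod_ge_0|apply Cmod_ge_0| |exact Hm].
  apply invpow_bound; assumption.
- replace (invpow a w0 * (invpow (- a) w0 * I - RtoC B * invpow b w1))%C with
    (invpow a w0 * invpow (- a) w0 * I - RtoC B * (invpow a w0 * invpow b w1))%C by ring.
  rewrite invpow_opp. ring.
Qed.
End Merge.

Lemma cont_csum {T : UniformSpace} (f : nat -> T -> C) (n : nat) (x : T) :
  (forall k, cont (f k) x) -> cont (fun t => csum (fun k => f k t) n) x.
Proof.
intros H. induction n; simpl; [apply cont_const|]. apply cont_plus; auto.
Qed.

Lemma small_Rpower (m K d : R) : 0 < m -> 0 <= K -> 0 < d ->
  exists e, 0 < e <= 1 / 4 /\ K * Rpower e m <= d.
Proof.
intros Hm HK Hd.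
(* The value wanted for [e^m]: the first entry makes [K * y <= d], the second forces [e <= 1/4]. *)
set (y := Rmin (d / (K + 1)) (Rpower (1 / 4) m)).
assert (Hy : 0 < y).
{ apply Rmin_glb_lt; [apply Rdiv_lt_0_compat; lra|apply exp_pos]. }
exists (Rpower y (/ m)).
assert (Hp : Rpower (Rpower y (/ m)) m = y).
{ rewrite Rpower_mult, Rinv_l, Rpower_1 by lra. reflexivity. }
split; [split; [apply exp_pos|]|].
- destruct (Rle_lt_dec (Rpower y (/ m)) (1 / 4)) as [|Hlt]; [assumption|exfalso].
  assert (H : Rpower (1 / 4) m < Rpower (Rpower y (/ m)) m) by (apply Rlt_Rpower_l; lra).
  rewrite Hp in H. pose proof (Rmin_r (d / (K + 1)) (Rpower (1 / 4) m)). fold y in H0. lra.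
- rewrite Hp. pose proof (Rmin_l (d / (K + 1)) (Rpower (1 / 4) m)) as H. fold y in H.
  apply Rle_trans with ((K + 1) * (d / (K + 1))); [nra|]. right; field; lra.
Qed.

(* Dirichlet averaging: a product of two powers lies in the closed convex hull of the
   powers with the total exponent, based at points of the segment. *)
Lemma merge_ineq (a b r S : R) (n : nat) (c w0 w1 : nat -> C) :
  0 < a -> 0 < b -> r < 1 ->
  (forall k, Cmod (w0 k) <= r) -> (forall k, Cmod (w1 k) <= r) ->
  (forall s, 0 <= s <= 1 ->
     Re (csum (fun k => c k * invpow (a + b) (seg (w0 k) (w1 k) s))%C n) <= S) ->
  Re (csum (fun k => c k * (invpow a (w0 k) * invpow b (w1 k)))%C n) <= S.
Proof.
intros Ha Hb Hr H0 H1 HS.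
set (w := beta_weight a b).
assert (Cw : forall t, 0 < t < 1 -> continuous w t).
{ intros t Ht. apply (continuous_beta_weight a b (fun s => s)); [apply continuous_id|exact Ht]. }
assert (CX : forall k t, 0 < t < 1 -> cont (fun s => invpow (a + b) (seg (w0 k) (w1 k) s)) t).
{ intros k t Ht. apply cont_invpow; [apply (cont_seg _ _ (fun s => s)), continuous_id|].
  apply seg_Re with r; auto. lra. }
assert (HK : exists K, 0 <= K /\ forall e, 0 < e <= 1 / 4 ->
  Cmod (RtoC (RInt w e (1 - e)) * csum (fun k => c k * (invpow a (w0 k) * invpow b (w1 k))) n -
    CInt (fun s => RtoC (w s) * csum (fun k => c k * invpow (a + b) (seg (w0 k) (w1 k) s)) n) e (1 - e))%C
  <= K * Rpower e (Rmin a b)).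
{ clear HS. induction n as [|n [K [K0 HK]]].
  - exists 0. split; [lra|]. intros e He. simpl.
    rewrite (CInt_ext _ (fun _ => RtoC 0)); [|lra|intros; ring].
    rewrite CInt_const. replace (_ - _)%C with (RtoC 0) by ring. rewrite Cmod_0. lra.
  - destruct (merge_pointwise a b r (w0 n) (w1 n)) as [K1 [K10 HK1]]; auto.
    exists (K + Cmod (c n) * K1). split.
    { apply Rplus_le_le_0_compat; [lra|apply Rmult_le_pos; [apply Cmod_ge_0|lra]]. }
    intros e He. specialize (HK e He). specialize (HK1 e He). simpl. fold w in HK1.
    rewrite (CInt_ext _ (fun s => RtoC (w s) * csum (fun k => c k * invpow (a + b) (seg (w0 k) (w1 k) s)) n
      + c n * (RtoC (w s) * invpow (a + b) (seg (w0 n) (w1 n) s)))%C); [|lra|intros; ring].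
    assert (C1 : forall t, e <= t <= 1 - e -> cont (fun s => RtoC (w s) *
       csum (fun k => c k * invpow (a + b) (seg (w0 k) (w1 k) s)) n)%C t).
    { intros t Ht. apply cont_mult; [apply cont_RtoC, Cw; lra|].
      apply cont_csum. intros k. apply cont_mult; [apply cont_const|apply CX; lra]. }
    assert (C2 : forall t, e <= t <= 1 - e -> cont (fun s => RtoC (w s) *
       invpow (a + b) (seg (w0 n) (w1 n) s))%C t).
    { intros t Ht. apply cont_mult; [apply cont_RtoC, Cw; lra|]. apply CX; lra. }
    rewrite CInt_plus, CInt_scal; [|lra|exact C2|lra|exact C1|
      intros; apply cont_mult; [apply cont_const|apply C2; assumption]].
    match type of HK with Cmod (_ - ?i)%C <= _ => set (I1 := i) in * end.
    match type of HK1 with Cmod (_ - ?i)%C <= _ => set (I2 := i) in * end.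
    set (B := RInt w e (1 - e)) in *.
    set (T := csum _ n) in *. set (X := (invpow a (w0 n) * invpow b (w1 n))%C) in *.
    replace (RtoC B * (T + c n * X) - (I1 + c n * I2))%C with
      ((RtoC B * T - I1) + c n * (RtoC B * X - I2))%C by ring.
    eapply Rle_trans; [apply Cmod_triangle|]. rewrite Cmod_mult, Rmult_plus_distr_r.
    apply Rplus_le_compat; [exact HK|]. rewrite Rmult_assoc.
    apply Rmult_le_compat_l; [apply Cmod_ge_0|exact HK1]. }
destruct HK as [K [K0 HK]].
set (T := csum _ n) in *.
(* The total weight on [[e, 1-e]] is at least [B0] for all admissible [e]. A gap [Re T - S > 0]
   would thus be weighted by at least [B0], whereas the truncation error is made at most half of
   [(Re T - S) * B0]. *)
set (B0 := RInt w (1 / 4) (1 - 1 / 4)).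
assert (ew : forall x y, 0 < x -> x <= y -> y < 1 -> ex_RInt w x y).
{ intros x y Hx Hxy Hy. apply ex_RInt_on; [lra|]. intros; apply Cw; lra. }
assert (HB0 : 0 < B0).
{ apply RInt_gt_0; [lra| |]; intros; [apply beta_weight_pos|apply Cw; lra]. }
assert (HB : forall e, 0 < e <= 1 / 4 -> B0 <= RInt w e (1 - e)).
{ intros e He. unfold B0.
  rewrite <- (RInt_Chasles (V := R_CompleteNormedModule) w e (1 / 4) (1 - e)) by (apply ew; lra).
  rewrite <- (RInt_Chasles (V := R_CompleteNormedModule) w (1 / 4) (1 - 1 / 4) (1 - e)) by (apply ew; lra).
  assert (0 <= RInt w e (1 / 4)) by (apply RInt_ge_0; [lra|apply ew; lra|intros; apply Rlt_le, beta_weight_pos]).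
  assert (0 <= RInt w (1 - 1 / 4) (1 - e)) by (apply RInt_ge_0; [lra|apply ew; lra|intros; apply Rlt_le, beta_weight_pos]).
  unfold plus; simpl. lra. }
destruct (Rle_lt_dec (Re T) S) as [|Hlt]; [assumption|exfalso].
destruct (small_Rpower (Rmin a b) K ((Re T - S) * B0 / 2)) as [e [He He2]].
{ now apply Rmin_glb_lt. } { exact K0. }
{ apply Rmult_lt_0_compat; [apply Rmult_lt_0_compat|]; lra. }
specialize (HK e He). specialize (HB e He).
set (I := CInt _ _ _) in *.
assert (HI : Re I <= S * RInt w e (1 - e)).
{ replace (Re I) with (Re (RtoC 1 * I)%C) by (f_equal; ring).
  unfold I. rewrite CInt_Re_scal; [|lra|].
  - replace (S * RInt w e (1 - e)) with (RInt (fun s => S * w s) e (1 - e))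
      by (apply (RInt_scal (V := R_CompleteNormedModule) w e (1 - e) S); apply ew; lra).
    apply RInt_le; [lra| | |].
    + apply ex_RInt_on; [lra|]. intros t Ht. apply cont_scal_Re, cont_mult; [apply cont_RtoC, Cw; lra|].
      apply cont_csum. intros k. apply cont_mult; [apply cont_const|apply CX; lra].
    + apply ex_RInt_on; [lra|]. intros t Ht. apply continuous_Rmult; [apply continuous_const|apply Cw; lra].
    + intros t Ht. rewrite Cmult_1_l, Re_scal, Rmult_comm.
      apply Rmult_le_compat_r; [apply Rlt_le, beta_weight_pos|apply HS; lra].
  - intros t Ht. apply cont_mult; [apply cont_RtoC, Cw; lra|].
    apply cont_csum. intros k. apply cont_mult; [apply cont_const|apply CX; lra]. }
pose proof (Re_le_Cmod (RtoC (RInt w e (1 - e)) * T - I)%C) as HR.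
assert (HR' : Re (RtoC (RInt w e (1 - e)) * T - I)%C = RInt w e (1 - e) * Re T - Re I)
  by (unfold Re; simpl; ring).
assert (H6 : (Re T - S) * B0 <= (Re T - S) * RInt w e (1 - e)) by (apply Rmult_le_compat_l; lra).
assert (0 < (Re T - S) * B0) by (apply Rmult_lt_0_compat; lra).
nra.
Qed.

Fixpoint rsum (f : nat -> R) (n : nat) : R :=
  match n with O => 0 | S m => rsum f m + f m end.

Fixpoint invpow_prod (a : nat -> R) (y : nat -> C) (n : nat) (z : C) : C :=
  match n with O => RtoC 1 | S m => (invpow_prod a y m z * invpow (a m) (y m * z))%C end.

(** The last two factors are merged again and again until one power is left. Since [seg (y * z k) (x
    * z k) s = seg y x s * z k], one parameter [s] moves the base point for all [z k] together; this
    is why a whole sum over [k] is carried, and the new base point stays in the disk of radius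
    [Y]. *)
Lemma hull_product (a : nat -> R) (y : nat -> C) (n K : nat) (c z : nat -> C) (Y r S : R) :
  0 <= Y -> Y * r < 1 -> (forall k, Cmod (z k) <= r) ->
  (forall j, 0 < a j) -> (forall j, Cmod (y j) <= Y) ->
  (forall x : C, Cmod x <= Y ->
     Re (csum (fun k => c k * invpow (rsum a (Datatypes.S n)) (x * z k))%C K) <= S) ->
  Re (csum (fun k => c k * invpow_prod a y (Datatypes.S n) (z k))%C K) <= S.
Proof.
intros HY HYr Hz Ha Hy.
assert (Hmod : forall x k, Cmod x <= Y -> Cmod (x * z k)%C <= Y * r).
{ intros x k Hx. rewrite Cmod_mult. apply Rmult_le_compat; auto using Cmod_ge_0. }
(* The exponent and base point of the last factor become arbitrary, because each merge replaces
   them. *)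
simpl. generalize (a n) (y n) (Ha n) (Hy n). revert c.
induction n as [|n IH]; intros c b x Hb Hx HS; simpl in *.
- rewrite (csum_ext _ (fun k => c k * invpow (0 + b) (x * z k))%C); [apply HS, Hx|].
  intros. rewrite Rplus_0_l. ring.
- rewrite (csum_ext _ (fun k => (c k * invpow_prod a y n (z k)) * (invpow (a n) (y n * z k) * invpow b (x * z k)))%C)
    by (intros; ring).
  apply merge_ineq with (Y * r); auto.
  intros s Hs.
  rewrite (csum_ext _ (fun k => c k * (invpow_prod a y n (z k) * invpow (a n + b) (seg (y n) x s * z k)))%C).
  + apply IH; [pose proof (Ha n); lra|apply seg_bound; auto|].
    intros x' Hx'. rewrite <- Rplus_assoc. apply HS, Hx'.
  + intros k _. replace (seg (y n * z k) (x * z k) s) with (seg (y n) x s * z k)%C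
      by (unfold seg; ring). ring.
Qed.

(** * The Cauchy integral formula *)


(* Complex differentiability is tested along real curves, so that the chain rule holds by
   definition. *)
Definition Hder (g : C -> C) (z l : C) : Prop :=
  forall u t v, cder u t v -> u t = z -> cder (fun s => g (u s)) t (l * v)%C.

Definition Hol (r : R) (g g' : C -> C) : Prop :=
  forall z, Cmod z < r -> Hder g z (g' z) /\ cont g' z.

Lemma ball_C (z w : C) (e : posreal) : Cmod (w - z)%C < e -> ball (M := C_UniformSpace) z e w.
Proof.
intros H. pose proof (Rmax_Cmod (w - z)%C) as Hm.
split.
- eapply Rle_lt_trans; [|exact H]. eapply Rle_trans; [|exact Hm].
  eapply Rle_trans; [|apply Rmax_l]. right. reflexivity.
- eapply Rle_lt_trans; [|exact H]. eapply Rle_trans; [|exact Hm].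
  eapply Rle_trans; [|apply Rmax_r]. right. reflexivity.
Qed.

(** Differentiability is known only along curves. A bound uniform in the direction comes from the
    segments issuing from [z], along which continuity of [g'] keeps [|g'|] below [|g' z| + 1]. *)
Lemma Hol_local_lipschitz (r : R) (g g' : C -> C) (z : C) : Hol r g g' -> Cmod z < r ->
  exists K d, 0 < d /\ 0 <= K /\
  forall w, Cmod (w - z)%C < d -> Cmod (g w - g z)%C <= K * Cmod (w - z)%C.
Proof.
intros H Hz. destruct (H z Hz) as [_ Hc].
assert (Hc' := cont_Cmod _ _ Hc).
destruct (proj1 (filterlim_locally _ _) Hc' (mkposreal 1 Rlt_0_1)) as [d Hd].
set (d' := Rmin d (r - Cmod z)).
exists (Cmod (g' z) + 1), d'. split; [apply Rmin_glb_lt; [apply d|lra]|].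
split; [pose proof (Cmod_ge_0 (g' z)); lra|].
intros w Hw.
pose proof (Rmin_l d (r - Cmod z)) as M1. pose proof (Rmin_r d (r - Cmod z)) as M2. fold d' in M1, M2.
assert (Hs : forall t, 0 <= t <= 1 -> Cmod (seg w z t - z)%C <= Cmod (w - z)%C).
{ intros t Ht. unfold seg. replace (z + RtoC t * (w - z) - z)%C with (RtoC t * (w - z))%C by ring.
  rewrite Cmod_mult, Cmod_RtoC_pos by lra. pose proof (Cmod_ge_0 (w - z)%C). nra. }
assert (B := cder_bound (fun t => g (seg w z t)) (fun t => g' (seg w z t) * (RtoC 1 * (w - z)))%C 0 1
  ((Cmod (g' z) + 1) * Cmod (w - z)%C) ltac:(lra)).
cbv beta in B. replace (seg w z 1) with w in B by (unfold seg; ring).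
replace (seg w z 0) with z in B by (unfold seg; ring).
rewrite Rminus_0_r, Rmult_1_r in B. apply B; intros t Ht; specialize (Hs t Ht).
- eapply (H (seg w z t)); [| |reflexivity].
  + pose proof (Cmod_triangle (seg w z t - z)%C z) as T.
    replace (seg w z t - z + z)%C with (seg w z t) in T by ring. lra.
  + apply (cder_seg w z (fun t => t)), (is_derive_id (K := R_AbsRing)).
- rewrite Cmult_1_l, Cmod_mult. apply Rmult_le_compat_r; [apply Cmod_ge_0|].
  assert (Hb : ball (M := C_UniformSpace) z d (seg w z t)) by (apply ball_C; lra).
  specialize (Hd _ Hb).
  assert (Hd' : Rabs (Cmod (g' (seg w z t)) - Cmod (g' z)) < 1) by exact Hd.
  apply Rabs_def2 in Hd'. lra.
Qed.

Lemma cont_of_lipschitz (g : C -> C) (z : C) (K d : R) : 0 < d -> 0 <= K ->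
  (forall w, Cmod (w - z)%C < d -> Cmod (g w - g z)%C <= K * Cmod (w - z)%C) -> cont g z.
Proof.
intros Hd HK H.
assert (HL : forall eps : posreal, locally (T := C_UniformSpace) z (fun w => Cmod (g w - g z)%C < eps)).
{ intros eps. set (d' := Rmin (d / 2) (eps / (2 * (K + 1)))).
  assert (P : 0 < d') by (apply Rmin_glb_lt; [lra|apply Rdiv_lt_0_compat; [apply eps|lra]]).
  exists (mkposreal _ P). intros w [B1 B2].
  assert (B : Cmod (w - z)%C < 2 * d').
  { assert (B1' : Rabs (Re (w - z)%C) < d') by exact B1.
    assert (B2' : Rabs (Im (w - z)%C) < d') by exact B2.
    replace (w - z)%C with (RtoC (Re (w - z)%C) + Ci * RtoC (Im (w - z)%C))%C
      by (apply Ceq_ext; unfold Re, Im; simpl; ring).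
    eapply Rle_lt_trans; [apply Cmod_triangle|].
    rewrite Cmod_mult, Cmod_Ci, !Cmod_R. lra. }
  pose proof (Rmin_l (d / 2) (eps / (2 * (K + 1)))) as M1.
  pose proof (Rmin_r (d / 2) (eps / (2 * (K + 1)))) as M2. fold d' in M1, M2.
  eapply Rle_lt_trans; [apply H; lra|].
  assert (M3 : 2 * d' * (K + 1) <= eps).
  { apply Rmult_le_compat_r with (r := 2 * (K + 1)) in M2; [|lra].
    replace (eps / (2 * (K + 1)) * (2 * (K + 1))) with (pos eps) in M2 by (field; lra). lra. }
  pose proof (Cmod_ge_0 (w - z)%C). nra. }
split; apply filterlim_locally; intros eps; (eapply filter_imp; [|exact (HL eps)]);
  intros w Hw; (eapply Rle_lt_trans; [|exact Hw]).
- exact (re_le_Cmod (g w - g z)%C).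
- exact (Im_le_Cmod (g w - g z)%C).
Qed.

Lemma Hol_cont (r : R) (g g' : C -> C) (z : C) : Hol r g g' -> Cmod z < r -> cont g z.
Proof.
intros H Hz. destruct (Hol_local_lipschitz r g g' z H Hz) as [K [d [Hd [HK HL]]]].
now apply cont_of_lipschitz with K d.
Qed.

Lemma Hol_const (r : R) (c : C) : Hol r (fun _ => c) (fun _ => RtoC 0).
Proof.
intros z Hz; split; [|apply cont_const].
intros u t v Hu E. eapply cder_eq; [apply cder_const|ring].
Qed.

Lemma Hol_id (r : R) : Hol r (fun z => z) (fun _ => RtoC 1).
Proof.
intros z Hz; split; [|apply cont_const].
intros u t v Hu E. eapply cder_eq; [exact Hu|ring].
Qed.

Lemma Hol_plus (r : R) (f f' g g' : C -> C) : Hol r f f' -> Hol r g g' ->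
  Hol r (fun z => f z + g z)%C (fun z => f' z + g' z)%C.
Proof.
intros Hf Hg z Hz; split.
- intros u t v Hu <-. eapply cder_eq; [apply cder_plus; [eapply (Hf (u t) Hz)|eapply (Hg (u t) Hz)]; try exact Hu; reflexivity|cbv beta; ring].
- apply cont_plus; [apply (Hf z Hz)|apply (Hg z Hz)].
Qed.

Lemma Hol_mult (r : R) (f f' g g' : C -> C) : Hol r f f' -> Hol r g g' ->
  Hol r (fun z => f z * g z)%C (fun z => f' z * g z + f z * g' z)%C.
Proof.
intros Hf Hg z Hz; split.
- intros u t v Hu <-. eapply cder_eq; [apply cder_mult; [eapply (Hf (u t) Hz)|eapply (Hg (u t) Hz)]; try exact Hu; reflexivity|cbv beta; ring].
- apply cont_plus; apply cont_mult; try (apply (Hf z Hz)); try (apply (Hg z Hz)).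
  + now apply Hol_cont with r g'.
  + now apply Hol_cont with r f'.
Qed.

Lemma Hol_inv (r : R) (f f' : C -> C) : Hol r f f' ->
  (forall z, Cmod z < r -> f z <> RtoC 0) ->
  Hol r (fun z => / f z)%C (fun z => - f' z * / (f z * f z))%C.
Proof.
intros Hf H0 z Hz; split.
- intros u t v Hu <-. eapply cder_eq.
  + apply cder_inv; [|apply H0, Hz]. eapply (Hf (u t) Hz); [exact Hu|reflexivity].
  + cbv beta. field. apply H0, Hz.
- pose proof (Hol_cont r f f' z Hf Hz) as Hc.
  apply cont_mult; [apply cont_opp, (Hf z Hz)|].
  apply cont_inv; [now apply cont_mult|]. apply Cmult_neq_0; now apply H0.
Qed.

Definition circ (r t : R) : C := (RtoC r * Cexp (Ci * RtoC t))%C.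

Lemma Cmod_circ (r t : R) : 0 <= r -> Cmod (circ r t) = r.
Proof.
intros H. unfold circ. rewrite Cmod_mult, Cmod_RtoC_pos, Cmod_Cexp by exact H.
replace (Re (Ci * RtoC t)%C) with 0 by (unfold Re; simpl; ring). rewrite exp_0; ring.
Qed.

Lemma circ_2PI (r : R) : circ r (2 * PI) = circ r 0.
Proof.
unfold circ, Cexp. f_equal. apply Ceq_ext; simpl.
- rewrite Rmult_0_l, !Rmult_1_l, !Rmult_0_r, !Rminus_0_r, !Rplus_0_l, cos_2PI, cos_0. reflexivity.
- rewrite Rmult_0_l, !Rmult_1_l, !Rmult_0_r, !Rminus_0_r, !Rplus_0_l, sin_2PI, sin_0. reflexivity.
Qed.

Lemma cder_circ (r t : R) : cder (circ r) t (Ci * circ r t)%C.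
Proof.
unfold circ. eapply cder_eq.
- apply cder_scal, cder_Cexp, cder_scal, cder_id.
- cbv beta. ring.
Qed.

Lemma cont_circ {T : UniformSpace} (r : R) (f : T -> R) (x : T) :
  continuous f x -> cont (fun s => circ r (f s)) x.
Proof.
intros H. unfold circ. apply cont_mult; [apply cont_const|].
apply cont_Cexp, cont_mult; [apply cont_const|apply cont_RtoC, H].
Qed.

Lemma Cminus_neq0 (z w : C) : Cmod w < Cmod z -> (z - w)%C <> RtoC 0.
Proof.
intros H E. pose proof (Cmod_rev_triangle z w) as T. rewrite E, Cmod_0 in T. lra.
Qed.

Lemma Ci_sqr : (Ci * Ci)%C = (- RtoC 1)%C.
Proof. apply Ceq_ext; unfold Re, Im; simpl; ring. Qed.

Lemma Ci_neq0 : Ci <> RtoC 0.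
Proof. intros E. apply (f_equal Im) in E. simpl in E. lra. Qed.

Lemma circ_neq0 (r t : R) : 0 < r -> circ r t <> RtoC 0.
Proof. intros H. apply Cmod_gt_0. rewrite Cmod_circ; lra. Qed.

(** Replacing [z] by [x z], the [x]-derivative of the integrand is the [t]-derivative of
    [i z / (circ r t - x z)], which takes equal values at [0] and [2 PI]. The integral therefore
    agrees with that at [x = 0], where the integrand is 1. *)
Lemma cauchy_kernel (r : R) (z : C) : Cmod z < r ->
  CInt (fun t => circ r t / (circ r t - z))%C 0 (2 * PI) = RtoC (2 * PI).
Proof.
intros Hz. pose proof (Cmod_ge_0 z) as Hz0. pose proof PI_RGT_0 as Hpi.
set (eta := (r - Cmod z) / (2 * r)).
assert (Heta : 0 < eta) by (apply Rdiv_lt_0_compat; lra).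
assert (Hk : forall x, - eta < x < 1 + eta -> Cmod (RtoC x * z)%C < r).
{ intros x Hx. rewrite Cmod_mult, Cmod_R.
  assert (Ha : Rabs x <= 1 + eta) by (apply Rabs_le; lra).
  assert (He : eta * r = (r - Cmod z) / 2) by (unfold eta; field; lra).
  assert (eta * Cmod z <= eta * r) by (apply Rmult_le_compat_l; lra).
  apply Rle_lt_trans with ((1 + eta) * Cmod z); [apply Rmult_le_compat_r; lra|lra]. }
assert (Hn : forall x t, - eta < x < 1 + eta -> (circ r t - RtoC x * z)%C <> RtoC 0).
{ intros x t Hx. apply Cminus_neq0. rewrite Cmod_circ by lra. auto. }
set (f := fun x t => (circ r t / (circ r t - RtoC x * z))%C).
assert (H : Cmod (CInt (f 1) 0 (2 * PI) - CInt (f 0) 0 (2 * PI))%C <= 0 * (1 - 0)).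
{ apply (homotopy f (fun x t => Ci * z / (circ r t - RtoC x * z))%C
    (fun x t => circ r t * z / ((circ r t - RtoC x * z) * (circ r t - RtoC x * z)))%C
    (- eta) (1 + eta) (-1) (2 * PI + 1)); try lra.
  - intros x t Hx Ht. unfold f. eapply cder_eq.
    + apply cder_scal, cder_inv; [|now apply Hn].
      apply cder_minus; [apply cder_const|apply cder_mult; [apply cder_id|apply cder_const]].
    + cbv beta. field. now apply Hn.
  - intros x t Hx Ht. eapply cder_eq.
    + apply cder_scal, cder_inv; [|now apply Hn].
      apply cder_minus; [apply cder_circ|apply cder_const].
    + cbv beta. set (D := (circ r t - RtoC x * z)%C).
      replace (Ci * z * (- (Ci * circ r t - 0) / (D * D)))%C with
        (- (Ci * Ci) * (circ r t * z / (D * D)))%C by (unfold Cdiv; ring).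
      rewrite Ci_sqr. ring.
  - intros x t Hx Ht.
    assert (C1 : cont (fun q : R * R => circ r (snd q)) (x, t)) by apply cont_circ, continuous_snd.
    assert (C2 : cont (fun q : R * R => circ r (snd q) - RtoC (fst q) * z)%C (x, t)).
    { apply cont_minus; [exact C1|]. apply cont_mult; [apply cont_RtoC, continuous_fst|apply cont_const]. }
    apply cont_mult; [apply cont_mult; [exact C1|apply cont_const]|].
    apply cont_inv; [now apply cont_mult|]. apply Cmult_neq_0; now apply Hn.
  - intros x t Hx Ht. unfold f.
    assert (C1 : cont (circ r) t) by apply (cont_circ r (fun t => t)), continuous_id.
    apply cont_mult; [exact C1|]. apply cont_inv; [|now apply Hn].
    apply cont_minus; [exact C1|apply cont_const].
  - intros x Hx. rewrite circ_2PI.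
    match goal with |- Cmod (?a - ?b)%C <= _ => replace (a - b)%C with (RtoC 0) by ring end.
    rewrite Cmod_0; lra. }
assert (E1 : CInt (f 1) 0 (2 * PI) = CInt (f 0) 0 (2 * PI)) by (apply Cmod_minus_0; lra).
transitivity (CInt (f 1) 0 (2 * PI)).
{ apply CInt_ext; [lra|]. intros t Ht. unfold f. now rewrite Cmult_1_l. }
rewrite E1. transitivity (CInt (fun _ => RtoC 1) 0 (2 * PI)).
{ apply CInt_ext; [lra|]. intros t Ht. unfold f. rewrite Cmult_0_l.
  field. replace (circ r t - 0)%C with (circ r t) by ring.
  apply circ_neq0; lra. }
rewrite CInt_const, Rminus_0_r. ring.
Qed.

(** The circle is contracted towards [z] along [z + x (circ r t - z)] with the kernel held fixed.
    The primitive [g / (i x)] excludes [x = 0], so that limit is taken by hand with the local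
    Lipschitz bound and [cauchy_kernel]. *)
Lemma cauchy_formula (R0 r : R) (g g' : C -> C) (z : C) :
  Hol R0 g g' -> r < R0 -> Cmod z < r ->
  CInt (fun t => g (circ r t) * (circ r t / (circ r t - z)))%C 0 (2 * PI) = (RtoC (2 * PI) * g z)%C.
Proof.
intros Hg Hr Hz. pose proof (Cmod_ge_0 z) as Hz0. pose proof PI_RGT_0 as Hpi.
set (eta := (R0 - r) / (2 * r)).
assert (Heta : 0 < eta) by (apply Rdiv_lt_0_compat; lra).
assert (Her : (1 + 2 * eta) * r = R0) by (unfold eta; field; lra).
assert (Hn : forall t, (circ r t - z)%C <> RtoC 0).
{ intros t. apply Cminus_neq0. rewrite Cmod_circ by lra. auto. }
set (w := fun x t => seg (circ r t) z x).
assert (Hw : forall x t, 0 < x < 1 + eta -> Cmod (w x t) < R0).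
{ intros x t Hx. unfold w.
  destruct (Rle_lt_dec x 1) as [H1|H1].
  - eapply Rle_lt_trans; [apply (seg_bound _ _ r)|]; try lra. rewrite Cmod_circ; lra.
  - unfold seg. replace (z + RtoC x * (circ r t - z))%C with (RtoC x * circ r t - RtoC (x - 1) * z)%C
      by (rewrite RtoC_minus; ring).
    eapply Rle_lt_trans; [apply Cmod_minus_le|].
    rewrite !Cmod_mult, !Cmod_RtoC_pos, Cmod_circ by lra. nra. }
assert (cw : forall x t, cont (fun q : R * R => w (fst q) (snd q)) (x, t)).
{ intros x t. unfold w, seg. apply cont_plus; [apply cont_const|].
  apply cont_mult; [apply cont_RtoC, continuous_fst|].
  apply cont_minus; [apply cont_circ, continuous_snd|apply cont_const]. }
assert (cw1 : forall x t, cont (w x) t).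
{ intros x t. unfold w, seg. apply cont_plus; [apply cont_const|].
  apply cont_mult; [apply cont_const|].
  apply cont_minus; [apply (cont_circ r (fun t => t)), continuous_id|apply cont_const]. }
assert (ck : forall t, cont (fun t => circ r t / (circ r t - z))%C t).
{ intros t. assert (C1 : cont (circ r) t) by apply (cont_circ r (fun t => t)), continuous_id.
  apply cont_mult; [exact C1|]. apply cont_inv; [|now apply Hn].
  apply cont_minus; [exact C1|apply cont_const]. }
set (f := fun x t => (circ r t / (circ r t - z) * g (w x t))%C).
assert (cf : forall x t, 0 < x < 1 + eta -> cont (f x) t).
{ intros x t Hx. unfold f. apply cont_mult; [apply ck|].
  apply (cont_comp g); [apply cw1|]. apply Hol_cont with R0 g'; auto. }
assert (H : forall x0, 0 < x0 < 1 -> CInt (f 1) 0 (2 * PI) = CInt (f x0) 0 (2 * PI)).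
{ intros x0 Hx0. apply Cmod_minus_0. apply Rle_trans with (0 * (1 - x0)); [|lra].
  apply (homotopy f (fun x t => / (Ci * RtoC x) * g (w x t))%C
    (fun x t => g' (w x t) * circ r t)%C 0 (1 + eta) (-1) (2 * PI + 1)); try lra.
  - intros x t Hx Ht. unfold f. eapply cder_eq.
    + apply cder_scal. eapply (Hg (w x t)); [now apply Hw| |reflexivity].
      apply (cder_seg _ _ (fun x => x)), (is_derive_id (K := R_AbsRing)).
    + change (@one R_AbsRing) with 1. field. apply Hn.
  - intros x t Hx Ht. eapply cder_eq.
    + apply cder_scal. eapply (Hg (w x t)); [now apply Hw| |reflexivity].
      apply cder_plus; [apply cder_const|]. apply cder_scal.
      apply cder_minus; [apply cder_circ|apply cder_const].
    + field. split; [intros E; apply RtoC_inj in E; lra|apply Ci_neq0].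
  - intros x t Hx Ht. apply cont_mult; [|apply cont_circ, continuous_snd].
    apply (cont_comp g'); [apply cw|]. apply Hg. now apply Hw.
  - intros x t Hx Ht. now apply cf.
  - intros x Hx. unfold w. rewrite circ_2PI.
    match goal with |- Cmod (?a - ?b)%C <= _ => replace (a - b)%C with (RtoC 0) by ring end.
    rewrite Cmod_0; lra. }
assert (G : CInt (f 1) 0 (2 * PI) = (RtoC (2 * PI) * g z)%C).
{ apply Cmod_minus_0. apply Rnot_lt_le. intros Hlt.
  destruct (Hol_local_lipschitz R0 g g' z Hg ltac:(lra)) as [K [d [Hd [HK HL]]]].
  set (D := Cmod _) in Hlt.
  set (B := r / (r - Cmod z) * (K * (2 * r)) * (2 * PI)).
  assert (HB : 0 <= B).
  { assert (0 <= r / (r - Cmod z)) by (apply Rle_mult_inv_pos; lra).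
    assert (0 <= K * (2 * r)) by (apply Rmult_le_pos; lra).
    apply Rmult_le_pos; [apply Rmult_le_pos|]; lra. }
  (* The second entry puts the contracted circle within the reach [d] of the Lipschitz bound; the
     third makes the error [B * x0] at most [D / 2], contradicting that it is at least [D]. *)
  set (x0 := Rmin (1 / 2) (Rmin (d / (4 * r)) (D / (2 * (B + 1))))).
  assert (Hx0 : 0 < x0).
  { repeat apply Rmin_glb_lt; [lra|apply Rdiv_lt_0_compat; lra|apply Rdiv_lt_0_compat; lra]. }
  assert (Hx1 : x0 <= 1 / 2) by apply Rmin_l.
  assert (Hx2 : x0 <= d / (4 * r)) by (eapply Rle_trans; [apply Rmin_r|apply Rmin_l]).
  assert (Hx3 : x0 <= D / (2 * (B + 1))) by (eapply Rle_trans; [apply Rmin_r|apply Rmin_r]).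
  assert (HD : D <= B * x0).
  { unfold D. rewrite (H x0) by lra.
    rewrite <- (cauchy_kernel r z Hz). rewrite (Cmult_comm _ (g z)).
    rewrite <- CInt_scal; [|lra|intros; apply ck].
    match goal with |- Cmod (?a - ?b)%C <= _ => replace (a - b)%C with (a + (- RtoC 1) * b)%C by ring end.
    rewrite <- CInt_scal; [|lra|intros; apply cont_mult; [apply cont_const|apply ck]].
    rewrite <- CInt_plus; [|lra|intros; apply cf; lra|
      intros; apply cont_mult; [apply cont_const|apply cont_mult; [apply cont_const|apply ck]]].
    replace (B * x0) with ((r / (r - Cmod z) * (K * (2 * r) * x0)) * (2 * PI - 0)) by (unfold B; ring).
    apply CInt_bound_const; [lra| |].
    - intros t Ht. apply cont_plus; [apply cf; lra|].
      apply cont_mult; [apply cont_const|apply cont_mult; [apply cont_const|apply ck]].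
    - intros t Ht. unfold f.
      replace (circ r t / (circ r t - z) * g (w x0 t) + (- RtoC 1) * (g z * (circ r t / (circ r t - z))))%C
        with (circ r t / (circ r t - z) * (g (w x0 t) - g z))%C by ring.
      rewrite Cmod_mult, Cmod_div, Cmod_circ by (try apply Hn; lra).
      assert (Hd1 : r - Cmod z <= Cmod (circ r t - z)%C).
      { eapply Rle_trans; [|apply Cmod_rev_triangle]. rewrite Cmod_circ; lra. }
      assert (Hdd : Cmod (w x0 t - z)%C <= 2 * r * x0).
      { unfold w, seg. replace (z + RtoC x0 * (circ r t - z) - z)%C with (RtoC x0 * (circ r t - z))%C by ring.
        rewrite Cmod_mult, Cmod_RtoC_pos by lra.
        pose proof (Cmod_minus_le (circ r t) z) as T. rewrite Cmod_circ in T by lra. nra. }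
      apply Rmult_le_compat; try apply Cmod_ge_0.
      + apply Rle_mult_inv_pos; lra.
      + apply Rmult_le_compat_l; [lra|]. apply Rinv_le_contravar; lra.
      + eapply Rle_trans; [apply HL|].
        * assert (2 * r * x0 <= d / 2); [|lra].
          replace (d / 2) with (2 * r * (d / (4 * r))) by (field; lra).
          apply Rmult_le_compat_l; lra.
        * rewrite Rmult_assoc. apply Rmult_le_compat_l; lra. }
  assert (B * x0 <= D / 2).
  { apply Rle_trans with ((B + 1) * (D / (2 * (B + 1)))); [nra|]. right; field; lra. }
  lra. }
rewrite <- G. apply CInt_ext; [lra|]. intros t Ht. unfold f, w.
replace (seg (circ r t) z 1) with (circ r t) by (unfold seg; ring). ring.
Qed.

(** * The Herglotz representation *)


Lemma CInt_conj (u : R -> C) (a b : R) : a <= b -> (forall t, a <= t <= b -> cont u t) ->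
  CInt (fun t => Cconj (u t)) a b = Cconj (CInt u a b).
Proof.
intros Hab H. apply Ceq_ext; simpl; [reflexivity|].
apply (RInt_opp (V := R_CompleteNormedModule)). apply ex_RInt_on; [lra|]. intros; now apply H.
Qed.

Lemma mult_conj_self (z : C) : (Cconj z * z)%C = RtoC (Cmod z * Cmod z).
Proof.
pose proof (Re_conj_mult z) as H. apply Ceq_ext; [exact H|].
unfold Im; simpl; ring.
Qed.

Section Herglotz.
Variables (m m' : C -> C) (p r : R).
Hypotheses (Hm : Hol 1 m m') (Hr : 0 < r < 1).

Definition hmeas (t : R) : R := p + 2 * Re (circ r t * m (circ r t))%C.

Lemma cont_m_circ (t : R) : cont (fun t => circ r t * m (circ r t))%C t.
Proof.
assert (C1 : cont (circ r) t) by apply (cont_circ r (fun t => t)), continuous_id.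
apply cont_mult; [exact C1|]. apply (cont_comp m); [exact C1|].
apply Hol_cont with 1 m'; [exact Hm|]. rewrite Cmod_circ; lra.
Qed.

Lemma cont_hmeas (t : R) : continuous hmeas t.
Proof.
unfold hmeas. apply continuous_Rplus; [apply continuous_const|].
apply continuous_Rmult; [apply continuous_const|]. exact (proj1 (cont_m_circ t)).
Qed.

(** The mean of [z * m z] over the circle is its value at the origin, which is 0; only the constant
    [p] survives. *)
Lemma RInt_hmeas : RInt hmeas 0 (2 * PI) = 2 * PI * p.
Proof.
pose proof PI_RGT_0 as Hpi.
assert (Hh : Hol 1 (fun z => z * m z)%C (fun z => RtoC 1 * m z + z * m' z)%C)
  by (apply Hol_mult; [apply Hol_id|exact Hm]).
pose proof (cauchy_formula 1 r _ _ (RtoC 0) Hh ltac:(lra) ltac:(rewrite Cmod_0; lra)) as H.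
cbv beta in H.
assert (E1 : CInt (fun t => circ r t * m (circ r t))%C 0 (2 * PI) = RtoC 0).
{ rewrite <- (CInt_ext (fun t => circ r t * m (circ r t) * (circ r t / (circ r t - 0)))%C); [|lra|].
  - rewrite H. ring.
  - intros t _. field. replace (circ r t - 0)%C with (circ r t) by ring. apply circ_neq0; lra. }
apply (f_equal Re) in E1. change (RInt (fun t => Re (circ r t * m (circ r t))%C) 0 (2 * PI) = 0) in E1.
assert (ex : ex_RInt (fun t => Re (circ r t * m (circ r t))%C) 0 (2 * PI)).
{ apply ex_RInt_on; [lra|]. intros t _; exact (proj1 (cont_m_circ t)). }
apply (RInt_correct (V := R_CompleteNormedModule)) in ex. rewrite E1 in ex.
apply is_RInt_unique. unfold hmeas.
replace (2 * PI * p) with (plus (scal (2 * PI - 0) p) (scal 2 0))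
  by (unfold scal, plus; simpl; unfold mult; simpl; ring).
exact (is_RInt_plus (V := R_NormedModule) _ _ _ _ _ _
  (is_RInt_const (V := R_NormedModule) 0 (2 * PI) p) (is_RInt_scal (V := R_NormedModule) _ _ _ 2 _ ex)).
Qed.

(** With [zeta] on the circle, the part [zeta * m zeta] of the density reproduces [m z] by Cauchy's
    formula. The rest, [p] plus a conjugate, contributes nothing: since [Cconj zeta = r^2 / zeta],
    it is the conjugate of a holomorphic function [phi] on the circle, and [phi] vanishes at the
    origin. *)
Lemma herglotz (z : C) : Cmod z < r ->
  CInt (fun t => RtoC (hmeas t) / (circ r t - z))%C 0 (2 * PI) = (RtoC (2 * PI) * m z)%C.
Proof.
intros Hz. pose proof PI_RGT_0 as Hpi. pose proof (Cmod_ge_0 z) as Hz0.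
assert (Hn : forall t, (circ r t - z)%C <> RtoC 0).
{ intros t. apply Cminus_neq0. rewrite Cmod_circ by lra. auto. }
assert (Hn0 : forall t, circ r t <> RtoC 0) by (intros; apply circ_neq0; lra).
(* A radius beyond [r] on which [r^2 - Cconj z * w] has no zero, because [|z| (2r - |z|) < r^2]. *)
set (R0 := Rmin 1 (2 * r - Cmod z)).
assert (HR0 : r < R0) by (apply Rmin_glb_lt; lra).
assert (HR1 : R0 <= 1) by apply Rmin_l.
assert (HR2 : R0 <= 2 * r - Cmod z) by apply Rmin_r.
assert (Hden : forall w, Cmod w < R0 -> (RtoC (r * r) - Cconj z * w)%C <> RtoC 0).
{ intros w Hw. apply Cminus_neq0. rewrite Cmod_mult, Cmod_conj, Cmod_RtoC_pos by nra.
  assert (Cmod z * Cmod w <= Cmod z * (2 * r - Cmod z)) by (apply Rmult_le_compat_l; lra).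
  assert (0 < (r - Cmod z) * (r - Cmod z)) by (apply Rmult_lt_0_compat; lra). nra. }
assert (Hm0 : Hol R0 m m') by (intros w Hw; apply Hm; lra).
set (phi := fun w => ((RtoC p + w * m w) * (w * / (RtoC (r * r) + - Cconj z * w)))%C).
assert (Hphi : exists phi', Hol R0 phi phi').
{ eexists. apply Hol_mult.
  - apply Hol_plus; [apply Hol_const|apply Hol_mult; [apply Hol_id|exact Hm0]].
  - apply Hol_mult; [apply Hol_id|]. apply Hol_inv.
    + apply Hol_plus; [apply Hol_const|apply Hol_mult; [apply Hol_const|apply Hol_id]].
    + intros w Hw. replace (RtoC (r * r) + - Cconj z * w)%C with (RtoC (r * r) - Cconj z * w)%C by ring.
      now apply Hden. }
destruct Hphi as [phi' Hphi].
assert (C1 : forall t, cont (fun t => phi (circ r t)) t).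
{ intros t. apply (cont_comp phi); [apply (cont_circ r (fun t => t)), continuous_id|].
  apply Hol_cont with R0 phi'; [exact Hphi|]. rewrite Cmod_circ; lra. }
assert (H0 : CInt (fun t => phi (circ r t)) 0 (2 * PI) = RtoC 0).
{ pose proof (cauchy_formula R0 r phi phi' (RtoC 0) Hphi HR0 ltac:(rewrite Cmod_0; lra)) as H.
  transitivity (RtoC (2 * PI) * phi (RtoC 0))%C.
  - rewrite <- H. apply CInt_ext; [lra|]. intros t _. field.
    replace (circ r t - 0)%C with (circ r t) by ring. auto.
  - unfold phi. ring. }
pose proof (cauchy_formula 1 r m m' z Hm ltac:(lra) Hz) as H1.
assert (C2 : forall t, cont (fun t => m (circ r t) * (circ r t / (circ r t - z)))%C t).
{ intros t. assert (C0 : cont (circ r) t) by apply (cont_circ r (fun t => t)), continuous_id.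
  apply cont_mult.
  - apply (cont_comp m); [exact C0|]. apply Hol_cont with 1 m'; [exact Hm|]. rewrite Cmod_circ; lra.
  - apply cont_mult; [exact C0|]. apply cont_inv; [|apply Hn].
    apply cont_minus; [exact C0|apply cont_const]. }
rewrite <- H1.
transitivity (CInt (fun t => m (circ r t) * (circ r t / (circ r t - z)) + Cconj (phi (circ r t)))%C 0 (2 * PI)).
- apply CInt_ext; [lra|]. intros t _.
  assert (Hcc : (Cconj (circ r t) * circ r t)%C = RtoC (r * r)).
  { rewrite mult_conj_self, Cmod_circ by lra. reflexivity. }
  unfold phi.
  replace (RtoC (r * r) + - Cconj z * circ r t)%C with ((Cconj (circ r t) - Cconj z) * circ r t)%C
    by (rewrite <- Hcc; ring).
  rewrite !Cmult_conj, Cplus_conj, Cmult_conj.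
  assert (Hn1 : (Cconj (circ r t) - Cconj z)%C <> RtoC 0).
  { rewrite <- Cminus_conj. intros E. apply (f_equal Cconj) in E. rewrite Cconj_conj in E.
    apply (Hn t). rewrite E. apply Ceq_ext; simpl; ring. }
  assert (Hc0 : Cconj (circ r t) <> RtoC 0).
  { intros E. apply (f_equal Cconj) in E. rewrite Cconj_conj in E.
    apply (Hn0 t). rewrite E. apply Ceq_ext; simpl; ring. }
  replace (Cconj (RtoC p)) with (RtoC p) by (apply Ceq_ext; simpl; ring).
  assert (Hinv : Cconj (/ ((Cconj (circ r t) - Cconj z) * circ r t)) = (/ ((circ r t - z) * Cconj (circ r t)))%C).
  { rewrite Cinv_conj by (apply Cmult_neq_0; auto).
    rewrite Cmult_conj, Cminus_conj, !Cconj_conj. reflexivity. }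
  rewrite Hinv.
  assert (HW : RtoC (hmeas t) = (RtoC p + circ r t * m (circ r t) + Cconj (circ r t) * Cconj (m (circ r t)))%C).
  { unfold hmeas. rewrite <- Cmult_conj. set (q := (circ r t * m (circ r t))%C).
    apply Ceq_ext; unfold Re, Im; simpl; ring. }
  rewrite HW. field. split; auto.
- rewrite CInt_plus; [|lra|intros; apply C2|].
  + rewrite CInt_conj by (try lra; intros; apply C1). rewrite H0.
    rewrite <- (Cplus_0_r (CInt _ _ _)) at 2. f_equal. apply Ceq_ext; simpl; ring.
  + intros t _. destruct (C1 t) as [A B]. split; simpl; [exact A|now apply continuous_Ropp].
Qed.

Hypothesis Hpos : forall z, Cmod z < 1 -> 0 < p + 2 * Re (z * m z)%C.

Lemma hmeas_pos (t : R) : 0 < hmeas t.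
Proof. apply Hpos. rewrite Cmod_circ; lra. Qed.

Lemma circ_lipschitz (s t : R) : s <= t -> Cmod (circ r t - circ r s)%C <= r * (t - s).
Proof.
intros H. apply (cder_bound (circ r) (fun t => Ci * circ r t)%C); [exact H| |].
- intros; apply cder_circ.
- intros. rewrite Cmod_mult, Cmod_Ci, Cmod_circ; lra.
Qed.

Definition node (N j : nat) : R := 2 * PI * INR j / INR N.
(** The exact mass of an arc rather than a sampled value: the [N] weights then add up to exactly
    [p], the exponent left after merging. *)
Definition weight (N j : nat) : R := / (2 * PI) * RInt hmeas (node N j) (node N (S j)).

Lemma node_le (N j : nat) : (0 < N)%nat -> node N (S j) - node N j = 2 * PI / INR N.
Proof.
intros HN. unfold node. rewrite S_INR. field. apply not_0_INR. lia.
Qed.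

Lemma node_step_pos (N : nat) : (0 < N)%nat -> 0 < 2 * PI / INR N.
Proof.
intros HN. pose proof PI_RGT_0. apply Rdiv_lt_0_compat; [lra|]. now apply lt_0_INR.
Qed.

Lemma weight_pos (N j : nat) : (0 < N)%nat -> 0 < weight N j.
Proof.
intros HN. pose proof (node_le N j HN). pose proof (node_step_pos N HN). pose proof PI_RGT_0.
apply Rmult_lt_0_compat; [apply Rinv_0_lt_compat; lra|].
apply RInt_gt_0; [lra|intros; apply hmeas_pos|intros; apply cont_hmeas].
Qed.

Lemma ex_RInt_hmeas (a b : R) : ex_RInt hmeas a b.
Proof. apply (ex_RInt_continuous (V := R_CompleteNormedModule)). intros; apply cont_hmeas. Qed.

Lemma rsum_weight (N n : nat) : rsum (weight N) n = / (2 * PI) * RInt hmeas 0 (node N n).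
Proof.
induction n; simpl.
- unfold node. replace (2 * PI * INR 0 / INR N) with 0 by (simpl; unfold Rdiv; ring).
  rewrite (RInt_point (V := R_CompleteNormedModule)). unfold zero; simpl. ring.
- rewrite IHn. unfold weight. rewrite <- Rmult_plus_distr_l. f_equal.
  apply (RInt_Chasles (V := R_CompleteNormedModule)); apply ex_RInt_hmeas.
Qed.

Lemma node_N (N : nat) : (0 < N)%nat -> node N N = 2 * PI.
Proof. intros HN. unfold node. field. apply not_0_INR. lia. Qed.

Lemma rsum_weight_N (N : nat) : (0 < N)%nat -> rsum (weight N) N = p.
Proof.
intros HN. rewrite rsum_weight, node_N, RInt_hmeas by exact HN.
field. apply PI_neq0.
Qed.

Lemma node_nonneg (N j : nat) : (0 < N)%nat -> 0 <= node N j.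
Proof.
intros HN. pose proof PI_RGT_0. unfold node. apply Rle_mult_inv_pos.
- apply Rmult_le_pos; [lra|apply pos_INR].
- now apply lt_0_INR.
Qed.

(** On an arc of length [2 PI r / N] the kernel differs from its value at the first node by at most
    that length divided by [(r-s)^2]; the density is positive, so the errors add up against its
    total mass. *)
Lemma herglotz_sum (N : nat) (z : C) (s : R) : (0 < N)%nat -> Cmod z <= s -> s < r ->
  Cmod (m z - csum (fun j => RtoC (weight N j) / (circ r (node N j) - z)) N)%C
    <= p * (2 * PI * r / ((r - s) * (r - s))) / INR N.
Proof.
intros HN Hz Hs. pose proof PI_RGT_0 as Hpi. pose proof (Cmod_ge_0 z) as Hz0.
assert (HN0 : 0 < INR N) by now apply lt_0_INR.
assert (Hd : forall t, r - s <= Cmod (circ r t - z)%C).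
{ intros t. eapply Rle_trans; [|apply Cmod_rev_triangle]. rewrite Cmod_circ; lra. }
assert (Hn : forall t, (circ r t - z)%C <> RtoC 0).
{ intros t. apply Cmod_gt_0. specialize (Hd t). lra. }
set (del := 2 * PI * r / ((r - s) * (r - s)) / INR N).
assert (Cc : forall t, cont (circ r) t) by (intros; apply (cont_circ r (fun t => t)), continuous_id).
assert (Cu : forall t, cont (fun t => RtoC (hmeas t) / (circ r t - z))%C t).
{ intros t. apply cont_mult; [apply cont_RtoC, cont_hmeas|]. apply cont_inv; [|apply Hn].
  apply cont_minus; [apply Cc|apply cont_const]. }
assert (Hind : forall n, Cmod (RtoC (/ (2 * PI)) * CInt (fun t => RtoC (hmeas t) / (circ r t - z)) 0 (node N n)
   - csum (fun j => RtoC (weight N j) / (circ r (node N j) - z)) n)%C <= del * rsum (weight N) n).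
{ induction n.
  - simpl. unfold node. replace (2 * PI * INR 0 / INR N) with 0 by (simpl; unfold Rdiv; ring).
    replace (CInt _ 0 0) with (RtoC 0).
    + replace (_ - _)%C with (RtoC 0) by ring. rewrite Cmod_0. lra.
    + apply Ceq_ext; simpl; rewrite (RInt_point (V := R_CompleteNormedModule)); reflexivity.
  - pose proof (node_le N n HN) as Hst. pose proof (node_step_pos N HN) as Hsp.
    pose proof (node_nonneg N n HN) as Hnn.
    rewrite (CInt_Chasles _ 0 (node N n)) by (auto; lra). simpl.
    set (I1 := CInt _ 0 (node N n)) in *. set (I2 := CInt _ (node N n) (node N (S n))).
    set (T := csum _ n) in *.
    set (x := (RtoC (weight N n) / (circ r (node N n) - z))%C).
    replace (RtoC (/ (2 * PI)) * (I1 + I2) - (T + x))%C with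
      ((RtoC (/ (2 * PI)) * I1 - T) + (RtoC (/ (2 * PI)) * I2 - x))%C by ring.
    eapply Rle_trans; [apply Cmod_triangle|]. rewrite Rmult_plus_distr_l.
    apply Rplus_le_compat; [exact IHn|].
    assert (Ex : x = (RtoC (/ (2 * PI)) * CInt (fun t => / (circ r (node N n) - z) * RtoC (hmeas t)) (node N n) (node N (S n)))%C).
    { rewrite CInt_scal; [|lra|intros; apply cont_RtoC, cont_hmeas].
      replace (CInt (fun t => RtoC (hmeas t)) (node N n) (node N (S n))) with (RtoC (RInt hmeas (node N n) (node N (S n)))).
      - unfold x, weight. rewrite RtoC_mult. unfold Cdiv. ring.
      - apply Ceq_ext; simpl; [reflexivity|]. rewrite (RInt_const (V := R_CompleteNormedModule)).
        unfold scal; simpl; unfold mult; simpl. ring. }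
    rewrite Ex.
    match goal with |- Cmod (_ * _ - _ * ?i)%C <= _ => set (I3 := i) end.
    replace (RtoC (/ (2 * PI)) * I2 - RtoC (/ (2 * PI)) * I3)%C with
      (RtoC (/ (2 * PI)) * (I2 + (- RtoC 1) * I3))%C by ring.
    assert (C3 : forall t, cont (fun t => / (circ r (node N n) - z) * RtoC (hmeas t))%C t).
    { intros t. apply cont_mult; [apply cont_const|apply cont_RtoC, cont_hmeas]. }
    unfold I2, I3. rewrite <- CInt_scal by (auto; lra).
    rewrite <- CInt_plus; [|lra|auto|intros; apply cont_mult; [apply cont_const|apply C3]].
    rewrite Cmod_mult, Cmod_RtoC_pos by (left; apply Rinv_0_lt_compat; lra).
    unfold weight. rewrite <- Rmult_assoc, (Rmult_comm del), Rmult_assoc.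
    apply Rmult_le_compat_l; [left; apply Rinv_0_lt_compat; lra|].
    replace (del * RInt hmeas (node N n) (node N (S n))) with (RInt (fun t => del * hmeas t) (node N n) (node N (S n)))
      by (apply (RInt_scal (V := R_CompleteNormedModule) hmeas); apply ex_RInt_hmeas).
    apply CInt_bound; [lra| | |].
    + intros t _. apply cont_plus; [apply Cu|apply cont_mult; [apply cont_const|apply C3]].
    + intros t _. apply continuous_Rmult; [apply continuous_const|apply cont_hmeas].
    + intros t Ht.
      replace (RtoC (hmeas t) / (circ r t - z) + - RtoC 1 * (/ (circ r (node N n) - z) * RtoC (hmeas t)))%C
        with (RtoC (hmeas t) * (- (circ r t - circ r (node N n)) / ((circ r t - z) * (circ r (node N n) - z))))%C
        by (field; split; apply Hn).
      rewrite Cmod_mult, Cmod_RtoC_pos by (left; apply hmeas_pos). rewrite (Rmult_comm del).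
      apply Rmult_le_compat_l; [left; apply hmeas_pos|].
      rewrite Cmod_div by (apply Cmult_neq_0; apply Hn). rewrite Cmod_opp, Cmod_mult.
      unfold del.
      replace (2 * PI * r / ((r - s) * (r - s)) / INR N) with ((r * (2 * PI / INR N)) * / ((r - s) * (r - s))) by (field; split; lra).
      apply Rmult_le_compat.
      * apply Cmod_ge_0.
      * left. apply Rinv_0_lt_compat, Rmult_lt_0_compat; eapply Rlt_le_trans; try apply Hd; lra.
      * eapply Rle_trans; [apply circ_lipschitz; lra|]. apply Rmult_le_compat_l; lra.
      * apply Rinv_le_contravar; [apply Rmult_lt_0_compat; lra|]. apply Rmult_le_compat; try apply Hd; lra. }
specialize (Hind N). rewrite node_N, herglotz, rsum_weight_N in Hind by (try exact HN; lra).
unfold del in Hind.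
replace (m z) with (RtoC (/ (2 * PI)) * (RtoC (2 * PI) * m z))%C.
- eapply Rle_trans; [exact Hind|]. right. field. split; lra.
- rewrite Cmult_assoc, <- RtoC_mult, Rinv_l by lra. ring.
Qed.

End Herglotz.

(** * The hull of the class *)


Lemma cont_bounded (u : R -> C) (a b : R) : a <= b -> (forall t, a <= t <= b -> cont u t) ->
  exists M, 0 <= M /\ forall t, a <= t <= b -> Cmod (u t) <= M.
Proof.
intros Hab H. destruct (continuity_ab_maj (fun t => Cmod (u t)) a b Hab) as [x [Hx Hx']].
- intros t Ht. apply continuity_pt_filterlim. exact (cont_Cmod u t (H t Ht)).
- exists (Cmod (u x)). split; [apply Cmod_ge_0|exact Hx].
Qed.

(** The function [k_] in the parameter [p = 2 - 2 * alpha], with [Log] in place of the principal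
    logarithm; [p = 1] is the case [alpha = 1/2]. *)
Definition kk (p : R) (w : C) : C :=
  if Req_dec_T p 1 then (- Log (RtoC 1 - w))%C
  else (/ RtoC (p - 1) * (invpow (p - 1) w - RtoC 1))%C.

Lemma invpow_1_inv (w : C) : Re w < 1 -> invpow 1 w = (/ (RtoC 1 - w))%C.
Proof.
intros H. pose proof (Re_pos_neq0 _ (Re_1_minus _ H)) as H0.
transitivity (invpow 1 w * (RtoC 1 - w) * / (RtoC 1 - w))%C; [field; exact H0|].
rewrite invpow_1 by exact H. ring.
Qed.

(** Both branches of the definition have derivative [(1-w)^(-p)], so that arguments through
    derivatives need no case distinction. *)
Lemma cder_kk (p : R) (u : R -> C) (t : R) (v : C) : cder u t v -> Re (u t) < 1 ->
  cder (fun s => kk p (u s)) t (v * invpow p (u t))%C.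
Proof.
intros Hu H. unfold kk. destruct (Req_dec_T p 1) as [->|Hp].
- eapply cder_eq.
  + apply cder_opp, cder_Log; [|now apply Re_1_minus].
    apply cder_minus; [apply cder_const|exact Hu].
  + cbv beta. rewrite invpow_1_inv by exact H. field. now apply Re_pos_neq0, Re_1_minus.
- eapply cder_eq.
  + apply cder_scal, cder_minus; [apply cder_invpow; [exact Hu|exact H]|apply cder_const].
  + cbv beta. replace (p - 1 + 1) with p by ring. field.
    intros E. apply RtoC_inj in E. lra.
Qed.

Lemma kk_0 (p : R) : kk p (RtoC 0) = RtoC 0.
Proof.
unfold kk. destruct (Req_dec_T p 1).
- replace (RtoC 1 - RtoC 0)%C with (RtoC 1) by ring.
  replace (Log (RtoC 1)) with (RtoC 0); [ring|].
  unfold Log; apply Ceq_ext; simpl.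
  + rewrite Rmult_0_l, Rplus_0_r, Rmult_1_l, ln_1. lra.
  + unfold Rdiv. rewrite Rmult_0_l, atan_0. reflexivity.
- rewrite invpow_at_0. ring.
Qed.

Lemma cder_ray (z : C) (t : R) : cder (fun t => RtoC t * z)%C t z.
Proof.
eapply cder_eq; [apply cder_mult; [apply cder_id|apply cder_const]|]. cbv beta; ring.
Qed.

Lemma Cmod_ray (z : C) (t s : R) : Cmod z <= s -> 0 <= t <= 1 -> Cmod (RtoC t * z)%C <= s.
Proof.
intros Hz Ht. rewrite Cmod_mult, Cmod_RtoC_pos by lra. pose proof (Cmod_ge_0 z). nra.
Qed.

Lemma over_z_0 (f : C -> C) : over_z f (RtoC 0) = RtoC 1.
Proof. unfold over_z. destruct (Ceq_dec (RtoC 0) (RtoC 0)) as [|H]; [reflexivity|now contradict H]. Qed.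

Lemma over_z_neq0 (f : C -> C) (z : C) : z <> RtoC 0 -> over_z f z = (f z / z)%C.
Proof. intros H. unfold over_z. destruct (Ceq_dec z (RtoC 0)); [contradiction|reflexivity]. Qed.

Lemma csum_const (c : C) (n : nat) : csum (fun _ => c) n = (RtoC (INR n) * c)%C.
Proof.
induction n; [simpl; ring|]. rewrite S_INR, RtoC_plus. simpl csum. rewrite IHn. ring.
Qed.

(** The mean of [(1-tw)^(-p)] is discretised at the same nodes as [f(z)/z] later on, so that the two
    sums can be compared term by term. The constant bounds the derivative of the integrand in
    [t]. *)
Lemma kk_riemann (p s : R) (w : C) (n : nat) : 0 <= p -> Cmod w <= s -> s < 1 ->
  Cmod (over_z (kk p) w -
    csum (fun k => RtoC (/ INR (S n)) * invpow p (RtoC (INR k / INR (S n)) * w)) (S n))%C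
  <= p * exp (Rabs (p + 1) * - ln (1 - s)) / INR (S n).
Proof.
intros Hp Hw Hs. assert (HN : 0 < INR (S n)) by (apply lt_0_INR; lia).
assert (HR : forall t, 0 <= t <= 1 -> Re (RtoC t * w)%C < 1).
{ intros t Ht. apply Re_lt_1. eapply Rle_lt_trans; [apply Cmod_ray; eauto|lra]. }
destruct (Ceq_dec w (RtoC 0)) as [->|H0].
- rewrite over_z_0.
  rewrite (csum_ext _ (fun _ => RtoC (/ INR (S n)))).
  + rewrite csum_const, <- RtoC_mult, Rinv_r by lra.
    replace (RtoC 1 - RtoC 1)%C with (RtoC 0) by ring. rewrite Cmod_0.
    apply Rle_mult_inv_pos; [|exact HN]. apply Rmult_le_pos; [exact Hp|left; apply exp_pos].
  + intros k _. rewrite Cmult_0_r, invpow_at_0. ring.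
- rewrite over_z_neq0 by exact H0.
  pose proof (riemann_sum (fun t => / w * kk p (RtoC t * w))%C (fun t => invpow p (RtoC t * w))
    (fun t => RtoC p * w * invpow (p + 1) (RtoC t * w))%C (p * exp (Rabs (p + 1) * - ln (1 - s))) n) as H.
  cbv beta in H. rewrite Cmult_1_l, Cmult_0_l, kk_0 in H.
  replace (kk p w / w)%C with (/ w * kk p w - / w * RtoC 0)%C by (unfold Cdiv; ring).
  apply H; intros t Ht.
  + eapply cder_eq; [apply cder_scal, cder_kk; [apply cder_ray|apply HR, Ht]|]. cbv beta. field. exact H0.
  + eapply cder_eq; [apply cder_invpow; [apply cder_ray|apply HR, Ht]|]. cbv beta. ring.
  + rewrite !Cmod_mult, Cmod_RtoC_pos by exact Hp. rewrite Rmult_assoc.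
    apply Rmult_le_compat_l; [exact Hp|].
    rewrite <- (Rmult_1_l (exp _)). apply Rmult_le_compat; try apply Cmod_ge_0; [lra|].
    apply invpow_bound; [exact Hs|]. apply Cmod_ray; assumption.
Qed.

Lemma invpow_prod_bound (a b : nat -> R) (y : nat -> C) (n : nat) (w : C) (s : R) : s < 1 ->
  (forall j, Rabs (a j) <= b j) -> (forall j, Cmod (y j * w)%C <= s) ->
  Cmod (invpow_prod a y n w) <= exp (rsum b n * - ln (1 - s)).
Proof.
intros Hs Hab Hy.
assert (HL : 0 <= - ln (1 - s)).
{ assert (0 <= s) by (eapply Rle_trans; [apply Cmod_ge_0|apply (Hy O)]).
  assert (ln (1 - s) <= ln 1) by (apply ln_le; lra). rewrite ln_1 in H0. lra. }
induction n; simpl.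
- rewrite Cmod_1, Rmult_0_l, exp_0. lra.
- rewrite Cmod_mult, Rmult_plus_distr_r, exp_plus.
  apply Rmult_le_compat; try apply Cmod_ge_0; [exact IHn|].
  eapply Rle_trans; [apply invpow_bound; [exact Hs|apply Hy]|].
  assert (Hle : Rabs (a n) * - ln (1 - s) <= b n * - ln (1 - s)) by (apply Rmult_le_compat_r; auto).
  destruct Hle as [Hle|Hle]; [left; now apply exp_increasing|right; now rewrite Hle].
Qed.

Lemma invpow_prod_opp (a : nat -> R) (y : nat -> C) (n : nat) (w : C) :
  (invpow_prod a y n w * invpow_prod (fun j => - a j)%R y n w)%C = RtoC 1.
Proof.
induction n; simpl; [ring|].
transitivity ((invpow_prod a y n w * invpow_prod (fun j => - a j)%R y n w) * (invpow (a n) (y n * w) * invpow (- a n) (y n * w)))%C; [ring|].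
rewrite IHn, invpow_opp. ring.
Qed.

Lemma invpow_prod_0 (a : nat -> R) (y : nat -> C) (n : nat) : invpow_prod a y n (RtoC 0) = RtoC 1.
Proof. induction n; simpl; [reflexivity|]. rewrite IHn, Cmult_0_r, invpow_at_0. ring. Qed.

Lemma cder_invpow_prod (a : nat -> R) (y : nat -> C) (n : nat) (u : R -> C) (t : R) (v : C) :
  cder u t v -> (forall j, Re (y j * u t)%C < 1) ->
  cder (fun t => invpow_prod a y n (u t)) t
    (v * csum (fun j => RtoC (a j) * (y j * invpow 1 (y j * u t))) n * invpow_prod a y n (u t))%C.
Proof.
intros Hu Hy. induction n; simpl.
- eapply cder_eq; [apply cder_const|ring].
- eapply cder_eq.
  + apply cder_mult; [exact IHn|]. apply cder_invpow; [apply cder_scal, Hu|apply Hy].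
  + rewrite invpow_plus. ring.
Qed.

Lemma csum_dist (F G : nat -> C) (d : R) (n : nat) :
  (forall k, (k < n)%nat -> Cmod (F k - G k)%C <= d) ->
  Cmod (csum F n - csum G n)%C <= INR n * d.
Proof.
induction n; intros H.
- simpl. replace (RtoC 0 - RtoC 0)%C with (RtoC 0) by ring. rewrite Cmod_0. lra.
- rewrite S_INR. simpl csum.
  assert (Eq : (csum F n + F n - (csum G n + G n))%C = ((csum F n - csum G n) + (F n - G n))%C) by ring.
  rewrite Eq. eapply Rle_trans; [apply Cmod_triangle|].
  rewrite Rmult_plus_distr_r, Rmult_1_l.
  apply Rplus_le_compat; [apply IHn; auto|apply H; lia].
Qed.

Section Hull.
Variables (f f1 f2 f3 : C -> C) (p : R).
Hypotheses (Hf : Hol 1 f f1) (Hf1 : Hol 1 f1 f2) (Hf2 : Hol 1 f2 f3)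
  (f_0 : f (RtoC 0) = RtoC 0) (f1_0 : f1 (RtoC 0) = RtoC 1)
  (f1_neq0 : forall z, Cmod z < 1 -> f1 z <> RtoC 0)
  (Hp : 0 < p)
  (Hpos : forall z, Cmod z < 1 -> 0 < p + 2 * Re (z * (f2 z / f1 z))%C).

Let m := (fun z => f2 z * / f1 z)%C.

Lemma Hol_m : Hol 1 m (fun z => f3 z * / f1 z + f2 z * (- f2 z * / (f1 z * f1 z)))%C.
Proof. apply Hol_mult; [exact Hf2|]. apply Hol_inv; [exact Hf1|exact f1_neq0]. Qed.

(** The product with exponents [a j] and base points [y j = 1 / zeta_j] has the logarithmic
    derivative given by the discretised Herglotz formula, so it approximates [f'] once that formula
    approximates [f''/f']. The condition [|z| < r] keeps [|y j * z|] below 1. *)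
Lemma product_approx (z : C) (r : R) : Cmod z < r -> r < 1 ->
  exists K, 0 <= K /\ forall n, exists (a : nat -> R) (y : nat -> C),
    (forall j, 0 < a j) /\ (forall j, Cmod (y j) <= / r) /\ rsum a (S n) = p /\
    forall t, 0 <= t <= 1 ->
    Cmod (f1 (RtoC t * z) - invpow_prod a y (S n) (RtoC t * z))%C <= K / INR (S n).
Proof.
intros Hz Hr. pose proof (Cmod_ge_0 z) as Hz0. pose proof PI_RGT_0 as Hpi.
assert (Hr' : 0 < r < 1) by lra.
set (s := / r * Cmod z).
assert (Hs : s < 1).
{ unfold s. apply Rmult_lt_reg_l with r; [lra|]. rewrite <- Rmult_assoc, Rinv_r; lra. }
assert (Hray : forall t, 0 <= t <= 1 -> Cmod (RtoC t * z)%C < 1).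
{ intros t Ht. eapply Rle_lt_trans; [apply Cmod_ray; [apply Rle_refl|exact Ht]|lra]. }
destruct (cont_bounded (fun t => f1 (RtoC t * z))%C 0 1) as [B [HB0 HB]]; [lra| |].
{ intros t Ht. apply (cont_comp f1); [eapply cder_cont, cder_ray|].
  apply Hol_cont with 1 f2; auto. }
set (L := exp (p * - ln (1 - s))).
assert (HL : 0 < L) by apply exp_pos.
set (K0 := p * (2 * PI * r / ((r - Cmod z) * (r - Cmod z)))).
assert (HK0 : 0 <= K0).
{ unfold K0. apply Rmult_le_pos; [lra|]. apply Rle_mult_inv_pos.
  - apply Rmult_le_pos; lra.
  - apply Rmult_lt_0_compat; lra. }
assert (HK1 : 0 <= Cmod z * K0 * (B * L)) by (apply Rmult_le_pos; apply Rmult_le_pos; lra).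
exists (L * (Cmod z * K0 * (B * L))). split.
{ apply Rmult_le_pos; lra. }
intros n. assert (HN : 0 < INR (S n)) by (apply lt_0_INR; lia).
assert (Hpos' : forall w, Cmod w < 1 -> 0 < p + 2 * Re (w * m w)%C) by exact Hpos.
exists (weight m p r (S n)), (fun j => / circ r (node (S n) j))%C.
assert (Hsum := rsum_weight_N m _ p r Hol_m Hr' (S n) ltac:(lia)).
assert (Hw := fun j => weight_pos m _ p r Hol_m Hr' Hpos' (S n) j ltac:(lia)).
assert (Hsumm := fun w Hw => herglotz_sum m _ p r Hol_m Hr' Hpos' (S n) w (Cmod z) ltac:(lia) Hw Hz).
revert Hsum Hw Hsumm. generalize (weight m p r (S n)). intros a Hsum Ha Hsumm.
assert (Hc : forall j, circ r (node (S n) j) <> RtoC 0) by (intros; apply circ_neq0; lra).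
assert (Hy : forall j, Cmod (/ circ r (node (S n) j))%C = / r).
{ intros j. rewrite Cmod_inv by apply Hc. rewrite Cmod_circ; lra. }
split; [exact Ha|]. split; [intros; rewrite Hy; lra|]. split; [exact Hsum|].
set (y := fun j => (/ circ r (node (S n) j))%C).
assert (Hyw : forall j t, 0 <= t <= 1 -> Cmod (y j * (RtoC t * z))%C <= s).
{ intros j t Ht. rewrite Cmod_mult. unfold y. rewrite Hy. unfold s.
  apply Rmult_le_compat_l; [left; apply Rinv_0_lt_compat; lra|].
  apply Cmod_ray; [apply Rle_refl|exact Ht]. }
assert (HyR : forall j t, 0 <= t <= 1 -> Re (y j * (RtoC t * z))%C < 1).
{ intros j t Ht. apply Re_lt_1. eapply Rle_lt_trans; [apply Hyw, Ht|exact Hs]. }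
assert (B1 : forall t, 0 <= t <= 1 -> Cmod (invpow_prod a y (S n) (RtoC t * z)) <= L).
{ intros t Ht. unfold L. rewrite <- Hsum. apply invpow_prod_bound; [exact Hs| |intros; now apply Hyw].
  intros j. rewrite Rabs_pos_eq; [lra|left; apply Ha]. }
assert (B2 : forall t, 0 <= t <= 1 -> Cmod (invpow_prod (fun j => - a j) y (S n) (RtoC t * z)) <= L).
{ intros t Ht. unfold L. rewrite <- Hsum. apply invpow_prod_bound; [exact Hs| |intros; now apply Hyw].
  intros j. rewrite Rabs_Ropp, Rabs_pos_eq; [lra|left; apply Ha]. }
set (mN := fun w => csum (fun j => RtoC (a j) * (y j * invpow 1 (y j * w)))%C (S n)).
assert (HmN : forall t, 0 <= t <= 1 -> Cmod (m (RtoC t * z)%C - mN (RtoC t * z)%C)%C <= K0 / INR (S n)).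
{ intros t Ht. unfold mN.
  rewrite (csum_ext _ (fun j => RtoC (a j) / (circ r (node (S n) j) - RtoC t * z))%C).
  - apply Hsumm. apply Cmod_ray; [apply Rle_refl|exact Ht].
  - intros j _. rewrite invpow_1_inv by now apply HyR. unfold y. field. split; [|apply Hc].
    intros E. pose proof (Cminus_neq0 (circ r (node (S n) j)) (RtoC t * z)%C) as Hne.
    rewrite Cmod_circ in Hne by lra. apply Hne; [|exact E].
    eapply Rle_lt_trans; [apply Cmod_ray; [apply Rle_refl|exact Ht]|exact Hz]. }
(* The quotient of [f1] by the product, opposite exponents giving the inverse. It equals 1 at
   [t = 0] and its derivative is [z * (m - mN)] times itself, hence of order [1/N]. *)
set (G := fun t => (f1 (RtoC t * z) * invpow_prod (fun j => - a j)%R y (S n) (RtoC t * z))%C).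
assert (HG : forall t, 0 <= t <= 1 -> cder G t
  (z * (m (RtoC t * z) - mN (RtoC t * z)) * (f1 (RtoC t * z) * invpow_prod (fun j => - a j)%R y (S n) (RtoC t * z)))%C).
{ intros t Ht. unfold G. eapply cder_eq.
  - apply cder_mult.
    + eapply (Hf1 (RtoC t * z)%C); [now apply Hray|apply cder_ray|reflexivity].
    + apply cder_invpow_prod; [apply cder_ray|intros; now apply HyR].
  - cbv beta.
    rewrite (csum_ext _ (fun j => (- RtoC 1) * (RtoC (a j) * (y j * invpow 1 (y j * (RtoC t * z)))))%C)
      by (intros; rewrite RtoC_opp; ring).
    rewrite csum_scal. fold (mN (RtoC t * z)%C). unfold m. field. apply f1_neq0. now apply Hray. }
intros t Ht.
assert (HG1 : Cmod (G t - G 0)%C <= Cmod z * K0 * (B * L) / INR (S n)).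
{ eapply Rle_trans.
  - apply (cder_bound G (fun t => z * (m (RtoC t * z) - mN (RtoC t * z)) * (f1 (RtoC t * z) * invpow_prod (fun j => - a j)%R y (S n) (RtoC t * z)))%C 0 t (Cmod z * (K0 / INR (S n)) * (B * L))); [lra| |].
    + intros x Hx. apply HG. lra.
    + intros x Hx. cbv beta. rewrite !Cmod_mult.
      apply Rmult_le_compat.
      * apply Rmult_le_pos; apply Cmod_ge_0.
      * apply Rmult_le_pos; apply Cmod_ge_0.
      * apply Rmult_le_compat_l; [apply Cmod_ge_0|apply HmN; lra].
      * apply Rmult_le_compat; try apply Cmod_ge_0; [|apply B2; lra].
        apply HB; lra.
  - replace (Cmod z * (K0 / INR (S n)) * (B * L)) with (Cmod z * K0 * (B * L) / INR (S n))
      by (field; lra).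
    assert (0 <= Cmod z * K0 * (B * L) / INR (S n)) by (apply Rle_mult_inv_pos; lra). nra. }
assert (HG0 : G 0 = RtoC 1).
{ unfold G. rewrite Cmult_0_l, f1_0, invpow_prod_0. ring. }
rewrite HG0 in HG1.
replace (f1 (RtoC t * z) - invpow_prod a y (S n) (RtoC t * z))%C
  with (invpow_prod a y (S n) (RtoC t * z) * (G t - RtoC 1))%C.
- rewrite Cmod_mult. unfold Rdiv. rewrite Rmult_assoc.
  apply Rmult_le_compat; try apply Cmod_ge_0; [now apply B1|exact HG1].
- unfold G. transitivity (f1 (RtoC t * z)%C * (invpow_prod a y (S n) (RtoC t * z)%C *
    invpow_prod (fun j => - a j)%R y (S n) (RtoC t * z)%C) - invpow_prod a y (S n) (RtoC t * z)%C)%C; [ring|].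
  rewrite invpow_prod_opp. ring.
Qed.

(** Three errors of order [1/N] separate [f(z)/z] from the hull: its Riemann sum ([M1]), the
    replacement of [f'] by products ([K]), and the Riemann sum of [h(x z)] for a single base point
    [x] ([M2]). Letting [N] grow removes them. *)
Lemma hull (z c : C) (s S0 : R) : Cmod z < s -> s < 1 ->
  (forall w, Cmod w <= s -> Re (c * over_z (kk p) w)%C <= S0) ->
  Re (c * over_z f z)%C <= S0.
Proof.
intros Hz Hs HS. pose proof (Cmod_ge_0 z) as Hz0.
destruct (Ceq_dec z (RtoC 0)) as [->|Hzn].
{ rewrite over_z_0. rewrite <- (over_z_0 (kk p)). apply HS. rewrite Cmod_0 in *; lra. }
assert (Hzp : 0 < Cmod z) by now apply Cmod_gt_0.
(* With this radius the base points satisfy [|x| <= / r], so [|x * z| <= s], exactly the disk on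
   which [h] is controlled. *)
set (r := Cmod z / s).
assert (Hr : Cmod z < r < 1).
{ unfold r. split.
  - apply Rmult_lt_reg_r with s; [lra|]. unfold Rdiv. rewrite Rmult_assoc, Rinv_l by lra. nra.
  - apply Rmult_lt_reg_r with s; [lra|]. unfold Rdiv. rewrite Rmult_assoc, Rinv_l by lra. lra. }
assert (Hrs : / r * Cmod z = s) by (unfold r; field; lra).
destruct (product_approx z r) as [K [HK Happ]]; try lra.
destruct (cont_bounded (fun t => z * f2 (RtoC t * z))%C 0 1) as [M1 [HM1 HM1']]; [lra| |].
{ intros t Ht. apply cont_mult; [apply cont_const|].
  apply (cont_comp f2); [eapply cder_cont, cder_ray|].
  apply Hol_cont with 1 f3; [exact Hf2|].
  eapply Rle_lt_trans; [apply Cmod_ray; [apply Rle_refl|exact Ht]|lra]. }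
set (M2 := p * exp (Rabs (p + 1) * - ln (1 - s))).
assert (Hmain : forall n, Re (c * over_z f z)%C <= S0 + Cmod c * (M1 + M2 + K) / INR (S n)).
{ intros n. assert (HN : 0 < INR (S n)) by (apply lt_0_INR; lia).
  destruct (Happ n) as [a [y [Ha [Hy [Hsum Hay]]]]].
  set (zk := fun k => (RtoC (INR k / INR (S n)) * z)%C).
  (* The value 0 past the last node is a default: [hull_product] wants its bound on [z k] for every
     index. *)
  set (zk' := fun k => if le_lt_dec (S n) k then RtoC 0 else zk k).
  assert (Hk01 : forall k, (k < S n)%nat -> 0 <= INR k / INR (S n) <= 1).
  { intros k Hk. split; [apply Rle_mult_inv_pos; [apply pos_INR|exact HN]|].
    apply Rmult_le_reg_r with (INR (S n)); [exact HN|]. unfold Rdiv.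
    rewrite Rmult_assoc, Rinv_l, Rmult_1_r, Rmult_1_l by lra. apply le_INR; lia. }
  assert (Hzk : forall k, (k < S n)%nat -> zk' k = zk k).
  { intros k Hk. unfold zk'. destruct (le_lt_dec (S n) k); [lia|reflexivity]. }
  assert (T1 : Cmod (over_z f z - csum (fun k => RtoC (/ INR (S n)) * f1 (zk k)) (S n))%C <= M1 / INR (S n)).
  { pose proof (riemann_sum (fun t => / z * f (RtoC t * z))%C (fun t => f1 (RtoC t * z))
      (fun t => z * f2 (RtoC t * z))%C M1 n) as H.
    cbv beta in H. rewrite Cmult_1_l, Cmult_0_l, f_0 in H. rewrite over_z_neq0 by exact Hzn.
    replace (f z / z)%C with (/ z * f z - / z * RtoC 0)%C by (unfold Cdiv; ring).
    apply H; intros t Ht.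
    - eapply cder_eq; [apply cder_scal; eapply (Hf (RtoC t * z)%C); [|apply cder_ray|reflexivity]|cbv beta; field; exact Hzn].
      eapply Rle_lt_trans; [apply Cmod_ray; [apply Rle_refl|exact Ht]|lra].
    - eapply cder_eq; [eapply (Hf1 (RtoC t * z)%C); [|apply cder_ray|reflexivity]|cbv beta; ring].
      eapply Rle_lt_trans; [apply Cmod_ray; [apply Rle_refl|exact Ht]|lra].
    - now apply HM1'. }
  assert (T2 : Cmod (csum (fun k => RtoC (/ INR (S n)) * f1 (zk k)) (S n) -
     csum (fun k => RtoC (/ INR (S n)) * invpow_prod a y (S n) (zk k)) (S n))%C <= K / INR (S n)).
  { eapply Rle_trans; [apply (csum_dist _ _ (/ INR (S n) * (K / INR (S n))))|right; field; lra].
    intros k Hk.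
    replace (RtoC (/ INR (S n)) * f1 (zk k) - RtoC (/ INR (S n)) * invpow_prod a y (S n) (zk k))%C
      with (RtoC (/ INR (S n)) * (f1 (zk k) - invpow_prod a y (S n) (zk k)))%C by ring.
    rewrite Cmod_mult, Cmod_RtoC_pos by (left; now apply Rinv_0_lt_compat).
    apply Rmult_le_compat_l; [left; now apply Rinv_0_lt_compat|].
    apply Hay, Hk01, Hk. }
  assert (T3 : Re (csum (fun k => c * RtoC (/ INR (S n)) * invpow_prod a y (S n) (zk' k)) (S n))%C
     <= S0 + Cmod c * (M2 / INR (S n))).
  { apply (hull_product a y n (S n) (fun _ => c * RtoC (/ INR (S n)))%C zk' (/ r) (Cmod z)).
    - left; apply Rinv_0_lt_compat; lra.
    - lra.
    - intros k. unfold zk'. destruct (le_lt_dec (S n) k); [rewrite Cmod_0; lra|].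
      apply Cmod_ray; [lra|apply Hk01; lia].
    - exact Ha.
    - exact Hy.
    - intros x Hx. rewrite Hsum.
      rewrite (csum_ext _ (fun k => c * (RtoC (/ INR (S n)) * invpow p (RtoC (INR k / INR (S n)) * (x * z))))%C).
      2:{ intros k Hk. rewrite Hzk by exact Hk. unfold zk.
          replace (x * (RtoC (INR k / INR (S n)) * z))%C with (RtoC (INR k / INR (S n)) * (x * z))%C by ring. ring. }
      rewrite csum_scal.
      assert (Hxz : Cmod (x * z)%C <= s).
      { rewrite Cmod_mult, <- Hrs. apply Rmult_le_compat_r; lra. }
      pose proof (kk_riemann p s (x * z)%C n ltac:(lra) Hxz Hs) as HR. fold M2 in HR.
      match type of HR with Cmod (_ - ?i)%C <= _ => set (T := i) in * end. specialize (HS _ Hxz).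
      pose proof (Re_le_Cmod (- c * (over_z (kk p) (x * z) - T))%C) as HR2.
      rewrite Cmod_mult, Cmod_opp in HR2.
      replace (Re (- c * (over_z (kk p) (x * z) - T))%C) with
        (Re (c * T)%C - Re (c * over_z (kk p) (x * z))%C) in HR2 by (unfold Re; simpl; ring).
      pose proof (Rmult_le_compat_l _ _ _ (Cmod_ge_0 c) HR). lra. }
  rewrite (csum_ext _ (fun k => c * (RtoC (/ INR (S n)) * invpow_prod a y (S n) (zk k)))%C) in T3
    by (intros k Hk; rewrite Hzk by exact Hk; ring).
  rewrite csum_scal in T3.
  match type of T2 with Cmod (?i - ?j)%C <= _ => set (X1 := i) in *; set (X2 := j) in * end.
  assert (T4 : Cmod (over_z f z - X2)%C <= M1 / INR (S n) + K / INR (S n)).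
  { replace (over_z f z - X2)%C with ((over_z f z - X1) + (X1 - X2))%C by ring.
    eapply Rle_trans; [apply Cmod_triangle|]. lra. }
  pose proof (Re_le_Cmod (c * (over_z f z - X2))%C) as T5. rewrite Cmod_mult in T5.
  pose proof (Rmult_le_compat_l _ _ _ (Cmod_ge_0 c) T4).
  replace (Re (c * (over_z f z - X2))%C) with (Re (c * over_z f z)%C - Re (c * X2)%C) in T5
    by (unfold Re; simpl; ring).
  replace (Cmod c * (M1 + M2 + K) / INR (S n)) with
    (Cmod c * (M1 / INR (S n) + K / INR (S n)) + Cmod c * (M2 / INR (S n))) by (field; lra).
  lra. }
destruct (Rle_lt_dec (Re (c * over_z f z)%C) S0) as [|Hlt]; [assumption|exfalso].
set (X := Cmod c * (M1 + M2 + K)) in *.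
set (d := Re (c * over_z f z)%C - S0).
assert (Hd : 0 < d) by (unfold d; lra).
destruct (nfloor_ex (Rmax 0 (X / d))) as [n [_ Hn]]; [apply Rmax_l|].
specialize (Hmain n). rewrite S_INR in Hmain.
assert (Hn' : X / d < INR n + 1) by (eapply Rle_lt_trans; [apply Rmax_r|exact Hn]).
pose proof (pos_INR n).
assert (X / (INR n + 1) < d).
{ apply Rmult_lt_reg_r with (INR n + 1); [lra|]. unfold Rdiv. rewrite Rmult_assoc, Rinv_l by lra.
  apply Rmult_lt_compat_r with (r := d) in Hn'; [|exact Hd].
  unfold Rdiv in Hn'. rewrite Rmult_assoc, Rinv_l in Hn' by lra. lra. }
unfold d in *. lra.
Qed.

End Hull.

(** * Complex power series *)


(** Convergence by coordinates, so that tests and sums of real series apply; it agrees with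
    convergence in the normed module [C] by [Cser_is_series]. *)
Definition Cser (a : nat -> C) (l : C) : Prop :=
  is_series (fun n => Re (a n)) (Re l) /\ is_series (fun n => Im (a n)) (Im l).

Lemma sum_n_C (a : nat -> C) (n : nat) :
  sum_n (G := AbelianGroup.AbelianMonoid C_AbelianGroup) a n = (sum_n (fun n => Re (a n)) n, sum_n (fun n => Im (a n)) n).
Proof.
induction n.
- rewrite !sum_O. apply surjective_pairing.
- rewrite !sum_Sn, IHn. reflexivity.
Qed.

Lemma Cser_is_series (a : nat -> C) (l : C) :
  is_series (K := C_AbsRing) (V := C_NormedModule) a l <-> Cser a l.
Proof.
split.
- intros H. split.
  + assert (H1 : filterlim (fun n => fst (sum_n (G := AbelianGroup.AbelianMonoid C_AbelianGroup) a n)) eventually (locally (fst l))).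
    { eapply filterlim_comp; [exact H|]. apply (continuous_fst (U := R_UniformSpace) (V := R_UniformSpace)). }
    eapply filterlim_ext; [|exact H1]. intros n. exact (f_equal fst (sum_n_C a n)).
  + assert (H1 : filterlim (fun n => snd (sum_n (G := AbelianGroup.AbelianMonoid C_AbelianGroup) a n)) eventually (locally (snd l))).
    { eapply filterlim_comp; [exact H|]. apply (continuous_snd (U := R_UniformSpace) (V := R_UniformSpace)). }
    eapply filterlim_ext; [|exact H1]. intros n. exact (f_equal snd (sum_n_C a n)).
- intros [H1 H2]. apply filterlim_locally. intros eps.
  pose proof (proj1 (filterlim_locally _ _) H1 eps) as E1.
  pose proof (proj1 (filterlim_locally _ _) H2 eps) as E2.
  generalize (filter_and _ _ E1 E2). apply filter_imp. intros n [A B].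
  assert (Bl : ball (M := C_UniformSpace) l eps
    (sum_n (fun n => Re (a n)) n, sum_n (fun n => Im (a n)) n)) by (split; assumption).
  rewrite <- sum_n_C in Bl. exact Bl.
Qed.

Lemma Cser_ext (a b : nat -> C) (l : C) : (forall n, a n = b n) -> Cser a l -> Cser b l.
Proof.
intros H [H1 H2]. split; (eapply is_series_ext; [|eassumption]); intros n; simpl; now rewrite H.
Qed.

Lemma Cser_plus (a b : nat -> C) (la lb : C) : Cser a la -> Cser b lb ->
  Cser (fun n => a n + b n)%C (la + lb)%C.
Proof.
intros [H1 H2] [H3 H4]. split.
- exact (is_series_plus _ _ _ _ H1 H3).
- exact (is_series_plus _ _ _ _ H2 H4).
Qed.

Lemma Cser_scal (c : C) (a : nat -> C) (l : C) : Cser a l -> Cser (fun n => c * a n)%C (c * l)%C.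
Proof.
intros [H1 H2]. split.
- exact (is_series_minus _ _ _ _ (is_series_scal (Re c) _ _ H1) (is_series_scal (Im c) _ _ H2)).
- exact (is_series_plus _ _ _ _ (is_series_scal (Re c) _ _ H2) (is_series_scal (Im c) _ _ H1)).
Qed.

Lemma Cser_unique (a : nat -> C) (l l' : C) : Cser a l -> Cser a l' -> l = l'.
Proof.
intros [H1 H2] [H3 H4].
apply Ceq_ext; [rewrite <- (is_series_unique _ _ H1)|rewrite <- (is_series_unique _ _ H2)];
  now apply is_series_unique.
Qed.

Lemma Cser_bound (a : nat -> C) (b : nat -> R) (l : C) : Cser a l ->
  (forall n, Cmod (a n) <= b n) -> ex_series b -> Cmod l <= Series b.
Proof.
intros Ha Hab Hb.
assert (Hb0 : forall n, 0 <= b n) by (intros; eapply Rle_trans; [apply Cmod_ge_0|apply Hab]).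
assert (HS : 0 <= Series b).
{ assert (Ex : forall n, Rabs (b n) = b n) by (intros; now apply Rabs_pos_eq).
  rewrite <- (Series_ext _ _ Ex). eapply Rle_trans; [apply Rabs_pos|apply Series_Rabs].
  apply (ex_series_ext b); [|exact Hb]. intros n. now rewrite !Ex. }
apply Cmod_le_dual; [exact HS|].
intros c. destruct (Cser_scal c _ _ Ha) as [H1 _].
rewrite <- (is_series_unique _ _ H1).
rewrite <- Series_scal_l.
apply Rle_trans with (Series (fun n => Rabs (Re (c * a n)%C))).
- eapply Rle_trans; [apply Rle_abs|]. apply Series_Rabs.
  apply (ex_series_le (V := R_CompleteNormedModule)) with (fun n => Cmod c * b n).
  + intros n. change (Rabs (Rabs (Re (c * a n)%C)) <= Cmod c * b n). rewrite Rabs_Rabsolu.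
    eapply Rle_trans; [apply re_le_Cmod|]. rewrite Cmod_mult. apply Rmult_le_compat_l; [apply Cmod_ge_0|apply Hab].
  + apply (ex_series_scal (Cmod c) b Hb).
- apply Series_le.
  + intros n. split; [apply Rabs_pos|].
    eapply Rle_trans; [apply re_le_Cmod|]. rewrite Cmod_mult. apply Rmult_le_compat_l; [apply Cmod_ge_0|apply Hab].
  + apply (ex_series_scal (Cmod c) b Hb).
Qed.

Lemma Cser_exists (a : nat -> C) (b : nat -> R) :
  (forall n, Cmod (a n) <= b n) -> ex_series b -> exists l, Cser a l.
Proof.
intros Hab Hb.
exists (Series (fun n => Re (a n)), Series (fun n => Im (a n))).
split; simpl; apply Series_correct; apply (ex_series_le (V := R_CompleteNormedModule)) with b; try exact Hb; intros n.
- eapply Rle_trans; [apply re_le_Cmod|apply Hab].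
- eapply Rle_trans; [apply Im_le_Cmod|apply Hab].
Qed.

Lemma Cser_shift (a : nat -> C) (l : C) : a O = RtoC 0 -> Cser (fun n => a (S n)) l -> Cser a l.
Proof.
intros H0 [H1 H2].
split; apply is_series_decr_1; rewrite H0; simpl.
- match goal with |- is_series _ ?x => replace x with (Re l) by (unfold plus, opp; simpl; ring) end. exact H1.
- match goal with |- is_series _ ?x => replace x with (Im l) by (unfold plus, opp; simpl; ring) end. exact H2.
Qed.

Lemma Cser_incr (a : nat -> C) (l : C) : a O = RtoC 0 -> Cser a l -> Cser (fun n => a (S n)) l.
Proof.
intros H0 [H1 H2].
split; [apply (is_series_incr_1 (V := R_NormedModule) (fun n => Re (a n)))|
  apply (is_series_incr_1 (V := R_NormedModule) (fun n => Im (a n)))]; rewrite H0; simpl.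
- match goal with |- is_series _ ?x => replace x with (Re l) by (unfold plus; simpl; ring) end. exact H1.
- match goal with |- is_series _ ?x => replace x with (Im l) by (unfold plus; simpl; ring) end. exact H2.
Qed.

Lemma Cser_terms_bounded (a : nat -> C) (l : C) : Cser a l -> exists M, forall n, Cmod (a n) <= M.
Proof.
assert (HR : forall (u : nat -> R) x, is_series u x -> exists M, forall n, Rabs (u n) <= M).
{ intros u x Hu. destruct (filterlim_bounded (V := R_NormedModule) u) as [M HM].
  - exists 0. apply ex_series_lim_0. eexists; exact Hu.
  - exists M. exact HM. }
intros [H1 H2]. destruct (HR _ _ H1) as [M1 HM1]. destruct (HR _ _ H2) as [M2 HM2].
exists (M1 + M2). intros n.
replace (a n) with (RtoC (Re (a n)) + Ci * RtoC (Im (a n)))%C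
  by (apply Ceq_ext; unfold Re, Im; simpl; ring).
eapply Rle_trans; [apply Cmod_triangle|]. rewrite Cmod_mult, Cmod_Ci, !Cmod_R, Rmult_1_l.
apply Rplus_le_compat; [apply HM1|apply HM2].
Qed.

Definition Cps (a : nat -> C) (w l : C) : Prop := Cser (fun n => w ^ n * a n)%C l.

Lemma Cps_is_pseries (a : nat -> C) (w l : C) :
  @is_pseries C_AbsRing C_NormedModule a w l <-> Cps a w l.
Proof.
unfold is_pseries, Cps. rewrite <- Cser_is_series.
assert (E : forall n, @scal C_AbsRing C_NormedModule (pow_n (K := C_AbsRing) w n) (a n) = (w ^ n * a n)%C).
{ intros n. change (@scal C_AbsRing C_NormedModule (pow_n (K := C_AbsRing) w n) (a n)) with (pow_n (K := C_AbsRing) w n * a n)%C.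
  apply (f_equal (fun x => (x * a n)%C)). induction n; [reflexivity|]. simpl. rewrite <- IHn. reflexivity. }
split; apply is_series_ext; intros n; [|symmetry]; apply E.
Qed.

Definition dcoef (a : nat -> C) (n : nat) : C := (RtoC (INR (S n)) * a (S n))%C.

(** The remainder for the next exponent is [w + h] times the present one plus [h^2] times a multiple
    of [w^(n+1)]. The constant is twice that of Taylor's formula, but it is the coefficient of the
    twice differentiated power series and so can be summed. *)
Lemma pow_remainder (w h : C) (r : R) (n : nat) : Cmod w <= r -> Cmod (w + h)%C <= r ->
  Cmod ((w + h) ^ S (S n) - w ^ S (S n) - h * (RtoC (INR (S (S n))) * w ^ S n))%C
   <= INR (S n) * INR (S (S n)) * r ^ n * (Cmod h * Cmod h).
Proof.
intros Hw Hwh. pose proof (Cmod_ge_0 h) as Hh. pose proof (Cmod_ge_0 w) as Hw0.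
assert (Hrn : forall k, 0 <= r ^ k) by (intros; apply pow_le; lra).
induction n.
- simpl INR. replace ((w + h) ^ 2 - w ^ 2 - h * (RtoC (1 + 1) * w ^ 1))%C with (h * h)%C
    by (simpl; rewrite RtoC_plus; ring).
  rewrite Cmod_mult. simpl. pose proof (Rmult_le_pos _ _ Hh Hh). lra.
- set (e := ((w + h) ^ S (S n) - w ^ S (S n) - h * (RtoC (INR (S (S n))) * w ^ S n))%C) in *.
  replace ((w + h) ^ S (S (S n)) - w ^ S (S (S n)) - h * (RtoC (INR (S (S (S n)))) * w ^ S (S n)))%C
    with ((w + h) * e + h * h * (RtoC (INR (S (S n))) * w ^ S n))%C.
  2:{ unfold e. rewrite (S_INR (S (S n))), RtoC_plus. simpl Cpow. ring. }
  eapply Rle_trans; [apply Cmod_triangle|].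
  rewrite !Cmod_mult, Cmod_RtoC_pos, Cmod_pow by apply pos_INR.
  assert (A1 : Cmod (w + h)%C * Cmod e <= r * (INR (S n) * INR (S (S n)) * r ^ n * (Cmod h * Cmod h)))
    by (apply Rmult_le_compat; auto using Cmod_ge_0).
  assert (A2 : Cmod w ^ S n <= r ^ S n) by (apply pow_incr; lra).
  assert (A3 : Cmod h * Cmod h * (INR (S (S n)) * Cmod w ^ S n) <= Cmod h * Cmod h * (INR (S (S n)) * r ^ S n)).
  { apply Rmult_le_compat_l; [apply Rmult_le_pos; lra|]. apply Rmult_le_compat_l; [apply pos_INR|exact A2]. }
  replace (INR (S (S n)) * INR (S (S (S n))) * r ^ S n * (Cmod h * Cmod h)) with
    (r * (INR (S n) * INR (S (S n)) * r ^ n * (Cmod h * Cmod h)) +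
     Cmod h * Cmod h * (INR (S (S n)) * r ^ S n) + Cmod h * Cmod h * (INR (S (S n)) * r ^ S n)).
  2:{ rewrite (S_INR (S (S n))), (S_INR (S n)). simpl pow. ring. }
  assert (0 <= Cmod h * Cmod h * (INR (S (S n)) * r ^ S n)).
  { apply Rmult_le_pos; [apply Rmult_le_pos; lra|apply Rmult_le_pos; [apply pos_INR|apply Hrn]]. }
  lra.
Qed.

(** Complex differentiability with a quadratic remainder. Power series provide it, and it implies
    both the derivative [C_derive] and the derivative along curves [Hder]. *)
Definition qdiff (g : C -> C) (z l : C) : Prop :=
  exists K d, 0 <= K /\ 0 < d /\ forall h, Cmod h < d ->
    Cmod (g (z + h) - g z - h * l)%C <= K * (Cmod h * Cmod h).

(** Bounded terms at a larger radius make the series of moduli, differentiated twice, converge at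
    [r]. Its sum is the constant of the quadratic remainder. *)
Lemma pseries_derive (a : nat -> C) (rho : R) (g : C -> C) :
  (forall w, Cmod w < rho -> Cps a w (g w)) ->
  forall w, Cmod w < rho -> exists l, Cps (dcoef a) w l /\ qdiff g w l.
Proof.
intros Hg w Hw. pose proof (Cmod_ge_0 w) as Hw0.
(* Boundedness of the terms is used at [r'], absolute convergence at [r], and [h] is confined by
   [|w + h| <= r]. *)
set (r := (Cmod w + rho) / 2). set (r' := (r + rho) / 2).
assert (Hr : Cmod w < r < r' /\ r' < rho) by (unfold r', r; lra).
set (b := fun n => Cmod (a n)).
assert (HR' : Cmod (RtoC r') = r') by (apply Cmod_RtoC_pos; lra).
destruct (Cser_terms_bounded _ _ (Hg (RtoC r') ltac:(rewrite HR'; lra))) as [M HM].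
assert (Hcv : Rbar_lt (Rabs r) (CV_radius b)).
{ apply Rbar_lt_le_trans with (Finite r').
  - simpl. rewrite Rabs_pos_eq; lra.
  - apply (CV_radius_bounded b). exists M. intros n. specialize (HM n).
    rewrite Cmod_mult, Cmod_pow, HR' in HM.
    rewrite Rabs_mult, (Rabs_pos_eq (b n)) by apply Cmod_ge_0.
    rewrite (Rabs_pos_eq (r' ^ n)) by (apply pow_le; lra). unfold b. lra. }
assert (Hcv1 : Rbar_lt (Rabs r) (CV_radius (PS_derive b))) by now rewrite CV_radius_derive.
assert (Hcv2 : Rbar_lt (Rabs r) (CV_radius (PS_derive (PS_derive b)))) by now rewrite !CV_radius_derive.
apply CV_disk_inside in Hcv1. apply CV_disk_inside in Hcv2.
assert (Hrn : forall n, 0 <= r ^ n) by (intros; apply pow_le; lra).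
destruct (Cser_exists (fun n => w ^ n * dcoef a n)%C (fun n => Rabs (PS_derive b n * r ^ n))) as [l Hl]; [|exact Hcv1|].
{ intros n. unfold dcoef, PS_derive. rewrite !Cmod_mult, Cmod_pow, Cmod_RtoC_pos by apply pos_INR.
  rewrite Rabs_pos_eq.
  - rewrite Rmult_comm. fold (b (S n)). apply Rmult_le_compat_l.
    + apply Rmult_le_pos; [apply pos_INR|apply Cmod_ge_0].
    + apply pow_incr; lra.
  - apply Rmult_le_pos; [|apply Hrn]. apply Rmult_le_pos; [apply pos_INR|apply Cmod_ge_0]. }
exists l. split; [exact Hl|].
exists (Series (fun n => Rabs (PS_derive (PS_derive b) n * r ^ n))), (r - Cmod w).
set (D := Series _).
assert (HD : 0 <= D).
{ unfold D. eapply Rle_trans; [apply Rabs_pos|apply (Series_Rabs _ Hcv2)]. }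
split; [exact HD|]. split; [lra|].
intros h Hh.
assert (Hwh : Cmod (w + h)%C <= r) by (eapply Rle_trans; [apply Cmod_triangle|lra]).
assert (L1 : Cser (fun n => match n with O => RtoC 0 | S k => w ^ k * dcoef a k end)%C l).
{ apply Cser_shift; [reflexivity|]. exact Hl. }
(* The constant and linear terms leave no remainder; the two zeros are then dropped to match the
   index of [pow_remainder]. *)
assert (L2 : Cser (fun n => match n with
    | S (S k) => ((w + h) ^ n - w ^ n - h * (RtoC (INR n) * w ^ S k)) * a n | _ => RtoC 0 end)%C
    (g (w + h) - g w - h * l)%C).
{ replace (g (w + h) - g w - h * l)%C with (g (w + h) + (- RtoC 1) * g w + (- h) * l)%C by ring.
  eapply Cser_ext; [|apply Cser_plus; [apply Cser_plus; [apply (Hg (w + h)%C); lra|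
    apply (Cser_scal (- RtoC 1)%C), (Hg w Hw)]|apply (Cser_scal (- h)%C), L1]].
  intros n. cbv beta. destruct n as [|[|k]].
  - simpl. ring.
  - unfold dcoef. simpl. ring.
  - unfold dcoef. ring. }
assert (L3 : Cser (fun k => ((w + h) ^ S (S k) - w ^ S (S k) - h * (RtoC (INR (S (S k))) * w ^ S k)) * a (S (S k)))%C
    (g (w + h) - g w - h * l)%C).
{ apply (Cser_incr (fun n => match n with
    | S k => ((w + h) ^ S (S k) - w ^ S (S k) - h * (RtoC (INR (S (S k))) * w ^ S k)) * a (S (S k))
    | _ => RtoC 0 end)%C); [reflexivity|].
  eapply Cser_ext; [|exact (Cser_incr _ _ eq_refl L2)]. intros [|n]; reflexivity. }
rewrite Rmult_comm. unfold D. rewrite <- Series_scal_l.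
apply (Cser_bound _ _ _ L3).
- intros n. rewrite Cmod_mult.
  assert (E1 : Rabs (PS_derive (PS_derive b) n * r ^ n) = INR (S n) * INR (S (S n)) * r ^ n * b (S (S n))).
  { unfold PS_derive. rewrite Rabs_pos_eq; [ring|].
    apply Rmult_le_pos; [|apply Hrn].
    apply Rmult_le_pos; [apply pos_INR|apply Rmult_le_pos; [apply pos_INR|apply Cmod_ge_0]]. }
  rewrite E1. pose proof (pow_remainder w h r n ltac:(lra) Hwh) as P.
  apply Rmult_le_compat_r with (r := Cmod (a (S (S n)))) in P; [|apply Cmod_ge_0].
  unfold b. lra.
- apply (ex_series_scal (Cmod h * Cmod h) _ Hcv2).
Qed.

Lemma qdiff_is_derive (g : C -> C) (z l : C) : qdiff g z l ->
  @is_derive C_AbsRing C_NormedModule g z l.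
Proof.
intros [K [d [HK [Hd H]]]]. split; [apply is_linear_scal_l|].
intros x Hx. apply (is_filter_lim_locally_unique (K := C_AbsRing) (V := AbsRing_NormedModule C_AbsRing)) in Hx. subst x.
intros eps.
assert (P : 0 < Rmin d (eps / (K + 1))).
{ apply Rmin_glb_lt; [exact Hd|]. apply Rdiv_lt_0_compat; [apply eps|lra]. }
exists (mkposreal _ P). intros y Hy.
assert (Hy' : Cmod (y - z)%C < Rmin d (eps / (K + 1))) by exact Hy.
pose proof (Rmin_l d (eps / (K + 1))). pose proof (Rmin_r d (eps / (K + 1))).
specialize (H (y - z)%C ltac:(lra)).
assert (Ey : @eq C (z + (y - z))%C y) by ring. rewrite Ey in H.
change (Cmod (g y - g z - (y - z) * l)%C <= eps * Cmod (y - z)%C).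
eapply Rle_trans; [exact H|]. rewrite <- Rmult_assoc.
apply Rmult_le_compat_r; [apply Cmod_ge_0|].
apply Rle_trans with ((K + 1) * (eps / (K + 1))); [|right; field; lra].
pose proof (Cmod_ge_0 (y - z)%C). apply Rmult_le_compat; lra.
Qed.

Lemma qdiff_C_derive (g : C -> C) (z l : C) : qdiff g z l -> C_derive g z = l.
Proof. intros H. apply is_C_derive_unique, qdiff_is_derive, H. Qed.

Lemma qdiff_cont (g : C -> C) (z l : C) : qdiff g z l -> cont g z.
Proof.
intros [K [d [HK [Hd H]]]].
apply cont_of_lipschitz with (K * d + Cmod l) d; [exact Hd| |].
{ apply Rplus_le_le_0_compat; [apply Rmult_le_pos; lra|apply Cmod_ge_0]. }
intros w Hw. specialize (H _ Hw). replace (z + (w - z))%C with w in H by ring.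
replace (g w - g z)%C with ((g w - g z - (w - z) * l) + (w - z) * l)%C by ring.
eapply Rle_trans; [apply Cmod_triangle|]. rewrite Cmod_mult.
pose proof (Cmod_ge_0 (w - z)%C).
assert (K * (Cmod (w - z)%C * Cmod (w - z)%C) <= K * (d * Cmod (w - z)%C)).
{ apply Rmult_le_compat_l; [exact HK|]. apply Rmult_le_compat_r; lra. }
lra.
Qed.

Lemma is_derive_small (e q : R -> R) (t : R) :
  locally t (fun s => Rabs (e s) <= q s) -> e t = 0 -> q t = 0 -> is_derive q t 0 -> is_derive e t 0.
Proof.
intros Hloc He Hq [_ Hd]. split; [apply is_linear_scal_l|].
intros x Hx eps. specialize (Hd x Hx eps).
pose proof (is_filter_lim_locally_unique (K := R_AbsRing) (V := AbsRing_NormedModule R_AbsRing) _ _ Hx) as Ex.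
change (t = x) in Ex. subst x.
generalize (filter_and _ _ Hloc Hd). apply filter_imp. intros s [H1 H2].
rewrite He. rewrite Hq in H2.
eapply Rle_trans; [|exact H2].
unfold norm, minus, plus, opp, scal; simpl. unfold abs, mult; simpl.
replace (e s + - 0 + - ((s + - t) * 0)) with (e s) by ring.
replace (q s + - 0 + - ((s + - t) * 0)) with (q s) by ring.
eapply Rle_trans; [exact H1|apply Rle_abs].
Qed.

(** Along a curve the remainder is at most [K |u s - u t|^2], whose derivative at [t] is 0; what is
    left is affine in [u s]. *)
Lemma qdiff_Hder (g : C -> C) (z l : C) : qdiff g z l -> Hder g z l.
Proof.
intros [K [d [HK [Hd H]]]] u t v Hu <-.
set (q := fun s => K * ((Re (u s) - Re (u t)) * (Re (u s) - Re (u t)) + (Im (u s) - Im (u t)) * (Im (u s) - Im (u t)))).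
assert (Hcm : forall z : C, Cmod z * Cmod z = Re z * Re z + Im z * Im z).
{ intros w. pose proof (Cmod2_alt w) as E. simpl in E. rewrite !Rmult_1_r in E. exact E. }
assert (Hq : is_derive q t 0).
{ unfold q. eapply is_derive_eq.
  - apply is_derive_Rmult; [apply (is_derive_const (V := R_NormedModule))|].
    apply is_derive_Rplus; apply is_derive_Rmult;
    (apply is_derive_Rplus; [first [exact (proj1 Hu)|exact (proj2 Hu)]|
       apply is_derive_Ropp, (is_derive_const (V := R_NormedModule))]).
  - change (@zero R_NormedModule) with 0. cbv beta. ring. }
set (e := fun s => (g (u s) - g (u t) - (u s - u t) * l)%C).
assert (Hloc : locally t (fun s => Cmod (e s) <= q s)).
{ pose proof (cder_cont _ _ _ Hu) as Hc.
  assert (Hc2 := cont_Cmod _ _ (cont_minus _ _ _ Hc (cont_const (u t) t))).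
  pose proof (proj1 (filterlim_locally _ _) Hc2 (mkposreal d Hd)) as Hl.
  eapply filter_imp; [|exact Hl]. intros s Hs.
  assert (Hs' : Rabs (Cmod (u s - u t)%C - Cmod (u t - u t)%C) < d) by exact Hs.
  replace (u t - u t)%C with (RtoC 0) in Hs' by ring. rewrite Cmod_0, Rminus_0_r in Hs'.
  apply Rabs_def2 in Hs'. specialize (H (u s - u t)%C ltac:(lra)).
  replace (u t + (u s - u t))%C with (u s) in H by ring.
  eapply Rle_trans; [exact H|]. right. unfold q. rewrite Hcm. f_equal. }
assert (He : cder e t (RtoC 0)).
{ assert (E0 : e t = RtoC 0) by (unfold e; ring).
  split; (apply is_derive_small with q; [| | |exact Hq]).
  - eapply filter_imp; [|exact Hloc]. intros s Hs. eapply Rle_trans; [apply re_le_Cmod|exact Hs].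
  - rewrite E0; reflexivity.
  - unfold q; ring.
  - eapply filter_imp; [|exact Hloc]. intros s Hs. eapply Rle_trans; [apply Im_le_Cmod|exact Hs].
  - rewrite E0; reflexivity.
  - unfold q; ring. }
apply (cder_ext (fun s => e s + (g (u t) + (u s - u t) * l))%C); [intros; unfold e; ring|].
eapply cder_eq.
- apply cder_plus; [exact He|]. apply cder_plus; [apply cder_const|].
  apply cder_mult; [apply cder_minus; [exact Hu|apply cder_const]|apply cder_const].
- cbv beta. ring.
Qed.

Lemma pseries_qdiff (f : C -> C) (z0 : C) (a : nat -> C) (rho : R) :
  (forall z, Cmod (z - z0)%C < rho -> Cps a (z - z0)%C (f z)) ->
  forall z, Cmod (z - z0)%C < rho ->
  Cps (dcoef a) (z - z0)%C (C_derive f z) /\ qdiff f z (C_derive f z).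
Proof.
intros H z Hz.
destruct (pseries_derive a rho (fun w => f (z0 + w)%C)) with (w := (z - z0)%C) as [l [H1 H2]].
- intros w Hw. specialize (H (z0 + w)%C).
  replace (z0 + w - z0)%C with w in H by ring. now apply H.
- exact Hz.
- assert (H3 : qdiff f z l).
  { destruct H2 as [K [d [HK [Hd H2]]]]. exists K, d. split; [exact HK|split; [exact Hd|]].
    intros h Hh. specialize (H2 h Hh).
    replace (z0 + (z - z0 + h))%C with (z + h)%C in H2 by ring.
    replace (z0 + (z - z0))%C with z in H2 by ring. exact H2. }
  rewrite (qdiff_C_derive _ _ _ H3). split; assumption.
Qed.

Lemma analytic_qdiff (f : C -> C) (z : C) : analytic_on_disk f -> Cmod z < 1 -> qdiff f z (C_derive f z).
Proof.
intros Hf Hz. destruct (Hf z Hz) as [a [rho [Hrho H]]].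
apply (pseries_qdiff f z a rho).
- intros w Hw. apply Cps_is_pseries, H, Hw.
- replace (z - z)%C with (RtoC 0) by ring. rewrite Cmod_0. exact Hrho.
Qed.

Lemma analytic_derive (f : C -> C) : analytic_on_disk f -> analytic_on_disk (C_derive f).
Proof.
intros Hf z Hz. destruct (Hf z Hz) as [a [rho [Hrho H]]].
exists (dcoef a), rho. split; [exact Hrho|]. intros w Hw.
apply Cps_is_pseries. apply (pseries_qdiff f z a rho); [|exact Hw].
intros x Hx. apply Cps_is_pseries, H, Hx.
Qed.

Lemma analytic_Hol (f : C -> C) : analytic_on_disk f -> Hol 1 f (C_derive f).
Proof.
intros Hf z Hz. split.
- apply qdiff_Hder, analytic_qdiff; assumption.
- eapply qdiff_cont, analytic_qdiff; [apply analytic_derive, Hf|exact Hz].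
Qed.

(** With [p = 2 - 2 * alpha], twice the excess of [Re (1 + z f''/f')] over [alpha] is
    [p + 2 Re (z f''/f')], the density required to be positive. *)
Lemma hull_convex_of_order (alpha : R) (f : C -> C) (z c : C) (s S0 : R) :
  alpha < 1 -> convex_of_order alpha f -> Cmod z < s -> s < 1 ->
  (forall w, Cmod w <= s -> Re (c * over_z (kk (2 - 2 * alpha)) w)%C <= S0) ->
  Re (c * over_z f z)%C <= S0.
Proof.
intros Ha [Hf [H0 [H1 H2]]].
assert (Hf1 := analytic_derive _ Hf). assert (Hf2 := analytic_derive _ Hf1).
apply (hull f (C_derive f) (C_derive (C_derive f)) (C_derive (C_derive (C_derive f))));
  auto using analytic_Hol; try lra.
- intros w Hw. now apply H2.
- intros w Hw. destruct (H2 w Hw) as [_ H3].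
  replace (Re (RtoC 1 + w * C_derive (C_derive f) w / C_derive f w)%C) with
    (1 + Re (w * (C_derive (C_derive f) w / C_derive f w))%C) in H3.
  + lra.
  + unfold Cdiv. rewrite Cmult_assoc. reflexivity.
Qed.

(** * The extremal function *)


Lemma k_kk (alpha : R) (w : C) : Re w < 1 -> k_ alpha w = kk (2 - 2 * alpha) w.
Proof.
intros H. unfold k_, kk. rewrite (Clog_Log (RtoC 1 - w)%C) by now apply Re_1_minus.
destruct (Req_dec_T alpha (1 / 2)) as [Ea|Ea]; destruct (Req_dec_T (2 - 2 * alpha) 1) as [Ep|Ep];
  try lra; [reflexivity|].
unfold Cpower. rewrite (Clog_Log (RtoC 1 - w)%C) by now apply Re_1_minus.
replace (2 - 2 * alpha - 1) with (1 - 2 * alpha) by ring.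
unfold invpow. replace (2 * alpha - 1) with (- (1 - 2 * alpha)) by ring. reflexivity.
Qed.

(* Taylor coefficients of [(1-u)^(-p)] and of its primitive. *)
Fixpoint binom_coef (p : R) (n : nat) : R :=
  match n with O => 1 | S m => binom_coef p m * (p + INR m) / INR (S m) end.

Definition kk_coef (p : R) (n : nat) : C :=
  match n with O => RtoC 0 | S m => RtoC (binom_coef p m / INR (S m)) end.

Lemma binom_coef_S (p : R) (n : nat) :
  binom_coef p (S n) = binom_coef p n * (p + INR n) / INR (S n).
Proof. reflexivity. Qed.

(** Comparison with the case [p = 2], whose coefficients are [n + 1]. Consequently the coefficients
    of the primitive are at most 1. *)
Lemma binom_coef_bound (p : R) (n : nat) : 0 <= p <= 2 -> 0 <= binom_coef p n <= INR (S n).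
Proof.
intros Hp. induction n; [simpl; lra|].
pose proof (pos_INR n) as Hn. rewrite binom_coef_S. rewrite !S_INR in *.
split.
- apply Rle_mult_inv_pos; [|lra]. apply Rmult_le_pos; lra.
- apply Rmult_le_reg_r with (INR n + 1); [lra|].
  unfold Rdiv. rewrite Rmult_assoc, Rinv_l by lra. nra.
Qed.

Lemma dcoef_kk_coef (p : R) (n : nat) : dcoef (kk_coef p) n = RtoC (binom_coef p n).
Proof.
unfold dcoef, kk_coef. rewrite <- RtoC_mult. f_equal. field. rewrite S_INR. pose proof (pos_INR n). lra.
Qed.

Lemma kk_pseries_exists (p : R) (u : C) : 0 <= p <= 2 -> Cmod u < 1 -> exists l, Cps (kk_coef p) u l.
Proof.
intros Hp Hu. apply (Cser_exists _ (fun n => Cmod u ^ n)).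
- intros n. rewrite Cmod_mult, Cmod_pow.
  rewrite <- (Rmult_1_r (Cmod u ^ n)) at 2. apply Rmult_le_compat_l; [apply pow_le, Cmod_ge_0|].
  destruct n; unfold kk_coef; [rewrite Cmod_0; lra|].
  pose proof (binom_coef_bound p n Hp) as B.
  assert (HS : 0 < INR (S n)) by (apply lt_0_INR; lia).
  rewrite Cmod_RtoC_pos by (apply Rle_mult_inv_pos; lra).
  apply Rmult_le_reg_r with (INR (S n)); [exact HS|].
  unfold Rdiv. rewrite Rmult_assoc, Rinv_l by lra. lra.
- apply ex_series_geom. rewrite Rabs_pos_eq by apply Cmod_ge_0. exact Hu.
Qed.

Lemma Cser_single (x : C) : Cser (fun n => match n with O => x | S _ => RtoC 0 end) x.
Proof.
assert (H : forall y : R, is_series (fun n => match n with O => y | S _ => 0 end) y).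
{ intros y. apply (filterlim_ext (fun _ => y)); [|apply filterlim_const].
  induction x0; [now rewrite sum_O|]. rewrite sum_Sn, <- IHx0. unfold plus; simpl; ring. }
split; (eapply is_series_ext; [|apply H]); intros [|n]; reflexivity.
Qed.

(** Let [T0] be the sum of the series and [T1] its derivative. The recursion of the coefficients is
    the equation [(1-w) T1' = p T1], so [T1 (1-w)^p] is constant along rays and [T1 = (1-w)^(-p)];
    then [T0] and [kk p] have equal derivatives and both vanish at 0. *)
Lemma kk_pseries (p : R) (u : C) : 0 <= p <= 2 -> Cmod u < 1 -> Cps (kk_coef p) u (kk p u).
Proof.
intros Hp Hu.
pose (T0 := (fun w => (Series (fun n => Re (w ^ n * kk_coef p n)%C), Series (fun n => Im (w ^ n * kk_coef p n)%C))) : C -> C).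
assert (H0 : forall w, Cmod w < 1 -> Cps (kk_coef p) w (T0 w)).
{ intros w Hw. destruct (kk_pseries_exists p w Hp Hw) as [l [A B]].
  unfold T0. rewrite (is_series_unique _ _ A), (is_series_unique _ _ B). split; assumption. }
assert (H1 : forall w, Cmod w < 1 -> Cps (dcoef (kk_coef p)) w (C_derive T0 w) /\ qdiff T0 w (C_derive T0 w)).
{ intros w Hw. replace w with (w - RtoC 0)%C at 1 by ring.
  apply pseries_qdiff with 1.
  - intros x Hx. replace (x - RtoC 0)%C with x in * by ring. now apply H0.
  - replace (w - RtoC 0)%C with w by ring. exact Hw. }
set (T1 := C_derive T0) in *.
assert (H2 : forall w, Cmod w < 1 -> Cps (dcoef (dcoef (kk_coef p))) w (C_derive T1 w) /\ qdiff T1 w (C_derive T1 w)).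
{ intros w Hw. replace w with (w - RtoC 0)%C at 1 by ring.
  apply pseries_qdiff with 1.
  - intros x Hx. replace (x - RtoC 0)%C with x in * by ring. now apply H1.
  - replace (w - RtoC 0)%C with w by ring. exact Hw. }
set (T2 := C_derive T1) in *.
assert (Hode : forall w, Cmod w < 1 -> ((RtoC 1 - w) * T2 w)%C = (RtoC p * T1 w)%C).
{ intros w Hw. destruct (H1 w Hw) as [A1 _]. destruct (H2 w Hw) as [A2 _].
  assert (A3 : Cser (fun n => w ^ n * (RtoC (INR n) * dcoef (kk_coef p) n))%C (w * T2 w)%C).
  { apply Cser_shift; [simpl; ring|].
    eapply Cser_ext; [|exact (Cser_scal w _ _ A2)]. intros n. cbv beta.
    unfold dcoef at 1. simpl Cpow. ring. }
  assert (A4 : Cser (fun n => w ^ n * dcoef (dcoef (kk_coef p)) n)%C (RtoC p * T1 w + w * T2 w)%C).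
  { eapply Cser_ext; [|exact (Cser_plus _ _ _ _ (Cser_scal (RtoC p) _ _ A1) A3)].
    intros n. cbv beta. unfold dcoef at 3. rewrite !dcoef_kk_coef, binom_coef_S.
    assert (Hn : INR (S n) <> 0) by (apply not_0_INR; lia).
    replace (RtoC (INR (S n)) * RtoC (binom_coef p n * (p + INR n) / INR (S n)))%C
      with (RtoC (binom_coef p n * (p + INR n))).
    - rewrite RtoC_mult, RtoC_plus. ring.
    - rewrite <- RtoC_mult. f_equal. field. exact Hn. }
  pose proof (Cser_unique _ _ _ A2 A4) as Eq.
  replace ((RtoC 1 - w) * T2 w)%C with (T2 w - w * T2 w)%C by ring. rewrite Eq at 1. ring. }
assert (Hray : forall w t, Cmod w < 1 -> 0 <= t <= 1 -> Cmod (RtoC t * w)%C < 1).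
{ intros w t Hw Ht. eapply Rle_lt_trans; [apply Cmod_ray; [apply Rle_refl|exact Ht]|exact Hw]. }
assert (HT1 : forall w, Cmod w < 1 -> T1 w = invpow p w).
{ intros w Hw.
  assert (Hz := cder_zero (fun t => T1 (RtoC t * w) * invpow (- p) (RtoC t * w))%C 0 1 ltac:(lra)).
  cbv beta in Hz. rewrite !Cmult_1_l, !Cmult_0_l in Hz.
  assert (HT10 : T1 (RtoC 0) = RtoC 1).
  { destruct (H1 (RtoC 0)) as [A _]; [rewrite Cmod_0; lra|].
    apply (Cser_unique _ _ _ A).
    apply (Cser_ext (fun n => match n with O => RtoC 1 | S _ => RtoC 0 end)).
    - intros [|n]; rewrite dcoef_kk_coef; simpl; ring.
    - apply Cser_single. }
  rewrite HT10, invpow_at_0 in Hz.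
  transitivity (T1 w * invpow (- p) w * invpow p w)%C.
  - rewrite <- Cmult_assoc, (Cmult_comm (invpow (- p) w)), invpow_opp. ring.
  - rewrite Hz; [ring|]. intros t Ht.
    assert (Hx := Hray w t Hw Ht). set (x := (RtoC t * w)%C) in *.
    eapply cder_eq.
    + apply cder_mult; [eapply (qdiff_Hder T1); [apply H2; exact Hx|apply cder_ray|reflexivity]|].
      apply cder_invpow; [apply cder_ray|now apply Re_lt_1].
    + cbv beta. fold x.
      replace (invpow (- p) x) with (invpow (- p + 1) x * (RtoC 1 - x))%C.
      * rewrite RtoC_opp.
        transitivity (w * invpow (- p + 1) x * ((RtoC 1 - x) * T2 x - RtoC p * T1 x))%C; [ring|].
        rewrite Hode by exact Hx. ring.
      * rewrite <- invpow_pred by now apply Re_lt_1. f_equal; ring. }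
assert (HT0 : T0 u = kk p u).
{ assert (Hz := cder_zero (fun t => T0 (RtoC t * u) - kk p (RtoC t * u))%C 0 1 ltac:(lra)).
  cbv beta in Hz. rewrite !Cmult_1_l, !Cmult_0_l, kk_0 in Hz.
  assert (HT00 : T0 (RtoC 0) = RtoC 0).
  { apply (Cser_unique _ _ _ (H0 (RtoC 0) ltac:(rewrite Cmod_0; lra))).
    apply (Cser_ext (fun n => match n with O => RtoC 0 | S _ => RtoC 0 end)); [|apply Cser_single].
  intros [|n]; simpl; ring. }
  rewrite HT00 in Hz.
  replace (T0 u) with (T0 u - kk p u + kk p u)%C by ring. rewrite Hz; [ring|].
  intros t Ht. assert (Hx := Hray u t Hu Ht).
  eapply cder_eq.
  - apply cder_minus; [eapply (qdiff_Hder T0); [apply H1; exact Hx|apply cder_ray|reflexivity]|].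
    apply cder_kk; [apply cder_ray|now apply Re_lt_1].
  - cbv beta. fold T1. rewrite HT1 by exact Hx. ring. }
rewrite <- HT0. now apply H0.
Qed.

(** * Analyticity and convexity of the extremal function *)

Lemma cder_shift (z v : C) (t : R) : cder (fun t => z + RtoC t * v)%C t v.
Proof.
eapply cder_eq; [apply cder_plus; [apply cder_const|apply cder_ray]|ring].
Qed.

(** As [1 - (z + (1-z) v) = (1-z) (1-v)], the expansion about [z] reduces to the one about 0. The
    factorisation of the powers is proved by differentiating a quotient along a ray, which avoids
    adding arguments of logarithms. *)
Lemma kk_translate (p : R) (z v : C) : Cmod z < 1 -> Cmod v < (1 - Cmod z) / 2 ->
  kk p (z + (RtoC 1 - z) * v)%C = (kk p z + invpow (p - 1) z * kk p v)%C.
Proof.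
intros Hz Hv. pose proof (Cmod_ge_0 z) as Hz0. pose proof (Cmod_ge_0 v) as Hv0.
set (d := ((RtoC 1 - z) * v)%C).
assert (Hd : Cmod d <= 2 * Cmod v).
{ unfold d. rewrite Cmod_mult. apply Rmult_le_compat_r; [lra|].
  eapply Rle_trans; [apply Cmod_minus_le|]. rewrite Cmod_1; lra. }
assert (Hx : forall t, 0 <= t <= 1 -> Re (z + RtoC t * d)%C < 1).
{ intros t Ht. apply Re_lt_1. eapply Rle_lt_trans; [apply Cmod_triangle|].
  pose proof (Cmod_ray d t _ Hd Ht). lra. }
assert (Hy : forall t, 0 <= t <= 1 -> Re (RtoC t * v)%C < 1).
{ intros t Ht. apply Re_lt_1. pose proof (Cmod_ray v t _ (Rle_refl _) Ht). lra. }
assert (Hz1 : Re z < 1) by now apply Re_lt_1.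
pose proof (Re_pos_neq0 _ (Re_1_minus _ Hz1)) as Hzn.
assert (HE : forall t, 0 <= t <= 1 -> invpow p (z + RtoC t * d)%C = (invpow p z * invpow p (RtoC t * v))%C).
{ intros t Ht.
  assert (H := cder_zero (fun t => invpow p (z + RtoC t * d) * invpow (- p) (RtoC t * v))%C 0 t ltac:(lra)).
  cbv beta in H. rewrite !Cmult_0_l, invpow_at_0, Cplus_0_r, Cmult_1_r in H.
  rewrite <- H.
  - rewrite <- Cmult_assoc, (Cmult_comm (invpow (- p) _)), invpow_opp. ring.
  - intros s Hs. eapply cder_eq.
    + apply cder_mult; apply cder_invpow; [apply cder_shift|apply Hx; lra|apply cder_ray|apply Hy; lra].
    + cbv beta.
      rewrite !invpow_plus, !invpow_1_inv by (try apply Hx; try apply Hy; lra).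
      pose proof (Re_pos_neq0 _ (Re_1_minus _ (Hy s ltac:(lra)))) as Hyn.
      replace (RtoC 1 - (z + RtoC s * d))%C with ((RtoC 1 - z) * (RtoC 1 - RtoC s * v))%C by (unfold d; ring).
      rewrite RtoC_opp. unfold d at 1. field. split; assumption. }
assert (H := cder_zero (fun t => kk p (z + RtoC t * d) - invpow (p - 1) z * kk p (RtoC t * v))%C 0 1 ltac:(lra)).
cbv beta in H. rewrite !Cmult_0_l, !Cmult_1_l, kk_0, Cplus_0_r, Cmult_0_r in H.
fold d. replace (kk p (z + d)%C) with ((kk p (z + d) - invpow (p - 1) z * kk p v) + invpow (p - 1) z * kk p v)%C by ring.
rewrite H; [ring|].
intros t Ht. eapply cder_eq.
- apply cder_minus; [apply cder_kk; [apply cder_shift|apply Hx; lra]|].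
  apply cder_scal, cder_kk; [apply cder_ray|apply Hy; lra].
- cbv beta. rewrite HE by exact Ht. rewrite invpow_pred by exact Hz1. unfold d. ring.
Qed.

Lemma k_analytic (alpha : R) : 0 <= alpha <= 1 -> analytic_on_disk (k_ alpha).
Proof.
intros Ha z Hz. unfold in_disk in Hz. set (p := 2 - 2 * alpha).
pose proof (Cmod_ge_0 z) as Hz0.
assert (Hz1 : Re z < 1) by now apply Re_lt_1.
pose proof (Re_pos_neq0 _ (Re_1_minus _ Hz1)) as Hzn.
assert (Hzm : 1 - Cmod z <= Cmod (RtoC 1 - z)%C).
{ eapply Rle_trans; [|apply Cmod_rev_triangle]. rewrite Cmod_1; lra. }
(* The expansion of [kk p] at 0 in [v = (w-z)/(1-z)], shifted by [kk p z]. Since [|1-z| >= 1 - |z|],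
   the radius ensures [|v| < (1-|z|)/2]. *)
exists (fun n => match n with O => kk p z | S _ => RtoC 0 end +
  invpow (p - 1) z * ((/ (RtoC 1 - z)) ^ n * kk_coef p n))%C, ((1 - Cmod z) * ((1 - Cmod z) / 2)).
split; [apply Rmult_lt_0_compat; lra|].
intros w Hw. apply Cps_is_pseries.
set (v := ((w - z) / (RtoC 1 - z))%C).
assert (Hv : Cmod v < (1 - Cmod z) / 2).
{ unfold v. rewrite Cmod_div by exact Hzn.
  apply Rmult_lt_reg_r with (Cmod (RtoC 1 - z)%C); [lra|].
  unfold Rdiv at 1. rewrite Rmult_assoc, Rinv_l, Rmult_1_r by lra.
  eapply Rlt_le_trans; [exact Hw|]. rewrite Rmult_comm. apply Rmult_le_compat_l; lra. }
assert (Hwv : w = (z + (RtoC 1 - z) * v)%C) by (unfold v; field; exact Hzn).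
assert (Hw1 : Re w < 1).
{ apply Re_lt_1. replace w with (z + (w - z))%C by ring.
  eapply Rle_lt_trans; [apply Cmod_triangle|].
  assert ((1 - Cmod z) * ((1 - Cmod z) / 2) <= 1 * ((1 - Cmod z) / 2)) by (apply Rmult_le_compat_r; lra). lra. }
rewrite k_kk by exact Hw1. fold p.
rewrite Hwv at 2. rewrite kk_translate by assumption.
unfold Cps.
apply (Cser_ext (fun n => match n with O => kk p z | S _ => RtoC 0 end +
  invpow (p - 1) z * (v ^ n * kk_coef p n))%C).
- intros n.
  assert (Hpow : (v ^ n)%C = (((w - z) ^ n) * (/ (RtoC 1 - z)) ^ n)%C).
  { unfold v, Cdiv. clear. induction n; simpl; [ring|rewrite IHn; ring]. }
  rewrite Hpow. destruct n; simpl; ring.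
- apply Cser_plus; [apply Cser_single|]. apply Cser_scal. apply kk_pseries; [unfold p; lra|lra].
Qed.

Lemma cder_unique (u : R -> C) (t : R) (a b : C) : cder u t a -> cder u t b -> a = b.
Proof.
intros [H1 H2] [H3 H4]. apply Ceq_ext.
- rewrite <- (is_derive_unique _ _ _ H1). now apply is_derive_unique.
- rewrite <- (is_derive_unique _ _ _ H2). now apply is_derive_unique.
Qed.

Lemma locally_disk (z : C) : Cmod z < 1 -> locally 0 (fun s : R => Cmod (z + RtoC s * RtoC 1)%C < 1).
Proof.
intros Hz. assert (P : 0 < 1 - Cmod z) by lra.
exists (mkposreal _ P). intros s Hs.
assert (Hs' : Rabs (s - 0) < 1 - Cmod z) by exact Hs. rewrite Rminus_0_r in Hs'.
eapply Rle_lt_trans; [apply Cmod_triangle|]. rewrite Cmult_1_r, Cmod_R. lra.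
Qed.

Lemma C_derive_k (alpha : R) (z : C) : 0 <= alpha <= 1 -> Cmod z < 1 ->
  C_derive (k_ alpha) z = invpow (2 - 2 * alpha) z.
Proof.
intros Ha Hz. pose proof (analytic_qdiff _ z (k_analytic alpha Ha) Hz) as Hq.
pose proof (qdiff_Hder _ _ _ Hq _ _ _ (cder_shift z (RtoC 1) 0) ltac:(cbv beta; ring)) as H1.
assert (H2 : cder (fun s => k_ alpha (z + RtoC s * RtoC 1)%C) 0 (RtoC 1 * invpow (2 - 2 * alpha) (z + RtoC 0 * RtoC 1))%C).
{ apply (cder_ext_loc (fun s => kk (2 - 2 * alpha) (z + RtoC s * RtoC 1)%C)).
  - eapply filter_imp; [|apply (locally_disk z Hz)]. intros s Hs. symmetry. apply k_kk. now apply Re_lt_1.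
  - apply cder_kk; [apply cder_shift|]. replace (z + RtoC 0 * RtoC 1)%C with z by ring. now apply Re_lt_1. }
pose proof (cder_unique _ _ _ _ H1 H2) as Eq.
replace (z + RtoC 0 * RtoC 1)%C with z in Eq by ring.
rewrite Cmult_1_r, Cmult_1_l in Eq. exact Eq.
Qed.

Lemma C_derive2_k (alpha : R) (z : C) : 0 <= alpha <= 1 -> Cmod z < 1 ->
  C_derive (C_derive (k_ alpha)) z = (RtoC (2 - 2 * alpha) * invpow (2 - 2 * alpha + 1) z)%C.
Proof.
intros Ha Hz. pose proof (analytic_qdiff _ z (analytic_derive _ (k_analytic alpha Ha)) Hz) as Hq.
pose proof (qdiff_Hder _ _ _ Hq _ _ _ (cder_shift z (RtoC 1) 0) ltac:(cbv beta; ring)) as H1.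
assert (H2 : cder (fun s => C_derive (k_ alpha) (z + RtoC s * RtoC 1)%C) 0
  (RtoC (2 - 2 * alpha) * RtoC 1 * invpow (2 - 2 * alpha + 1) (z + RtoC 0 * RtoC 1))%C).
{ apply (cder_ext_loc (fun s => invpow (2 - 2 * alpha) (z + RtoC s * RtoC 1)%C)).
  - eapply filter_imp; [|apply (locally_disk z Hz)]. intros s Hs. symmetry. now apply C_derive_k.
  - apply cder_invpow; [apply cder_shift|]. replace (z + RtoC 0 * RtoC 1)%C with z by ring. now apply Re_lt_1. }
pose proof (cder_unique _ _ _ _ H1 H2) as Eq.
replace (z + RtoC 0 * RtoC 1)%C with z in Eq by ring.
rewrite !Cmult_1_r in Eq. exact Eq.
Qed.

Lemma Re_inv (z : C) : z <> RtoC 0 -> Re (/ z)%C = Re z / (Re z * Re z + Im z * Im z).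
Proof. intros H. pose proof (sqnorm_pos z H). unfold Re, Im in *; simpl. rewrite !Rmult_1_r. reflexivity. Qed.

Lemma Im_inv (z : C) : z <> RtoC 0 -> Im (/ z)%C = - Im z / (Re z * Re z + Im z * Im z).
Proof. intros H. pose proof (sqnorm_pos z H). unfold Re, Im in *; simpl. rewrite !Rmult_1_r. reflexivity. Qed.

Lemma Cmod_sqr (z : C) : Cmod z * Cmod z = Re z * Re z + Im z * Im z.
Proof. pose proof (Cmod2_alt z) as H. simpl in H. rewrite !Rmult_1_r in H. exact H. Qed.

(** The map [1/(1-w)] sends the disk [|w| <= r] onto the disk with diameter from [1/(1+r)] to
    [1/(1-r)]; its leftmost point gives the bound. *)
Lemma Re_inv_1_minus (w : C) (r : R) : r < 1 -> Cmod w <= r -> / (1 + r) <= Re (/ (RtoC 1 - w))%C.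
Proof.
intros Hr Hw. pose proof (Cmod_ge_0 w) as H0.
assert (Hw1 : Re w < 1) by (apply Re_lt_1; lra).
pose proof (Re_1_minus _ Hw1) as H1. rewrite Re_inv by now apply Re_pos_neq0.
pose proof (Cmod_sqr w) as H2.
assert (H3 : Cmod w * Cmod w <= r * r) by (apply Rmult_le_compat; lra).
assert (H4 : - r <= Re w).
{ pose proof (re_le_Cmod w) as T. apply Rabs_le_between in T. lra. }
replace (Re (RtoC 1 - w)%C) with (1 - Re w) in * by (unfold Re; simpl; ring).
replace (Im (RtoC 1 - w)%C) with (- Im w) by (unfold Im; simpl; ring).
set (x := Re w) in *. set (y := Im w) in *.
assert (HD : 0 < (1 - x) * (1 - x) + - y * - y) by nra.
apply Rmult_le_reg_r with (1 + r); [lra|]. rewrite Rinv_l by lra.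
apply Rmult_le_reg_r with ((1 - x) * (1 - x) + - y * - y); [exact HD|].
replace ((1 - x) / ((1 - x) * (1 - x) + - y * - y) * (1 + r) * ((1 - x) * (1 - x) + - y * - y))
  with ((1 - x) * (1 + r)) by (field; lra).
nra.
Qed.

(** Here [1 + z k''/k' = 1 + p (1/(1-z) - 1)], and [Re (1/(1-z)) > 1/2] gives the lower bound
    [1 - p/2 = alpha]. The smaller order [beta] allows [M_ alpha] to be compared with [M_ (1/2)]. *)
Lemma k_convex (alpha beta : R) : 0 <= alpha < 1 -> beta <= alpha -> convex_of_order beta (k_ alpha).
Proof.
intros Ha Hb. split; [apply k_analytic; lra|]. split; [|split].
- rewrite k_kk by (simpl; lra). apply kk_0.
- rewrite C_derive_k by (try rewrite Cmod_0; lra). apply invpow_at_0.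
- intros z Hz. unfold in_disk in Hz. rewrite C_derive2_k, C_derive_k by lra.
  split; [apply invpow_neq0|].
  set (p := 2 - 2 * alpha).
  assert (Hz1 : Re z < 1) by now apply Re_lt_1.
  pose proof (Re_pos_neq0 _ (Re_1_minus _ Hz1)) as Hzn.
  assert (Eq : (RtoC 1 + z * (RtoC p * invpow (p + 1) z) / invpow p z)%C = (RtoC 1 + RtoC p * (/ (RtoC 1 - z) - RtoC 1))%C).
  { rewrite invpow_plus, invpow_1_inv by exact Hz1. field. split; [exact Hzn|apply invpow_neq0]. }
  rewrite Eq.
  replace (Re (RtoC 1 + RtoC p * (/ (RtoC 1 - z) - RtoC 1))%C) with (1 + p * (Re (/ (RtoC 1 - z))%C - 1))
    by (unfold Re; simpl; ring).
  pose proof (Re_inv_1_minus z (Cmod z) Hz (Rle_refl _)) as HR.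
  assert (1 / 2 < / (1 + Cmod z)).
  { pose proof (Cmod_ge_0 z). apply Rmult_lt_reg_r with (1 + Cmod z); [lra|]. rewrite Rinv_l; lra. }
  unfold p. nra.
Qed.

(** * Half-plane and sector estimates *)


Definition Pw (a : R) (z : C) : C := Cexp (RtoC a * Log z)%C.

Lemma Re_Pw (a : R) (z : C) : 0 < Re z -> Re (Pw a z) = exp (a * ln (Cmod z)) * cos (a * Im (Log z)).
Proof. intros H. unfold Pw. unfold Cexp. rewrite Re_scal, Im_scal, Re_Log by exact H. reflexivity. Qed.

Lemma Im_Pw (a : R) (z : C) : 0 < Re z -> Im (Pw a z) = exp (a * ln (Cmod z)) * sin (a * Im (Log z)).
Proof. intros H. unfold Pw. unfold Cexp. rewrite Re_scal, Im_scal, Re_Log by exact H. reflexivity. Qed.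

Lemma Re_polar (z : C) : 0 < Re z -> Re z = Cmod z * cos (Im (Log z)).
Proof.
intros H. rewrite <- (Cexp_Log z H) at 1. unfold Cexp.
rewrite Re_Log by exact H. rewrite exp_ln by (apply Cmod_gt_0, Re_pos_neq0, H). reflexivity.
Qed.

Lemma Im_polar (z : C) : 0 < Re z -> Im z = Cmod z * sin (Im (Log z)).
Proof.
intros H. rewrite <- (Cexp_Log z H) at 1. unfold Cexp.
rewrite Re_Log by exact H. rewrite exp_ln by (apply Cmod_gt_0, Re_pos_neq0, H). reflexivity.
Qed.

Lemma Im_Log_bound (z : C) : - PI / 2 < Im (Log z) < PI / 2.
Proof. unfold Log; simpl. apply atan_bound. Qed.

Lemma Log_inv (z : C) : 0 < Re z -> Log (/ z)%C = (- Log z)%C.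
Proof.
intros H. pose proof (Re_pos_neq0 z H) as H0.
assert (HD : 0 < Re z * Re z + Im z * Im z) by nra.
unfold Log. rewrite Re_inv, Im_inv by exact H0.
set (x := Re z) in *. set (y := Im z) in *. set (D := x * x + y * y) in *.
apply Ceq_ext; simpl.
- replace (x / D * (x / D) + - y / D * (- y / D)) with (/ D).
  + rewrite ln_Rinv by exact HD. field.
  + assert (E : / D = D / D / D) by (field; lra). rewrite E. unfold D at 1. field. lra.
- replace (- y / D / (x / D)) with (- (y / x)) by (field; lra). apply atan_opp.
Qed.

Lemma Pw_inv (a : R) (z : C) : 0 < Re z -> Pw a (/ z)%C = Pw (- a) z.
Proof. intros H. unfold Pw. rewrite Log_inv, RtoC_opp by exact H. f_equal. ring. Qed.

Lemma invpow_Pw_inv (a : R) (w : C) : Re w < 1 -> invpow a w = Pw a (/ (RtoC 1 - w))%C.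
Proof. intros H. rewrite Pw_inv by now apply Re_1_minus. reflexivity. Qed.

Lemma Pw_plus (a b : R) (z : C) : Pw (a + b) z = (Pw a z * Pw b z)%C.
Proof. unfold Pw. rewrite <- Cexp_plus. f_equal. rewrite RtoC_plus. ring. Qed.

Lemma Pw_1 (z : C) : 0 < Re z -> Pw 1 z = z.
Proof. intros H. unfold Pw. rewrite Cmult_1_l. now apply Cexp_Log. Qed.

Lemma cder_Pw (a : R) (u : R -> C) (t : R) (v : C) : cder u t v -> 0 < Re (u t) ->
  cder (fun s => Pw (a + 1) (u s)) t (RtoC (a + 1) * v * Pw a (u t))%C.
Proof.
intros Hu H. unfold Pw. eapply cder_eq.
- apply cder_Cexp, cder_scal, cder_Log; [exact Hu|exact H].
- cbv beta. fold (Pw (a + 1) (u t)). fold (Pw a (u t)).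
  rewrite Pw_plus, Pw_1 by exact H. field. now apply Re_pos_neq0.
Qed.

Lemma Log_RtoC (x : R) : 0 < x -> Log (RtoC x) = RtoC (ln x).
Proof.
intros H. apply Ceq_ext.
- rewrite Re_Log by exact H. rewrite Cmod_RtoC_pos by lra. reflexivity.
- unfold Log; simpl. unfold Rdiv. rewrite Rmult_0_l. apply atan_0.
Qed.

Lemma Cexp_RtoC (x : R) : Cexp (RtoC x) = RtoC (exp x).
Proof. unfold Cexp; simpl. rewrite cos_0, sin_0. apply Ceq_ext; simpl; ring. Qed.

Lemma Pw_RtoC (a x : R) : 0 < x -> Pw a (RtoC x) = RtoC (Rpower x a).
Proof. intros H. unfold Pw. rewrite Log_RtoC, <- RtoC_mult, Cexp_RtoC by exact H. reflexivity. Qed.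

Lemma Rpower_le_mono (x y a : R) : 0 <= a -> 0 < x <= y -> Rpower x a <= Rpower y a.
Proof.
intros Ha Hx. unfold Rpower.
assert (H : a * ln x <= a * ln y) by (apply Rmult_le_compat_l; [exact Ha|apply ln_le; lra]).
destruct H as [H|H]; [left; now apply exp_increasing|right; now rewrite H].
Qed.

(** For positive angles, [ln (cos (a t)) - a ln (cos t)] vanishes at 0 and has derivative
    [a (tan t - tan (a t)) >= 0]. In polar form this is [(Re z)^a <= Re (z^a)]. *)
Lemma cos_scaled_ge (a x : R) : 0 <= a <= 1 -> - PI / 2 < x < PI / 2 -> Rpower (cos x) a <= cos (a * x).
Proof.
intros Ha.
assert (Hpos : forall x, 0 <= x < PI / 2 -> Rpower (cos x) a <= cos (a * x)).
{ clear x. intros x Hx.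
  assert (Hax : forall t, 0 <= t <= x -> 0 <= a * t <= t) by (intros; nra).
  assert (Hc : forall t, 0 <= t <= x -> 0 < cos t) by (intros; apply cos_gt_0; lra).
  assert (Hca : forall t, 0 <= t <= x -> 0 < cos (a * t)).
  { intros t Ht. specialize (Hax t Ht). apply cos_gt_0; lra. }
  assert (H : ln (cos (a * 0)) - a * ln (cos 0) <= ln (cos (a * x)) - a * ln (cos x)).
  { apply (derive_le (fun t => ln (cos (a * t)) - a * ln (cos t))
      (fun t => a * (tan t - tan (a * t)))); [lra| |]; intros t Ht.
    - specialize (Hc t Ht). specialize (Hca t Ht). unfold tan. auto_derive; [split; [exact Hca|split; [exact Hc|exact I]]|].
      field. split; lra.
    - specialize (Hax t Ht). apply Rmult_le_pos; [lra|].
      destruct (Req_dec (a * t) t) as [->|Hne]; [lra|].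
      assert (tan (a * t) < tan t) by (apply tan_increasing; lra). lra. }
  rewrite Rmult_0_r, cos_0, ln_1 in H.
  rewrite <- (exp_ln (cos (a * x))) by (apply Hca; lra). unfold Rpower.
  assert (H' : a * ln (cos x) <= ln (cos (a * x))) by lra.
  destruct H' as [H'|H']; [left; now apply exp_increasing|right; now rewrite H']. }
intros Hx. destruct (Rle_lt_dec 0 x).
- apply Hpos; lra.
- rewrite <- (cos_neg x), <- (cos_neg (a * x)).
  replace (- (a * x)) with (a * - x) by ring. apply Hpos; lra.
Qed.

Lemma Re_Pw_ge (a : R) (z : C) : 0 <= a <= 1 -> 0 < Re z -> Rpower (Re z) a <= Re (Pw a z).
Proof.
intros Ha H. rewrite Re_Pw by exact H. rewrite (Re_polar z) at 1 by exact H.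
assert (Hm : 0 < Cmod z) by (apply Cmod_gt_0, Re_pos_neq0, H).
pose proof (Im_Log_bound z) as Hb.

assert (Hc : 0 < cos (Im (Log z))) by (apply cos_gt_0; lra).
unfold Rpower at 1. rewrite ln_mult by assumption.
rewrite Rmult_plus_distr_l, exp_plus. apply Rmult_le_compat_l; [left; apply exp_pos|].
now apply cos_scaled_ge.
Qed.

(** A comparison of the means of [d1] and [d2] over [[0,1]], stated through primitives so that no
    integral has to be formed. *)
Lemma Re_derive_le (u1 d1 u2 d2 : R -> C) (c1 c2 : C) :
  (forall t, 0 <= t <= 1 -> cder u1 t (d1 t)) -> (forall t, 0 <= t <= 1 -> cder u2 t (d2 t)) ->
  (forall t, 0 <= t <= 1 -> Re (c1 * d1 t)%C <= Re (c2 * d2 t)%C) ->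
  Re (c1 * (u1 1 - u1 0))%C <= Re (c2 * (u2 1 - u2 0))%C.
Proof.
intros H1 H2 H.
assert (HH := derive_le (fun t => Re (c2 * u2 t)%C - Re (c1 * u1 t)%C)
  (fun t => Re (c2 * d2 t)%C - Re (c1 * d1 t)%C) 0 1 ltac:(lra)).
cbv beta in HH.
assert (X1 : Re (c1 * (u1 1 - u1 0))%C = Re (c1 * u1 1)%C - Re (c1 * u1 0)%C) by (unfold Re; simpl; ring).
assert (X2 : Re (c2 * (u2 1 - u2 0))%C = Re (c2 * u2 1)%C - Re (c2 * u2 0)%C) by (unfold Re; simpl; ring).
rewrite X1, X2.
enough (Re (c2 * u2 0)%C - Re (c1 * u1 0)%C <= Re (c2 * u2 1)%C - Re (c1 * u1 1)%C) by lra.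
apply HH; intros t Ht.
- apply is_derive_Rplus; [|apply is_derive_Ropp]; apply cder_scal_Re; auto.
- specialize (H t Ht). lra.
Qed.

Definition hk (p : R) (w : C) : C := over_z (kk p) w.

Lemma Re_ray_lt_1 (w : C) (t : R) : Re w < 1 -> 0 <= t <= 1 -> Re (RtoC t * w)%C < 1.
Proof. intros Hw Ht. rewrite Re_scal. destruct (Rle_lt_dec (Re w) 0); nra. Qed.

(* [h(w)] is the mean of [(1-tw)^(-p)] over [0 <= t <= 1]. *)
Lemma hk_primitive (p : R) (w : C) : Re w < 1 -> exists u : R -> C,
  (forall t, 0 <= t <= 1 -> cder u t (invpow p (RtoC t * w)%C)) /\ (u 1 - u 0)%C = hk p w.
Proof.
intros Hw. unfold hk. destruct (Ceq_dec w (RtoC 0)) as [->|H0].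
- exists RtoC. split.
  + intros t Ht. rewrite Cmult_0_r, invpow_at_0. apply cder_id.
  + rewrite over_z_0. ring.
- exists (fun t => / w * kk p (RtoC t * w))%C. split.
  + intros t Ht. eapply cder_eq; [apply cder_scal, cder_kk; [apply cder_ray|now apply Re_ray_lt_1]|].
    cbv beta. field. exact H0.
  + rewrite over_z_neq0, Cmult_0_l, Cmult_1_l, kk_0 by exact H0. field. exact H0.
Qed.

Lemma hk_le (p : R) (w1 w2 c1 c2 : C) : Re w1 < 1 -> Re w2 < 1 ->
  (forall t, 0 <= t <= 1 -> Re (c1 * invpow p (RtoC t * w1))%C <= Re (c2 * invpow p (RtoC t * w2))%C) ->
  Re (c1 * hk p w1)%C <= Re (c2 * hk p w2)%C.
Proof.
intros H1 H2 Hle.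
destruct (hk_primitive p w1 H1) as [u1 [D1 <-]]. destruct (hk_primitive p w2 H2) as [u2 [D2 <-]].
now apply (Re_derive_le u1 _ u2 _ c1 c2 D1 D2).
Qed.

(** The quotient [(1-tw)/(1-w)], written as a convex combination of 1 and [1/(1-w)]: its real part
    and argument are then controlled by those of [1/(1-w)]. *)
Definition Q (w : C) (t : R) : C := (RtoC t + RtoC (1 - t) * / (RtoC 1 - w))%C.

Lemma Re_Q (w : C) (t : R) : Re (Q w t) = t + (1 - t) * Re (/ (RtoC 1 - w))%C.
Proof. unfold Q, Re; simpl; ring. Qed.

Lemma Im_Q (w : C) (t : R) : Im (Q w t) = (1 - t) * Im (/ (RtoC 1 - w))%C.
Proof. unfold Q, Im; simpl; ring. Qed.

Lemma Re_inv_pos (w : C) : Re w < 1 -> 0 < Re (/ (RtoC 1 - w))%C.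
Proof.
intros Hw. pose proof (Re_1_minus w Hw) as H1. rewrite Re_inv by now apply Re_pos_neq0.
apply Rdiv_lt_0_compat; [exact H1|]. nra.
Qed.

Lemma Re_Q_pos (w : C) (t : R) : Re w < 1 -> 0 <= t <= 1 -> 0 < Re (Q w t).
Proof.
intros Hw Ht. rewrite Re_Q. pose proof (Re_inv_pos w Hw).
destruct (Rle_lt_dec t (1 / 2)); nra.
Qed.

(* [q h(w) + 1 = (1+q) * mean of ((1-tw)/(1-w))^q], where [q = p - 1]. *)
Lemma hk_primitive_Q (q : R) (w : C) : 0 < q -> Re w < 1 -> exists u : R -> C,
  (forall t, 0 <= t <= 1 -> cder u t (Pw q (Q w t))) /\
  (RtoC q * hk (q + 1) w + RtoC 1)%C = (RtoC (q + 1) * (u 1 - u 0))%C.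
Proof.
intros Hq Hw. pose proof (Re_pos_neq0 _ (Re_1_minus w Hw)) as Hn.
assert (Hq1 : RtoC (q + 1) <> RtoC 0) by (intros E; apply RtoC_inj in E; lra).
assert (Hq0 : RtoC q <> RtoC 0) by (intros E; apply RtoC_inj in E; lra).
unfold hk. destruct (Ceq_dec w (RtoC 0)) as [->|H0].
- exists RtoC. split.
  + intros t Ht. replace (Q (RtoC 0) t) with (RtoC 1).
    * rewrite Pw_RtoC by lra. unfold Rpower. rewrite ln_1, Rmult_0_r, exp_0. apply cder_id.
    * unfold Q. replace (RtoC 1 - RtoC 0)%C with (RtoC 1) by ring. rewrite RtoC_minus. field.
  + rewrite over_z_0, RtoC_plus. ring.
- exists (fun t => - (RtoC 1 - w) / (RtoC (q + 1) * w) * Pw (q + 1) (Q w t))%C. split.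
  + intros t Ht. eapply cder_eq.
    * apply cder_scal, (cder_Pw q (Q w)).
      -- unfold Q. apply cder_plus; [apply cder_id|].
         apply cder_mult; [|apply cder_const].
         apply cder_RtoC. apply is_derive_Rplus; [apply (is_derive_const (V := R_NormedModule))|].
         apply is_derive_Ropp, (is_derive_id (K := R_AbsRing)).
      -- now apply Re_Q_pos.
    * cbv beta. change (@zero R_NormedModule) with 0. change (@one R_AbsRing) with 1.
      replace (RtoC (0 + - (1))) with (- RtoC 1)%C by (rewrite <- RtoC_opp; f_equal; ring).
      field. repeat split; assumption.
  + replace (Q w 1) with (RtoC 1) by (unfold Q; replace (1 - 1) with 0 by ring; ring).
    replace (Q w 0) with (/ (RtoC 1 - w))%C by (unfold Q; replace (1 - 0) with 1 by ring; ring).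
    rewrite <- invpow_Pw_inv, Pw_RtoC by (try exact Hw; lra).
    unfold Rpower. rewrite ln_1, Rmult_0_r, exp_0.
    rewrite over_z_neq0 by exact H0. unfold kk. destruct (Req_dec_T (q + 1) 1) as [|_]; [lra|].
    replace (q + 1 - 1) with q by ring.
    replace (invpow q w) with (invpow (q + 1) w * (RtoC 1 - w))%C.
    * field. repeat split; assumption.
    * rewrite <- invpow_pred by exact Hw. f_equal; ring.
Qed.

Lemma invpow_RtoC (p x : R) : x < 1 -> invpow p (RtoC x) = RtoC (Rpower (1 - x) (- p)).
Proof.
intros Hx. unfold invpow. rewrite <- RtoC_minus. fold (Pw (- p) (RtoC (1 - x))).
apply Pw_RtoC. lra.
Qed.

Lemma hk_upper (p r : R) (w : C) : 0 <= p -> r < 1 -> Cmod w <= r -> Re (hk p w) <= Re (hk p (RtoC r)).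
Proof.
intros Hp Hr Hw. pose proof (Cmod_ge_0 w) as H0.
rewrite <- (Cmult_1_l (hk p w)), <- (Cmult_1_l (hk p (RtoC r))).
apply hk_le; [apply Re_lt_1; lra|exact Hr|].
intros t Ht. rewrite !Cmult_1_l, <- RtoC_mult.
pose proof (Cmod_ray w t r Hw Ht) as Htw.
assert (Htr : t * r <= r) by nra.
eapply Rle_trans; [apply Re_le_Cmod|].
rewrite Cmod_invpow by (apply Re_lt_1; lra). rewrite invpow_RtoC by lra.
change (exp (- p * ln (Cmod (RtoC 1 - RtoC t * w)%C)) <= exp (- p * ln (1 - t * r))).
assert (Hm : 1 - t * r <= Cmod (RtoC 1 - RtoC t * w)%C).
{ eapply Rle_trans; [|apply Cmod_rev_triangle]. rewrite Cmod_1, Cmod_mult, Cmod_RtoC_pos by lra.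
  assert (t * Cmod w <= t * r) by (apply Rmult_le_compat_l; lra). lra. }
assert (Hl : - p * ln (Cmod (RtoC 1 - RtoC t * w)%C) <= - p * ln (1 - t * r)).
{ assert (ln (1 - t * r) <= ln (Cmod (RtoC 1 - RtoC t * w)%C)) by (apply ln_le; lra). nra. }
destruct Hl as [Hl|Hl]; [left; now apply exp_increasing|right; now rewrite Hl].
Qed.

(** For [p <= 1], [Re_Pw_ge] bounds the mean of [(1-tw)^(-p)] pointwise by that of [(1+tr)^(-p)].
    For [p > 1] this exponent is too large, and the second mean value formula, with exponent
    [q = p - 1 <= 1], takes over. *)
Lemma hk_lower (p r : R) (w : C) : 0 <= p <= 2 -> r < 1 -> Cmod w <= r ->
  Re (hk p (RtoC (- r))) <= Re (hk p w).
Proof.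
intros Hp Hr Hw. pose proof (Cmod_ge_0 w) as H0.
assert (Hw1 : Re w < 1) by (apply Re_lt_1; lra).
assert (Hr1 : Re (RtoC (- r)) < 1) by (simpl; lra).
destruct (Rle_lt_dec p 1) as [Hp1|Hp1].
- rewrite <- (Cmult_1_l (hk p w)), <- (Cmult_1_l (hk p (RtoC (- r)))).
  apply hk_le; [exact Hr1|exact Hw1|].
  intros t Ht. rewrite !Cmult_1_l, <- RtoC_mult.
  pose proof (Cmod_ray w t r Hw Ht) as Htw.
  assert (Htr : 0 <= t * r <= r) by nra.
  assert (Htw' : Cmod (RtoC t * w)%C <= t * r).
  { rewrite Cmod_mult, Cmod_RtoC_pos by lra. apply Rmult_le_compat_l; lra. }
  rewrite invpow_RtoC by nra. rewrite invpow_Pw_inv by (apply Re_lt_1; lra).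
  pose proof (Re_inv_1_minus (RtoC t * w)%C (t * r) ltac:(lra) Htw') as HI.
  assert (HP : 0 < / (1 + t * r)) by (apply Rinv_0_lt_compat; lra).
  eapply Rle_trans; [|apply Re_Pw_ge; lra].
  eapply Rle_trans; [|apply Rpower_le_mono; [lra|split; [exact HP|exact HI]]].
  change (Re (RtoC (Rpower (1 - t * - r) (- p)))) with (Rpower (1 - t * - r) (- p)).
  right. unfold Rpower. f_equal. replace (1 - t * - r) with (1 + t * r) by ring.
  rewrite ln_Rinv by lra. ring.
- set (q := p - 1).
  destruct (hk_primitive_Q q w) as [u1 [D1 E1]]; [unfold q; lra|exact Hw1|].
  destruct (hk_primitive_Q q (RtoC (- r))) as [u2 [D2 E2]]; [unfold q; lra|exact Hr1|].
  replace (q + 1) with p in * by (unfold q; ring).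
  assert (HR := Re_derive_le u2 _ u1 _ (RtoC p) (RtoC p) D2 D1).
  rewrite <- E1, <- E2 in HR.
  assert (X : forall z : C, Re (RtoC q * z + RtoC 1)%C = q * Re z + 1) by (intros; unfold Re; simpl; ring).
  rewrite !X in HR.
  enough (q * Re (hk p (RtoC (- r))) + 1 <= q * Re (hk p w) + 1).
  { apply Rmult_le_reg_l with q; [unfold q; lra|lra]. }
  apply HR. intros t Ht. rewrite !Re_scal. apply Rmult_le_compat_l; [lra|].
  assert (EQ : Q (RtoC (- r)) t = RtoC (t + (1 - t) * / (1 + r))).
  { unfold Q. rewrite <- RtoC_minus. replace (1 - - r) with (1 + r) by ring.
    rewrite <- RtoC_inv by lra. rewrite <- RtoC_mult, <- RtoC_plus. reflexivity. }
  assert (HP : 0 < / (1 + r)) by (apply Rinv_0_lt_compat; lra).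
  assert (HP2 : 0 < t + (1 - t) * / (1 + r)) by (destruct (Rle_lt_dec t (1 / 2)); nra).
  rewrite EQ, Pw_RtoC by exact HP2.
  change (Rpower (t + (1 - t) * / (1 + r)) q <= Re (Pw q (Q w t))).
  eapply Rle_trans; [|apply Re_Pw_ge; [unfold q; lra|now apply Re_Q_pos]].
  apply Rpower_le_mono; [unfold q; lra|]. split; [exact HP2|].
  rewrite Re_Q. pose proof (Re_inv_1_minus w r Hr Hw). nra.
Qed.

Lemma hk_real_pos (p x : R) : x < 1 -> 0 < Re (hk p (RtoC x)).
Proof.
intros Hx. destruct (hk_primitive p (RtoC x) Hx) as [u [D <-]].
assert (HH := derive_lt (fun t => Re (u t)) (fun t => Re (invpow p (RtoC t * RtoC x)%C)) 0 1 ltac:(lra)).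
cbv beta in HH. replace (Re (u 1 - u 0)%C) with (Re (u 1) - Re (u 0)) by (unfold Re; simpl; ring).
enough (Re (u 0) < Re (u 1)) by lra.
apply HH; intros t Ht; [apply D, Ht|].
rewrite <- RtoC_mult, invpow_RtoC by (destruct (Rle_lt_dec x 0); nra).
apply exp_pos.
Qed.

(** On the disk of radius [s], [Re Q >= 1/(1+s)] and [|Im Q| <= 1/(1-s)], so the argument of [Q] is
    at most the arctangent in [b]. Thus [Q^q], and with it the mean, lies in a closed sector of
    half-angle [b], still smaller than [q * PI / 2]. *)
Lemma hk_sector (q s : R) (w : C) : 0 < q < 1 -> 0 <= s < 1 -> Cmod w <= s ->
  let b := q * atan ((1 + s) / (1 - s)) in
  0 <= sin b * (Re (hk (q + 1) w) + / q) + cos b * Im (hk (q + 1) w) /\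
  0 <= sin b * (Re (hk (q + 1) w) + / q) - cos b * Im (hk (q + 1) w).
Proof.
intros Hq Hs Hw b. set (psi := atan ((1 + s) / (1 - s))) in *.
assert (Hw1 : Re w < 1) by (apply Re_lt_1; lra).
assert (Hpsi : 0 <= psi < PI / 2).
{ split; [|apply atan_bound]. rewrite <- atan_0. unfold psi.
  left. apply atan_increasing. apply Rdiv_lt_0_compat; lra. }
destruct (hk_primitive_Q q w) as [u [D E1]]; [lra|exact Hw1|].
(* Up to the factor [(q+1)/q], [h + 1/q] is the mean of [Q^q]; a half plane bounded by a line
   through 0 passes from the values to the mean. *)
assert (Hc : forall c : C, (forall t, 0 <= t <= 1 -> 0 <= Re (c * Pw q (Q w t))%C) ->
   0 <= Re (c * (hk (q + 1) w + RtoC (/ q)))%C).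
{ intros c Hc.
  assert (HR := Re_derive_le (fun _ => RtoC 0) (fun _ => RtoC 0) u _ (RtoC 0) c (fun t _ => cder_const _ t) D).
  cbv beta in HR. rewrite !Cmult_0_l in HR.
  assert (H1 : 0 <= Re (c * (u 1 - u 0))%C) by (apply HR; intros; now apply Hc).
  replace (c * (hk (q + 1) w + RtoC (/ q)))%C with (RtoC ((q + 1) / q) * (c * (u 1 - u 0)))%C.
  - rewrite Re_scal. apply Rmult_le_pos; [|exact H1]. apply Rle_mult_inv_pos; lra.
  - replace (RtoC ((q + 1) / q) * (c * (u 1 - u 0)))%C with (c * (RtoC (/ q) * (RtoC (q + 1) * (u 1 - u 0))))%C.
    + rewrite <- E1. rewrite RtoC_inv by lra. field. intros X. apply RtoC_inj in X. lra.
    + unfold Rdiv. rewrite RtoC_mult. ring. }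
assert (Hang : forall t, 0 <= t <= 1 -> Rabs (Im (Log (Q w t))) <= psi).
{ intros t Ht. pose proof (Re_Q_pos w t Hw1 Ht) as HQ.
  assert (A1 : / (1 + s) <= Re (Q w t)).
  { rewrite Re_Q. pose proof (Re_inv_1_minus w s ltac:(lra) Hw).
    assert (/ (1 + s) <= 1) by (rewrite <- Rinv_1; apply Rinv_le_contravar; lra). nra. }
  assert (A2 : Rabs (Im (Q w t)) <= / (1 - s)).
  { rewrite Im_Q, Rabs_mult, (Rabs_pos_eq (1 - t)) by lra.
    assert (A3 : Rabs (Im (/ (RtoC 1 - w))%C) <= / (1 - s)).
    { eapply Rle_trans; [apply Im_le_Cmod|]. rewrite Cmod_inv by now apply Re_pos_neq0, Re_1_minus.
      apply Rinv_le_contravar; [lra|].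
      eapply Rle_trans; [|apply Cmod_rev_triangle]. rewrite Cmod_1; lra. }
    pose proof (Rabs_pos (Im (/ (RtoC 1 - w))%C)). nra. }
  assert (A4 : Rabs (Im (Q w t) / Re (Q w t)) <= (1 + s) / (1 - s)).
  { unfold Rdiv. rewrite Rabs_mult, (Rabs_pos_eq (/ Re (Q w t))) by (left; now apply Rinv_0_lt_compat).
    rewrite (Rmult_comm (1 + s)). apply Rmult_le_compat; [apply Rabs_pos|left; now apply Rinv_0_lt_compat|exact A2|].
    rewrite <- (Rinv_inv (1 + s)). apply Rinv_le_contravar; [apply Rinv_0_lt_compat; lra|exact A1]. }
  assert (At : forall x y, x <= y -> atan x <= atan y).
  { intros x y [Hxy| ->]; [left; now apply atan_increasing|apply Rle_refl]. }
  change (Rabs (atan (Im (Q w t) / Re (Q w t))) <= psi). unfold psi. apply Rabs_le_between in A4. apply Rabs_le. rewrite <- atan_opp.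
  split; apply At; lra. }
assert (Hb : 0 <= b <= psi) by (unfold b; nra).
split.
(* Pointwise this is the sign of [sin (b + q x)] with [|q x| <= b < PI/2]; the other side of the
   sector gives [sin (b - q x)]. *)
- replace (sin b * (Re (hk (q + 1) w) + / q) + cos b * Im (hk (q + 1) w)) with
    (Re ((sin b, (- cos b)%R) * (hk (q + 1) w + RtoC (/ q)))%C) by (unfold Re, Im; simpl; ring).
  apply Hc. intros t Ht. specialize (Hang t Ht). apply Rabs_le_between in Hang.
  pose proof (Re_Q_pos w t Hw1 Ht) as HQ.
  replace (Re ((sin b, (- cos b)%R) * Pw q (Q w t))%C) with (sin b * Re (Pw q (Q w t)) + cos b * Im (Pw q (Q w t)))
    by (unfold Re, Im; simpl; ring).
  rewrite Re_Pw, Im_Pw by exact HQ. set (x := Im (Log (Q w t))) in *.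
  replace (_ + _) with (exp (q * ln (Cmod (Q w t))) * sin (b + q * x)) by (rewrite sin_plus; ring).
  apply Rmult_le_pos; [left; apply exp_pos|]. apply sin_ge_0; unfold b; nra.
- replace (sin b * (Re (hk (q + 1) w) + / q) - cos b * Im (hk (q + 1) w)) with
    (Re ((sin b, cos b) * (hk (q + 1) w + RtoC (/ q)))%C) by (unfold Re, Im; simpl; ring).
  apply Hc. intros t Ht. specialize (Hang t Ht). apply Rabs_le_between in Hang.
  pose proof (Re_Q_pos w t Hw1 Ht) as HQ.
  replace (Re ((sin b, cos b) * Pw q (Q w t))%C) with (sin b * Re (Pw q (Q w t)) - cos b * Im (Pw q (Q w t)))
    by (unfold Re, Im; simpl; ring).
  rewrite Re_Pw, Im_Pw by exact HQ. set (x := Im (Log (Q w t))) in *.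
  replace (_ - _) with (exp (q * ln (Cmod (Q w t))) * sin (b - q * x)) by (rewrite sin_minus; ring).
  apply Rmult_le_pos; [left; apply exp_pos|]. apply sin_ge_0; unfold b; nra.
Qed.

(** * The imaginary part *)


Lemma Log_conj (z : C) : Log (Cconj z) = Cconj (Log z).
Proof.
unfold Log, Cconj; simpl. apply Ceq_ext; simpl; unfold Re, Im; simpl.
- f_equal. f_equal. ring.
- rewrite <- atan_opp. f_equal. unfold Rdiv. ring.
Qed.

Lemma Cexp_conj (z : C) : Cexp (Cconj z) = Cconj (Cexp z).
Proof.
unfold Cexp, Cconj; simpl. apply Ceq_ext; simpl; unfold Re, Im; simpl; rewrite ?cos_neg, ?sin_neg; ring.
Qed.

Lemma Cconj_RtoC (x : R) : Cconj (RtoC x) = RtoC x.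
Proof. apply Ceq_ext; simpl; ring. Qed.

Lemma one_minus_conj (w : C) : (RtoC 1 - Cconj w)%C = Cconj (RtoC 1 - w)%C.
Proof. apply Ceq_ext; simpl; unfold Re, Im; simpl; ring. Qed.

Lemma invpow_conj (a : R) (w : C) : invpow a (Cconj w) = Cconj (invpow a w).
Proof.
unfold invpow. rewrite one_minus_conj, Log_conj, <- Cexp_conj, Cmult_conj, Cconj_RtoC. reflexivity.
Qed.

Lemma kk_conj (p : R) (w : C) : kk p (Cconj w) = Cconj (kk p w).
Proof.
unfold kk. destruct (Req_dec_T p 1) as [Ep|Ep].
- rewrite one_minus_conj, Log_conj. apply Ceq_ext; simpl; ring.
- rewrite invpow_conj, Cmult_conj, Cminus_conj, Cinv_conj, !Cconj_RtoC; [reflexivity|].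
  intros X. apply RtoC_inj in X. lra.
Qed.

Lemma hk_conj (p : R) (w : C) : hk p (Cconj w) = Cconj (hk p w).
Proof.
unfold hk. destruct (Ceq_dec w (RtoC 0)) as [->|H0].
- rewrite Cconj_RtoC, over_z_0, Cconj_RtoC. reflexivity.
- assert (H1 : Cconj w <> RtoC 0).
  { intros X. apply (f_equal Cconj) in X. rewrite Cconj_conj, Cconj_RtoC in X. contradiction. }
  rewrite !over_z_neq0, kk_conj by assumption. unfold Cdiv. rewrite Cmult_conj, Cinv_conj by exact H0. reflexivity.
Qed.

Lemma one_minus_polar (w : C) : Re w < 1 -> exists rho om,
  0 < rho /\ - PI / 2 < om < PI / 2 /\ Re w = 1 - rho * cos om /\ Im w = rho * sin om /\
  (forall a, Im (invpow a w) = exp (- a * ln rho) * sin (a * om)) /\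
  (forall a, Re (invpow a w) = exp (- a * ln rho) * cos (a * om)).
Proof.
intros Hw. pose proof (Re_1_minus w Hw) as H1.
exists (Cmod (RtoC 1 - w)%C), (- Im (Log (RtoC 1 - w)%C)).
pose proof (Im_Log_bound (RtoC 1 - w)%C) as Hb.
pose proof (Re_polar _ H1) as P1. pose proof (Im_polar _ H1) as P2.
assert (R1 : Re (RtoC 1 - w)%C = 1 - Re w) by (unfold Re; simpl; ring).
assert (R2 : Im (RtoC 1 - w)%C = - Im w) by (unfold Im; simpl; ring).
split; [apply Cmod_gt_0, Re_pos_neq0, H1|]. split; [lra|].
rewrite cos_neg, sin_neg. split; [lra|]. split; [lra|].
split; intros a.
- change (invpow a w) with (Pw (- a) (RtoC 1 - w)%C). rewrite Im_Pw by exact H1.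
  replace (a * - Im (Log (RtoC 1 - w)%C)) with (- a * Im (Log (RtoC 1 - w)%C)) by ring. reflexivity.
- change (invpow a w) with (Pw (- a) (RtoC 1 - w)%C). rewrite Re_Pw by exact H1.
  replace (a * - Im (Log (RtoC 1 - w)%C)) with (- a * Im (Log (RtoC 1 - w)%C)) by ring. reflexivity.
Qed.

Lemma Im_invpow_ge0 (p : R) (w : C) : 0 <= p <= 2 -> Re w < 1 -> 0 <= Im w -> 0 <= Im (invpow p w).
Proof.
intros Hp Hw Hi. destruct (one_minus_polar w Hw) as [rho [om [Hr [Ho [_ [H2 [H3 _]]]]]]].
rewrite H3. apply Rmult_le_pos; [left; apply exp_pos|].
assert (0 <= om).
{ apply Rnot_lt_le. intros Hlt. assert (sin om < 0) by (apply sin_lt_0_var; lra). nra. }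
apply sin_ge_0; nra.
Qed.

Lemma Im_hk_ge0 (p : R) (w : C) : 0 <= p <= 2 -> Re w < 1 -> 0 <= Im w -> 0 <= Im (hk p w).
Proof.
intros Hp Hw Hi.
assert (HH := hk_le p (RtoC 0) w (RtoC 0) (- Ci)%C ltac:(simpl; lra) Hw).
assert (X : forall z : C, Re (- Ci * z)%C = Im z) by (intros; unfold Re, Im; simpl; ring).
rewrite X, Cmult_0_l in HH. apply HH.
intros t Ht. rewrite X, Cmult_0_l. apply Im_invpow_ge0; [exact Hp|now apply Re_ray_lt_1|].
rewrite Im_scal. apply Rmult_le_pos; lra.
Qed.

(* With [1 - x = rho e^(-i om)], [|x| < 1] means [rho < 2 cos om], and then the imaginary
   part exceeds a positive multiple of [sin ((1-p) om) >= 0]. *)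
Lemma Im_mul_invpow_pos (p : R) (x : C) : 0 < p <= 1 -> Cmod x < 1 -> 0 < Im x ->
  0 < Im (x * invpow (p + 1) x)%C.
Proof.
intros Hp Hx Hi. assert (Hx1 : Re x < 1) by now apply Re_lt_1.
destruct (one_minus_polar x Hx1) as [rho [om [Hr [Ho [H1 [H2 [H3 H4]]]]]]].
assert (Hom : 0 < om).
{ apply Rnot_le_lt. intros Hle.
  destruct (Req_dec om 0) as [->|Hne]; [rewrite sin_0 in H2; lra|].
  assert (sin om < 0) by (apply sin_lt_0_var; lra). nra. }
pose proof (Cmod_sqr x) as Hs. rewrite H1, H2 in Hs.
pose proof (sin2_cos2 om) as Hsc. unfold Rsqr in Hsc.
assert (Hs1 : Cmod x * Cmod x < 1) by (pose proof (Cmod_ge_0 x); nra).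
assert (Hrc : rho < 2 * cos om).
{ apply Rmult_lt_reg_l with rho; [exact Hr|].
  assert (Hs2 : (1 - rho * cos om) * (1 - rho * cos om) + rho * sin om * (rho * sin om) =
    1 - 2 * (rho * cos om) + rho * rho * (sin om * sin om + cos om * cos om)) by ring.
  rewrite Hsc in Hs2. nra. }
assert (Hsp : 0 < sin (p * om)) by (apply sin_gt_0; nra).
assert (Hs1p : 0 <= sin ((1 - p) * om)) by (apply sin_ge_0; nra).
replace (Im (x * invpow (p + 1) x)%C) with (Re x * Im (invpow (p + 1) x) + Im x * Re (invpow (p + 1) x))
  by (unfold Re, Im; simpl; ring).
rewrite H3, H4, H1, H2.
set (e := exp _). assert (He : 0 < e) by apply exp_pos.
replace ((1 - rho * cos om) * (e * sin ((p + 1) * om)) + rho * sin om * (e * cos ((p + 1) * om)))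
  with (e * (sin ((p + 1) * om) - rho * (sin ((p + 1) * om) * cos om - cos ((p + 1) * om) * sin om))) by ring.
rewrite <- sin_minus. replace ((p + 1) * om - om) with (p * om) by ring.
apply Rmult_lt_0_compat; [exact He|].
replace ((p + 1) * om) with (p * om + om) by ring. rewrite sin_plus.
replace ((1 - p) * om) with (om - p * om) in Hs1p by ring. rewrite sin_minus in Hs1p.
assert (rho * sin (p * om) < 2 * cos om * sin (p * om)) by (apply Rmult_lt_compat_r; lra).
lra.
Qed.

(** The derivative of [h(tw)] in [t] is [N(t)/t^2] with [N(0) = 0] and
    [N'(t) = p t w (1-tw)^(-p-1)], whose imaginary part is positive. Boundary points [|w| = 1] are
    included, since only [t < 1] enters the strict inequality for [N']. *)
Lemma Im_hk_increasing (p : R) (w : C) (t0 : R) : 0 < p <= 1 -> Cmod w <= 1 -> Re w < 1 -> 0 < Im w ->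
  0 < t0 < 1 -> Im (hk p (RtoC t0 * w)) < Im (hk p w).
Proof.
intros Hp Hw Hw1 Hi Ht0.
assert (H0 : w <> RtoC 0) by (intros ->; simpl in Hi; lra).
set (N := fun t => (RtoC t * invpow p (RtoC t * w) - / w * kk p (RtoC t * w))%C).
assert (HN : forall t, 0 <= t <= 1 -> cder N t (RtoC p * (RtoC t * w * invpow (p + 1) (RtoC t * w)))%C).
{ intros t Ht. unfold N. eapply cder_eq.
  - apply cder_minus.
    + apply cder_mult; [apply cder_id|]. apply cder_invpow; [apply cder_ray|now apply Re_ray_lt_1].
    + apply cder_scal, cder_kk; [apply cder_ray|now apply Re_ray_lt_1].
  - cbv beta. field. exact H0. }
assert (HNpos : forall t, 0 < t <= 1 -> 0 < Im (N t)).
{ intros t Ht.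
  assert (HH := derive_lt (fun t => Im (N t)) (fun t => Im (RtoC p * (RtoC t * w * invpow (p + 1) (RtoC t * w)))%C) 0 t ltac:(lra)).
  cbv beta in HH.
  assert (N0 : N 0 = RtoC 0) by (unfold N; rewrite !Cmult_0_l, kk_0; ring).
  rewrite N0 in HH. apply HH; intros s Hs.
  - apply HN; lra.
  - rewrite Im_scal. apply Rmult_lt_0_compat; [lra|]. apply Im_mul_invpow_pos; [exact Hp| |].
    + rewrite Cmod_mult, Cmod_RtoC_pos by lra. nra.
    + rewrite Im_scal. apply Rmult_lt_0_compat; lra. }
set (G := fun t => (RtoC (/ t) * (/ w * kk p (RtoC t * w)))%C).
assert (HG : forall t, 0 < t <= 1 -> cder G t (RtoC (/ (t * t)) * N t)%C).
{ intros t Ht. unfold G. eapply cder_eq.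
  - apply cder_mult; [apply cder_RtoC, is_derive_inv; [apply (is_derive_id (K := R_AbsRing))|simpl; lra]|].
    apply cder_scal, cder_kk; [apply cder_ray|apply Re_ray_lt_1; [exact Hw1|lra]].
  - cbv beta. unfold N. change (@one R_AbsRing) with 1.
    replace (- (1) / t ^ 2) with (- / (t * t)) by (field; lra).
    replace (/ t) with (/ (t * t) * t) by (field; lra).
    rewrite RtoC_opp, RtoC_mult. field. exact H0. }
assert (HGk : forall t, 0 < t <= 1 -> hk p (RtoC t * w)%C = G t).
{ intros t Ht. assert (Htn : RtoC t <> RtoC 0) by (intros X; apply RtoC_inj in X; lra).
  unfold hk, G. rewrite over_z_neq0 by now apply Cmult_neq_0.
  rewrite RtoC_inv by lra. field. split; assumption. }
rewrite <- (Cmult_1_l w) at 2. rewrite !HGk by lra.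
apply (derive_lt (fun t => Im (G t)) (fun t => Im (RtoC (/ (t * t)) * N t)%C)); [lra| |]; intros t Ht.
- apply HG; lra.
- rewrite Im_scal. apply Rmult_lt_0_compat; [apply Rinv_0_lt_compat; nra|apply HNpos; lra].
Qed.

(** Serves only for the continuity of [h] along rays, up to and including boundary points other than
    1. *)
Lemma cder_hk_ray (p : R) (w : C) (t : R) : 0 < t -> w <> RtoC 0 -> Re (RtoC t * w)%C < 1 ->
  exists l, cder (fun s => hk p (RtoC s * w)%C) t l.
Proof.
intros Ht H0 Hw. eexists.
apply (cder_ext_loc (fun s => kk p (RtoC s * w) * / (RtoC s * w))%C).
- generalize (open_gt 0 t Ht). apply filter_imp. intros s Hs. unfold hk.
  rewrite over_z_neq0; [reflexivity|]. apply Cmult_neq_0; [|exact H0].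
  intros X; apply RtoC_inj in X; lra.
- apply cder_mult; [apply cder_kk; [apply cder_ray|exact Hw]|].
  apply cder_inv; [apply cder_ray|]. apply Cmult_neq_0; [|exact H0].
  intros X; apply RtoC_inj in X; lra.
Qed.

Lemma Re_circ (r t : R) : Re (circ r t) = r * cos t.
Proof. unfold circ, Cexp, Re; simpl. rewrite Rmult_0_l, Rmult_0_r, Rminus_0_r, exp_0. replace (0 * 0 + 1 * t) with t by ring. ring. Qed.

Lemma Im_circ (r t : R) : Im (circ r t) = r * sin t.
Proof. unfold circ, Cexp, Im; simpl. rewrite Rmult_0_l, Rmult_0_r, Rminus_0_r, exp_0. replace (0 * 0 + 1 * t) with t by ring. ring. Qed.

Lemma circ_scal (r s t : R) : (RtoC r * circ s t)%C = circ (r * s) t.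
Proof. unfold circ. rewrite RtoC_mult. ring. Qed.

Lemma upper_polar (w : C) : 0 < Im w -> exists t, 0 < t < PI /\ w = circ (Cmod w) t.
Proof.
intros Hi. assert (H0 : w <> RtoC 0) by (intros ->; simpl in Hi; lra).
assert (Hm : 0 < Cmod w) by now apply Cmod_gt_0.
exists (Carg w).
assert (E1 := Cexp_Clog w H0). unfold Clog, Cexp in E1. simpl in E1. rewrite exp_ln in E1 by exact Hm.
assert (E2 : w = circ (Cmod w) (Carg w)).
{ apply Ceq_ext; rewrite ?Re_circ, ?Im_circ; rewrite <- E1 at 1; reflexivity. }
split; [|exact E2].
assert (Hc : 0 <= Carg w <= PI).
{ unfold Carg. destruct (Rle_dec 0 (Im w)); [apply acos_bound|lra]. }
rewrite E2, Im_circ in Hi.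
destruct (Req_dec (Carg w) 0) as [X|X]; [rewrite X, sin_0 in Hi; lra|].
destruct (Req_dec (Carg w) PI) as [Y|Y]; [rewrite Y, sin_PI in Hi; lra|]. lra.
Qed.

Lemma cos_lt_1 (t : R) : 0 < t < PI -> cos t < 1.
Proof. intros Ht. rewrite <- cos_0. apply cos_decreasing_1; lra. Qed.

(** By conjugation and monotonicity along radii, [|Im h|] on the disk is largest on the upper half
    circle of radius [s]. The boundary point on the ray of a maximum has a strictly larger value,
    and this gap makes the bound by [M_] strict. *)
Lemma Im_hk_disk (p s : R) : 0 < p <= 1 -> 0 < s < 1 -> exists t S,
  0 < t < PI /\ S < Im (hk p (circ 1 t)) /\ forall w, Cmod w <= s -> Rabs (Im (hk p w)) <= S.
Proof.
intros Hp Hs. pose proof PI_RGT_0 as Hpi.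
destruct (continuity_ab_maj (fun t => Im (hk p (circ s t))) 0 PI ltac:(lra)) as [t0 [Hmax Ht0]].
{ intros t Ht. apply continuity_pt_filterlim.
  assert (Hn : forall t, circ s t <> RtoC 0) by (intros; apply circ_neq0; lra).
  assert (Hc : cont (fun t => kk p (circ s t) * / circ s t)%C t).
  { apply cont_mult.
    - eapply cder_cont, cder_kk; [apply cder_circ|]. apply Re_lt_1. rewrite Cmod_circ; lra.
    - apply cont_inv; [apply (cont_circ s (fun t => t)), continuous_id|apply Hn]. }
  apply proj2 in Hc.
  apply (continuous_ext (fun t => Im (kk p (circ s t) * / circ s t)%C) (fun t => Im (hk p (circ s t)))); [|exact Hc].
  intros x. unfold hk. now rewrite over_z_neq0. }
set (S := Im (hk p (circ s t0))) in *.
assert (Hreal : forall x, Im (hk p (RtoC x)) = 0).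
{ intros x. assert (X := hk_conj p (RtoC x)). rewrite Cconj_RtoC in X.
  apply (f_equal Im) in X.
  change (Im (hk p (RtoC x)) = - Im (hk p (RtoC x))) in X. lra. }
assert (Hc0 : circ s 0 = RtoC s).
{ apply Ceq_ext; rewrite ?Re_circ, ?Im_circ, ?cos_0, ?sin_0; simpl; ring. }
assert (HcP : circ s PI = RtoC (- s)).
{ apply Ceq_ext; rewrite ?Re_circ, ?Im_circ, ?cos_PI, ?sin_PI; simpl; ring. }
assert (HS0 : 0 <= S).
{ rewrite <- (Hreal s), <- Hc0. apply (Hmax 0). lra. }
assert (Hbd : forall w, Cmod w <= s -> 0 <= Im w -> Im (hk p w) <= S).
{ intros w Hw [Hi|Hi].
  - destruct (upper_polar w Hi) as [t [Ht Ew]].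
    assert (Hm : 0 < Cmod w) by (apply Cmod_gt_0; intros ->; simpl in Hi; lra).
    apply Rle_trans with (Im (hk p (circ s t))); [|apply Hmax; lra].
    destruct Hw as [Hw|Hw]; [|rewrite Ew, Hw; apply Rle_refl].
    left. replace w with (RtoC (Cmod w / s) * circ s t)%C.
    + apply Im_hk_increasing; [exact Hp|rewrite Cmod_circ; lra|apply Re_lt_1; rewrite Cmod_circ; lra| |].
      * rewrite Im_circ. apply Rmult_lt_0_compat; [lra|apply sin_gt_0; lra].
      * split; [apply Rdiv_lt_0_compat; lra|]. apply Rmult_lt_reg_r with s; [lra|].
        unfold Rdiv. rewrite Rmult_assoc, Rinv_l; lra.
    + rewrite circ_scal. rewrite Ew at 2. f_equal. field. lra.
  - assert (Ew : w = RtoC (Re w)) by (apply Ceq_ext; simpl; [reflexivity|now symmetry]).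
    rewrite Ew, Hreal. exact HS0. }
assert (Hall : forall w, Cmod w <= s -> Rabs (Im (hk p w)) <= S).
{ intros w Hw. destruct (Rle_lt_dec 0 (Im w)) as [Hi|Hi].
  - rewrite Rabs_pos_eq; [now apply Hbd|]. apply Im_hk_ge0; [lra|apply Re_lt_1; lra|exact Hi].
  - assert (X := hk_conj p w). apply (f_equal Im) in X. change (Im (hk p (Cconj w)) = - Im (hk p w)) in X.
    assert (Hi' : 0 <= Im (Cconj w)) by (change (0 <= - Im w); lra).
    assert (Y1 : 0 <= Im (hk p (Cconj w))).
    { apply Im_hk_ge0; [lra|apply Re_lt_1; rewrite Cmod_conj; lra|exact Hi']. }
    assert (Y2 : Im (hk p (Cconj w)) <= S) by (apply Hbd; [rewrite Cmod_conj; exact Hw|exact Hi']).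
    rewrite <- Rabs_Ropp, Rabs_pos_eq; lra. }
assert (Hlt : forall t, 0 < t < PI -> Im (hk p (circ s t)) < Im (hk p (circ 1 t))).
{ intros t Ht. replace (circ s t) with (RtoC s * circ 1 t)%C by (rewrite circ_scal; f_equal; ring).
  apply Im_hk_increasing; [exact Hp|rewrite Cmod_circ; lra| | |exact Hs].
  - rewrite Re_circ. pose proof (cos_lt_1 t Ht). lra.
  - rewrite Im_circ. pose proof (sin_gt_0 t ltac:(lra) ltac:(lra)). lra. }
(* A maximum at a real point means [S = 0]; any other ray then exceeds it, here the imaginary
   axis. *)
destruct (Req_dec t0 0) as [E0|E0].
{ exists (PI / 2), S. split; [lra|]. split; [|exact Hall].
  assert (S = 0) by (unfold S; rewrite E0, Hc0; apply Hreal).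
  eapply Rle_lt_trans; [|apply Hlt; lra].
  assert (0 <= Im (hk p (circ s (PI / 2)))); [|lra].
  apply Im_hk_ge0; [lra|apply Re_lt_1; rewrite Cmod_circ; lra|rewrite Im_circ, sin_PI2; lra]. }
destruct (Req_dec t0 PI) as [EP|EP].
{ exists (PI / 2), S. split; [lra|]. split; [|exact Hall].
  assert (S = 0) by (unfold S; rewrite EP, HcP; apply Hreal).
  eapply Rle_lt_trans; [|apply Hlt; lra].
  assert (0 <= Im (hk p (circ s (PI / 2)))); [|lra].
  apply Im_hk_ge0; [lra|apply Re_lt_1; rewrite Cmod_circ; lra|rewrite Im_circ, sin_PI2; lra]. }
exists t0, S. split; [lra|]. split; [apply Hlt; lra|exact Hall].
Qed.

(** * The constant [M_] as a supremum of boundary values of [Im h] *)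

Lemma Cexp_circ (t : R) : Cexp (Ci * RtoC t)%C = circ 1 t.
Proof. unfold circ. ring. Qed.

Lemma M_value (alpha t : R) : 0 < t < PI ->
  Im (Cexp (- Ci * RtoC t) * k_ alpha (Cexp (Ci * RtoC t)))%C = Im (hk (2 - 2 * alpha) (circ 1 t)).
Proof.
intros Ht. pose proof (cos_lt_1 t Ht) as Hc.
rewrite k_kk by (rewrite Cexp_circ, Re_circ; lra).
rewrite Cexp_circ.
assert (Hn : circ 1 t <> RtoC 0) by (apply circ_neq0; lra).
unfold hk. rewrite over_z_neq0 by exact Hn. f_equal.
assert (X : (Cexp (- Ci * RtoC t) * circ 1 t)%C = RtoC 1).
{ rewrite <- Cexp_circ, <- Cexp_plus. replace (- Ci * RtoC t + Ci * RtoC t)%C with (RtoC 0) by ring. apply Cexp_0. }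
transitivity (Cexp (- Ci * RtoC t) * circ 1 t * (kk (2 - 2 * alpha) (circ 1 t) / circ 1 t))%C.
- field. exact Hn.
- rewrite X. ring.
Qed.

Lemma M_ge (alpha t : R) : 0 < t < PI -> Rbar_le (Finite (Im (hk (2 - 2 * alpha) (circ 1 t)))) (M_ alpha).
Proof.
intros Ht. apply (proj1 (Lub_Rbar_correct _)). exists t. split; [exact Ht|]. symmetry. now apply M_value.
Qed.

Lemma M_le (alpha : R) (b : Rbar) :
  (forall t, 0 < t < PI -> Rbar_le (Finite (Im (hk (2 - 2 * alpha) (circ 1 t)))) b) -> Rbar_le (M_ alpha) b.
Proof.
intros H. apply (proj2 (Lub_Rbar_correct _)). intros x [t [Ht ->]]. rewrite M_value by exact Ht. now apply H.
Qed.

Lemma Im_over_z_lt_M (alpha : R) (f : C -> C) (z : C) : 1 / 2 <= alpha < 1 -> convex_of_order alpha f ->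
  Cmod z < 1 -> Rbar_lt (Finite (Rabs (Im (over_z f z)))) (M_ alpha).
Proof.
intros Ha Hf Hz. pose proof (Cmod_ge_0 z) as Hz0. set (p := 2 - 2 * alpha).
set (s := (1 + Cmod z) / 2).
destruct (Im_hk_disk p s) as [t [S [Ht [HS Hb]]]]; [unfold p; lra|unfold s; lra|].
apply Rbar_lt_le_trans with (Finite (Im (hk p (circ 1 t)))); [|now apply M_ge].
simpl. eapply Rle_lt_trans; [|exact HS].
assert (X1 : forall z : C, Re (- Ci * z)%C = Im z) by (intros; unfold Re, Im; simpl; ring).
assert (X2 : forall z : C, Re (Ci * z)%C = - Im z) by (intros; unfold Re, Im; simpl; ring).
assert (B1 : Im (over_z f z) <= S).
{ rewrite <- X1. apply (hull_convex_of_order alpha f z (- Ci)%C s S); [lra|exact Hf|unfold s; lra|unfold s; lra|].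
  intros w Hw. rewrite X1. specialize (Hb w Hw). apply Rabs_le_between in Hb. unfold hk in Hb. fold p. lra. }
assert (B2 : - Im (over_z f z) <= S).
{ rewrite <- X2. apply (hull_convex_of_order alpha f z Ci s S); [lra|exact Hf|unfold s; lra|unfold s; lra|].
  intros w Hw. rewrite X2. specialize (Hb w Hw). apply Rabs_le_between in Hb. unfold hk in Hb. fold p. lra. }
apply Rabs_le. lra.
Qed.

Lemma hk_radial_limit (p t e : R) : 0 < t < PI -> 0 < e -> exists x, 0 < x < 1 /\
  Rabs (Im (hk p (RtoC x * circ 1 t)%C) - Im (hk p (circ 1 t))) < e.
Proof.
intros Ht He. pose proof (cos_lt_1 t Ht) as Hc.
destruct (cder_hk_ray p (circ 1 t) 1) as [l Hl]; [lra|apply circ_neq0; lra|rewrite Cmult_1_l, Re_circ; lra|].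
apply cder_cont in Hl. destruct Hl as [_ Hl].
destruct (proj1 (filterlim_locally _ _) Hl (mkposreal e He)) as [d Hd].
set (y := Rmin (d / 2) (1 / 2)).
assert (Hy : 0 < y) by (apply Rmin_glb_lt; [pose proof (cond_pos d); lra|lra]).
assert (Hy1 : y <= d / 2) by apply Rmin_l. assert (Hy2 : y <= 1 / 2) by apply Rmin_r.
exists (1 - y). split; [lra|].
assert (Hb : ball 1 d (1 - y)).
{ change (Rabs (1 - y - 1) < d). replace (1 - y - 1) with (- y) by ring.
  rewrite Rabs_Ropp, Rabs_pos_eq by lra. pose proof (cond_pos d). lra. }
specialize (Hd _ Hb). rewrite Cmult_1_l in Hd. exact Hd.
Qed.

Lemma cos_lt_1_2PI (t : R) : 0 < t < 2 * PI -> cos t < 1.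
Proof.
intros Ht. replace t with (2 * (t / 2)) by field. rewrite cos_2a_sin.
assert (0 < sin (t / 2)) by (apply sin_gt_0; lra). nra.
Qed.

(** From [1 - e^(it) = 2 sin(t/2) e^(-i (PI-t)/2)]. *)
Lemma Log_one_minus_circ (t : R) : 0 < t < 2 * PI ->
  Log (RtoC 1 - circ 1 t)%C = (ln (2 * sin (t / 2)), - ((PI - t) / 2)).
Proof.
intros Ht.
assert (Hs : 0 < sin (t / 2)) by (apply sin_gt_0; lra).
assert (Dc : cos t = 1 - 2 * sin (t / 2) * sin (t / 2)).
{ replace t with (2 * (t / 2)) at 1 by field. apply cos_2a_sin. }
assert (Ds : sin t = 2 * sin (t / 2) * cos (t / 2)).
{ replace t with (2 * (t / 2)) at 1 by field. apply sin_2a. }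
unfold Log.
assert (R1 : Re (RtoC 1 - circ 1 t)%C = 1 - cos t).
{ change (1 + - Re (circ 1 t) = 1 - cos t). rewrite Re_circ. ring. }
assert (R2 : Im (RtoC 1 - circ 1 t)%C = - sin t).
{ change (0 + - Im (circ 1 t) = - sin t). rewrite Im_circ. ring. }
rewrite R1, R2. f_equal.
- pose proof (sin2_cos2 t) as SC. unfold Rsqr in SC.
  replace ((1 - cos t) * (1 - cos t) + - sin t * - sin t) with (2 * sin (t / 2) * (2 * sin (t / 2))).
  + rewrite ln_mult by lra. field.
  + replace ((1 - cos t) * (1 - cos t) + - sin t * - sin t) with (1 - 2 * cos t + (sin t * sin t + cos t * cos t)) by ring.
    rewrite SC, Dc. ring.
- replace (- sin t / (1 - cos t)) with (- tan ((PI - t) / 2)).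
  + rewrite atan_opp, atan_tan by lra. reflexivity.
  + unfold tan. replace ((PI - t) / 2) with (PI / 2 - t / 2) by field.
    rewrite sin_shift, cos_shift, Ds, Dc.
    replace (1 - (1 - 2 * sin (t / 2) * sin (t / 2))) with (2 * sin (t / 2) * sin (t / 2)) by ring.
    field. lra.
Qed.

Lemma M_half_value (t : R) : 0 < t < PI ->
  Im (hk (2 - 2 * (1 / 2)) (circ 1 t)) = cos t * ((PI - t) / 2) + sin t * ln (2 * sin (t / 2)).
Proof.
intros Ht. rewrite <- M_value by exact Ht.
assert (Hc := cos_lt_1 t Ht).
rewrite k_kk by (rewrite Cexp_circ, Re_circ; lra). rewrite Cexp_circ.
unfold kk. destruct (Req_dec_T (2 - 2 * (1 / 2)) 1) as [_|X]; [|lra].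
rewrite Log_one_minus_circ by lra.
replace (Cexp (- Ci * RtoC t)%C) with (cos t, - sin t).
- unfold Im; simpl. ring.
- apply Ceq_ext; unfold Cexp, Re, Im; simpl.
  + replace (- (0) * t - - (1) * 0) with 0 by ring. replace (- (0) * 0 + - (1) * t) with (- t) by ring.
    rewrite exp_0, cos_neg. ring.
  + replace (- (0) * t - - (1) * 0) with 0 by ring. replace (- (0) * 0 + - (1) * t) with (- t) by ring.
    rewrite exp_0, sin_neg. ring.
Qed.

Lemma ln_le_sub_1 (x : R) : 0 < x -> ln x <= x - 1.
Proof.
intros Hx. pose proof (exp_ineq1_le (ln x)) as H. rewrite exp_ln in H by exact Hx. lra.
Qed.

(** With [ph = (PI-t)/2] the boundary value is [ph] minus [2 cos ph (ph cos ph - sin ph ln (2 cos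
    ph))], and the bracket is nonnegative because [ln x <= x - 1] and [sin ph < ph]; so it is below
    [PI/2]. As [t] tends to 0 the value tends to [PI/2]. *)
Lemma M_half : M_ (1 / 2) = Finite (PI / 2).
Proof.
apply is_lub_Rbar_unique. split.
- intros x [t [Ht ->]]. rewrite M_value, M_half_value by exact Ht. simpl.
  set (ph := (PI - t) / 2). assert (Hph : 0 < ph < PI / 2) by (unfold ph; lra).
  assert (Et : t = PI - 2 * ph) by (unfold ph; lra).
  rewrite Et. rewrite <- cos_neg. replace (- (PI - 2 * ph)) with (2 * ph - PI) by ring.
  replace (cos (2 * ph - PI)) with (- cos (2 * ph)).
  2:{ rewrite cos_minus, cos_PI, sin_PI. ring. }
  replace (sin (PI - 2 * ph)) with (sin (2 * ph)) by (rewrite sin_minus, cos_PI, sin_PI; ring).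
  replace ((PI - 2 * ph) / 2) with (PI / 2 - ph) by field. rewrite sin_shift.
  replace ((PI - (PI - 2 * ph)) / 2) with ph by field.
  assert (Hc : 0 < cos ph) by (apply cos_gt_0; lra). assert (Hc1 : cos ph <= 1) by apply COS_bound.
  assert (Hs : 0 < sin ph) by (apply sin_gt_0; lra).
  assert (Hsx : sin ph < ph) by (apply sin_lt_x; lra).
  rewrite sin_2a, cos_2a_cos.
  pose proof (ln_le_sub_1 (2 * cos ph) ltac:(lra)) as Hl.
  assert (T1 : sin ph * ln (2 * cos ph) <= ph * cos ph).
  { apply Rle_trans with (sin ph * (2 * cos ph - 1)); [apply Rmult_le_compat_l; lra|].
    destruct (Rle_lt_dec 0 (2 * cos ph - 1)); nra. }
  assert (T2 : 2 * cos ph * (sin ph * ln (2 * cos ph)) <= 2 * cos ph * (ph * cos ph)) by (apply Rmult_le_compat_l; lra).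
  lra.
- intros b Hb. destruct b as [b| |]; [|exact I|].
  + simpl. apply Rnot_lt_le. intros Hlt.
    (* The angle is [t = d^2]: then [y = 2 sin (t/2)] has [sqrt y <= d], and [y ln y >= - 2 sqrt y]
       bounds the logarithmic term below by [- 2 d]. *)
    set (d := Rmin (1 / 2) ((PI / 2 - b) / 8)).
    assert (Hd : 0 < d) by (apply Rmin_glb_lt; lra).
    assert (Hd1 : d <= 1 / 2) by apply Rmin_l. assert (Hd2 : d <= (PI / 2 - b) / 8) by apply Rmin_r.
    pose proof PI2_3_2 as Hpi. pose proof PI_4 as Hpi4.
    set (t := d * d). assert (Ht : 0 < t < PI) by (unfold t; nra).
    assert (Hval : Rbar_le (Finite (Im (hk (2 - 2 * (1 / 2)) (circ 1 t)))) (Finite b)).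
    { apply Hb. exists t. split; [exact Ht|]. symmetry. now apply M_value. }
    rewrite M_half_value in Hval by exact Ht. simpl in Hval.
    assert (Hs : 0 < sin (t / 2)) by (apply sin_gt_0; lra).
    assert (Hch : 0 < cos (t / 2)) by (apply cos_gt_0; lra).
    assert (Hch1 : cos (t / 2) <= 1) by apply COS_bound.
    assert (Hst : sin (t / 2) < t / 2) by (apply sin_lt_x; lra).
    set (y := 2 * sin (t / 2)). assert (Hy : 0 < y < t) by (unfold y; lra).
    assert (Hsy : 0 < sqrt y) by (apply sqrt_lt_R0; lra).
    assert (Hyy : sqrt y * sqrt y = y) by (apply sqrt_sqrt; lra).
    assert (Hsd : sqrt y <= d).
    { apply Rnot_lt_le. intros X. assert (d * d < sqrt y * sqrt y) by nra. unfold t in Hy. lra. }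
    assert (Hln : - (2 * sqrt y) <= y * ln y).
    { pose proof (ln_le_sub_1 (/ sqrt y) (Rinv_0_lt_compat _ Hsy)) as L. rewrite ln_Rinv in L by exact Hsy.
      assert (L2 : ln y = 2 * ln (sqrt y)) by (rewrite <- Hyy at 1; rewrite ln_mult by exact Hsy; ring).
      assert (L3 : y * / sqrt y = sqrt y) by (rewrite <- Hyy at 1; field; lra).
      assert (L4 : y * - ln (sqrt y) <= y * (/ sqrt y - 1)) by (apply Rmult_le_compat_l; lra).
      rewrite L2. lra. }
    assert (T1 : - (2 * d) <= sin t * ln y).
    { replace (sin t) with (cos (t / 2) * y).
      - assert (Hp : y * ln y <= 0).
        { assert (ln y <= ln 1) by (apply ln_le; [lra|]; unfold t in Hy; nra). rewrite ln_1 in H. nra. }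
        rewrite Rmult_assoc. nra.
      - unfold y. replace t with (2 * (t / 2)) at 3 by field. rewrite sin_2a. ring. }
    assert (T2 : 1 - t <= cos t).
    { assert (Dc : cos t = 1 - 2 * sin (t / 2) * sin (t / 2)).
      { replace t with (2 * (t / 2)) at 1 by field. apply cos_2a_sin. }
      assert (S2 : sin (t / 2) * sin (t / 2) <= t / 2 * (t / 2)) by (apply Rmult_le_compat; lra).
      assert (Ht1 : t <= 1) by (unfold t; nra).
      rewrite Dc. clear - S2 Ht1 Ht. nra. }
    fold y in Hval.
    assert (T3 : (1 - t) * ((PI - t) / 2) <= cos t * ((PI - t) / 2)) by (apply Rmult_le_compat_r; lra).
    assert (T4 : t <= d) by (unfold t; nra).
    nra.
  + exfalso. pose proof PI_RGT_0. apply (Hb (Im (hk (2 - 2 * (1 / 2)) (circ 1 (PI / 2))))).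
    exists (PI / 2). split; [lra|]. symmetry. apply M_value. lra.
Qed.

(** The function [k_ alpha] is itself convex of order [1/2], so the bound already proved for that
    order applies to it in the disk; boundary values follow radially. *)
Lemma M_le_half (alpha : R) : 1 / 2 <= alpha < 1 -> Rbar_le (M_ alpha) (M_ (1 / 2)).
Proof.
intros Ha. rewrite M_half. apply M_le. intros t Ht. simpl.
apply Rnot_lt_le. intros Hlt.
set (p := 2 - 2 * alpha) in *.
destruct (hk_radial_limit p t (Im (hk p (circ 1 t)) - PI / 2) Ht ltac:(lra)) as [x [Hx He]].
assert (Hd : Cmod (RtoC x * circ 1 t)%C < 1).
{ rewrite Cmod_mult, Cmod_RtoC_pos, Cmod_circ by lra. lra. }
pose proof (Im_over_z_lt_M (1 / 2) (k_ alpha) (RtoC x * circ 1 t)%C ltac:(lra) (k_convex alpha (1 / 2) ltac:(lra) ltac:(lra)) Hd) as HM.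
rewrite M_half in HM. simpl in HM.
assert (Eh : over_z (k_ alpha) (RtoC x * circ 1 t)%C = hk p (RtoC x * circ 1 t)%C).
{ unfold hk, over_z. destruct (Ceq_dec _ _); [reflexivity|]. rewrite k_kk by now apply Re_lt_1. reflexivity. }
change (Rabs (Im (over_z (k_ alpha) (RtoC x * circ 1 t)%C)) < PI / 2) in HM.
rewrite Eh in HM. apply Rabs_def2 in HM. apply Rabs_def2 in He. lra.
Qed.

Lemma M_sharp (alpha c : R) : 1 / 2 <= alpha < 1 -> Rbar_lt (Finite c) (M_ alpha) ->
  exists z, Cmod z < 1 /\ c < Rabs (Im (over_z (k_ alpha) z)).
Proof.
intros Ha Hc. set (p := 2 - 2 * alpha).
destruct (classic (exists t, 0 < t < PI /\ c < Im (hk p (circ 1 t)))) as [[t [Ht Hv]]|Hno].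
- destruct (hk_radial_limit p t (Im (hk p (circ 1 t)) - c) Ht ltac:(lra)) as [x [Hx He]].
  assert (Hd : Cmod (RtoC x * circ 1 t)%C < 1).
  { rewrite Cmod_mult, Cmod_RtoC_pos, Cmod_circ by lra. lra. }
  exists (RtoC x * circ 1 t)%C. split; [exact Hd|].
  assert (Eh : over_z (k_ alpha) (RtoC x * circ 1 t)%C = hk p (RtoC x * circ 1 t)%C).
  { unfold hk, over_z. destruct (Ceq_dec _ _); [reflexivity|]. rewrite k_kk by now apply Re_lt_1. reflexivity. }
  rewrite Eh. eapply Rlt_le_trans; [|apply Rle_abs]. apply Rabs_def2 in He. lra.
- exfalso. apply (Rbar_lt_not_le _ _ Hc). apply M_le. intros t Ht. simpl.
  apply Rnot_lt_le. intros X. apply Hno. exists t. split; assumption.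
Qed.

(** * Asymptotic lines *)


(** A unit normal makes the left side of the equation the signed distance. The first coefficient
    belongs to [Im w]. *)
Definition normal_form (L : C -> Prop) (a b c : R) : Prop :=
  a * a + b * b = 1 /\ forall w, L w <-> a * Im w + b * Re w + c = 0.

Lemma line_normal_form (L : C -> Prop) : is_line L -> exists a b c, normal_form L a b c.
Proof.
intros [p [d [Hd HL]]].
assert (Hm : 0 < Cmod d) by now apply Cmod_gt_0.
pose proof (Cmod_sqr d) as Hs.
exists (Re d / Cmod d), (- Im d / Cmod d), (- (Re d / Cmod d * Im p + - Im d / Cmod d * Re p)).
split.
- replace (_ + _) with ((Re d * Re d + Im d * Im d) / (Cmod d * Cmod d)) by (field; lra).
  rewrite <- Hs. field. lra.
- intros w. rewrite HL. split.
  + intros [t ->]. unfold Re, Im; simpl. field. lra.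
  + intros Hw.
    assert (X : Re d * (Im w - Im p) - Im d * (Re w - Re p) = 0).
    { replace (Re d * (Im w - Im p) - Im d * (Re w - Re p)) with
        (Cmod d * (Re d / Cmod d * Im w + - Im d / Cmod d * Re w + - (Re d / Cmod d * Im p + - Im d / Cmod d * Re p)))
        by (field; lra). rewrite Hw; ring. }
    exists ((Re d * (Re w - Re p) + Im d * (Im w - Im p)) / (Cmod d * Cmod d)).
    assert (HD : 0 < Re d * Re d + Im d * Im d) by (rewrite <- Hs; nra).
    rewrite Hs.
    set (D := Re d * Re d + Im d * Im d) in *.
    apply Ceq_ext.
    * change (Re (p + _)%C) with (Re p + Re (RtoC ((Re d * (Re w - Re p) + Im d * (Im w - Im p)) / D) * d)%C).
      rewrite Re_scal. apply Rmult_eq_reg_r with D; [|lra].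
      replace ((Re p + (Re d * (Re w - Re p) + Im d * (Im w - Im p)) / D * Re d) * D) with
        (Re p * D + (Re d * (Re w - Re p) + Im d * (Im w - Im p)) * Re d) by (field; lra).
      unfold D.
      replace (Re w * (Re d * Re d + Im d * Im d)) with
        (Re p * (Re d * Re d + Im d * Im d) + (Re d * (Re w - Re p) + Im d * (Im w - Im p)) * Re d
         - Im d * (Re d * (Im w - Im p) - Im d * (Re w - Re p))) by ring.
      rewrite X. ring.
    * change (Im (p + _)%C) with (Im p + Im (RtoC ((Re d * (Re w - Re p) + Im d * (Im w - Im p)) / D) * d)%C).
      rewrite Im_scal. apply Rmult_eq_reg_r with D; [|lra].
      replace ((Im p + (Re d * (Re w - Re p) + Im d * (Im w - Im p)) / D * Im d) * D) with
        (Im p * D + (Re d * (Re w - Re p) + Im d * (Im w - Im p)) * Im d) by (field; lra).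
      unfold D.
      replace (Im w * (Re d * Re d + Im d * Im d)) with
        (Im p * (Re d * Re d + Im d * Im d) + (Re d * (Re w - Re p) + Im d * (Im w - Im p)) * Im d
         + Re d * (Re d * (Im w - Im p) - Im d * (Re w - Re p))) by ring.
      rewrite X. ring.
Qed.

Lemma normal_form_line (L : C -> Prop) (a b c : R) : normal_form L a b c -> is_line L.
Proof.
intros [Hab HL]. exists (- c * b, - c * a), (a, - b). split.
- intros E. apply (f_equal (fun z : C => Re z * Re z + Im z * Im z)) in E.
  unfold Re, Im in E; simpl in E. nra.
- intros w. rewrite HL. split.
  + intros Hw. exists (a * Re w - b * Im w).
    apply Ceq_ext.
    * change (Re w = - c * b + ((a * Re w - b * Im w) * a - 0 * - b)).
      replace c with (- (a * Im w + b * Re w)) by lra.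
      transitivity (Re w * (a * a + b * b)); [rewrite Hab|]; ring.
    * change (Im w = - c * a + ((a * Re w - b * Im w) * - b + 0 * a)).
      replace c with (- (a * Im w + b * Re w)) by lra.
      transitivity (Im w * (a * a + b * b)); [rewrite Hab|]; ring.
  + intros [t ->]. unfold Re, Im; simpl.
    transitivity (c * (1 - (a * a + b * b))); [ring|]. rewrite Hab. ring.
Qed.

Lemma dist_to_normal_form (L : C -> Prop) (a b c : R) (w : C) : normal_form L a b c ->
  dist_to L w = Rabs (a * Im w + b * Re w + c).
Proof.
intros [Hab HL]. unfold dist_to.
rewrite (is_glb_Rbar_unique _ (Finite (Rabs (a * Im w + b * Re w + c)))); [reflexivity|].
split.
- intros x [p [Hp ->]]. simpl. apply HL in Hp.
  assert (E : a * Im w + b * Re w + c = Re ((b, (- a)%R) * (w - p))%C).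
  { transitivity (a * (Im w - Im p) + b * (Re w - Re p)); [lra|]. unfold Re, Im; simpl. ring. }
  rewrite E. eapply Rle_trans; [apply re_le_Cmod|]. rewrite Cmod_mult.
  assert (Hu : Cmod (b, (- a)%R) * Cmod (b, (- a)%R) = 1) by (rewrite Cmod_sqr; unfold Re, Im; simpl; lra).
  assert (Hu1 : Cmod (b, (- a)%R) = 1) by (pose proof (Cmod_ge_0 (b, (- a)%R)); nra).
  rewrite Hu1. lra.
- intros y Hy. set (l := a * Im w + b * Re w + c) in *.
  apply Hy. exists (w - RtoC l * (b, a))%C. split.
  + apply HL. change (a * (Im w + - (l * a + 0 * b)) + b * (Re w + - (l * b - 0 * a)) + c = 0).
    transitivity (l * (1 - (a * a + b * b))); [unfold l; ring|]. rewrite Hab; ring.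
  + replace (w - (w - RtoC l * (b, a)))%C with (RtoC l * (b, a))%C by ring.
    rewrite Cmod_mult, Cmod_R.
    assert (Hu : Cmod (b, a) * Cmod (b, a) = 1) by (rewrite Cmod_sqr; unfold Re, Im; simpl; lra).
    assert (Hu1 : Cmod (b, a) = 1) by (pose proof (Cmod_ge_0 (b, a)); nra).
    rewrite Hu1. ring.
Qed.

(** Two affine forms tending to 0 along a curve that goes to infinity define the same line, so an
    end of the curve has at most one asymptote. Parallel normals agree up to sign, and the constants
    then agree in the limit. *)
Lemma normal_form_unique (F : (R -> Prop) -> Prop) (FF : ProperFilter F) (g : R -> C)
    (L : C -> Prop) (a b c a' b' c' : R) :
  normal_form L a b c -> a' * a' + b' * b' = 1 ->
  filterlim (fun t => Cmod (g t)) F (Rbar_locally p_infty) ->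
  filterlim (fun t => Rabs (a * Im (g t) + b * Re (g t) + c)) F (locally 0) ->
  filterlim (fun t => Rabs (a' * Im (g t) + b' * Re (g t) + c')) F (locally 0) ->
  normal_form L a' b' c'.
Proof.
intros [Hab HL] Hab' Hinf H1 H2.
assert (Hev : forall M e, 0 < e -> exists t, M < Cmod (g t) /\
  Rabs (a * Im (g t) + b * Re (g t) + c) < e /\ Rabs (a' * Im (g t) + b' * Re (g t) + c') < e).
{ intros M e He.
  assert (I1 : F (fun t => M < Cmod (g t))) by (apply Hinf; exists M; auto).
  pose proof (proj1 (filterlim_locally _ _) H1 (mkposreal e He)) as I2.
  pose proof (proj1 (filterlim_locally _ _) H2 (mkposreal e He)) as I3.
  destruct (filter_ex _ (filter_and _ _ I1 (filter_and _ _ I2 I3))) as [t [T1 [T2 T3]]].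
  exists t. split; [exact T1|].
  assert (B : forall x, ball 0 (mkposreal e He) (Rabs x) -> Rabs x < e).
  { intros x Hx. change (Rabs (Rabs x - 0) < e) in Hx. rewrite Rminus_0_r, Rabs_Rabsolu in Hx. exact Hx. }
  split; apply B; assumption. }
split; [exact Hab'|]. intros w. rewrite HL.
destruct (Req_dec (a * b' - a' * b) 0) as [D|D].
- set (s := a * a' + b * b').
  assert (Hs2 : s * s = 1).
  { assert (X : s * s + (a * b' - a' * b) * (a * b' - a' * b) = (a * a + b * b) * (a' * a' + b' * b')) by (unfold s; ring).
    rewrite D, Hab, Hab' in X. lra. }
  assert (Ha : a' = s * a).
  { unfold s. transitivity (a' * (a * a + b * b)); [rewrite Hab; ring|].
    replace (a' * (a * a + b * b)) with ((a * a' + b * b') * a - b * (a * b' - a' * b)) by ring. rewrite D; ring. }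
  assert (Hb : b' = s * b).
  { unfold s. transitivity (b' * (a * a + b * b)); [rewrite Hab; ring|].
    replace (b' * (a * a + b * b)) with ((a * a' + b * b') * b + a * (a * b' - a' * b)) by ring. rewrite D; ring. }
  assert (Hsa : Rabs s = 1).
  { assert (Rabs s * Rabs s = 1) by (rewrite <- Rabs_mult, Hs2; apply Rabs_R1). pose proof (Rabs_pos s). nra. }
  assert (Hc : c' = s * c).
  { apply Rminus_diag_uniq.
    destruct (Req_dec (c' - s * c) 0) as [|Hne]; [assumption|exfalso].
    pose proof (Rabs_pos_lt _ Hne) as Hp.
    destruct (Hev 0 (Rabs (c' - s * c) / 2) ltac:(lra)) as [t [_ [T1 T2]]].
    assert (E : c' - s * c = (a' * Im (g t) + b' * Re (g t) + c') - s * (a * Im (g t) + b * Re (g t) + c))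
      by (rewrite Ha, Hb; ring).
    assert (Rabs (c' - s * c) <= Rabs (a' * Im (g t) + b' * Re (g t) + c') + Rabs (a * Im (g t) + b * Re (g t) + c)).
    { rewrite E. eapply Rle_trans; [apply Rabs_triang|]. rewrite Rabs_Ropp, Rabs_mult, Hsa. lra. }
    lra. }
  rewrite Ha, Hb, Hc. split; intros X.
  + transitivity (s * (a * Im w + b * Re w + c)); [ring|rewrite X; ring].
  + transitivity (s * (s * a * Im w + s * b * Re w + s * c)); [|rewrite X; ring].
    transitivity ((s * s) * (a * Im w + b * Re w + c)); [rewrite Hs2|]; ring.
(* For independent normals, Cramer's rule recovers both coordinates from two bounded forms, so the
   curve would stay bounded. *)
- exfalso. set (D0 := a * b' - a' * b) in *.
  set (M := (2 + Rabs c + Rabs c') * 4 / Rabs D0).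
  destruct (Hev M 1 Rlt_0_1) as [t [T0 [T1 T2]]].
  assert (Hd : 0 < Rabs D0) by now apply Rabs_pos_lt.
  set (x := Re (g t)) in *. set (y := Im (g t)) in *.
  set (u := a * y + b * x) in *. set (v := a' * y + b' * x) in *.
  assert (Bound : forall k, k * k <= 1 -> Rabs k <= 1).
  { intros k Hk. apply Rabs_le. nra. }
  assert (Ba := Bound a ltac:(nra)). assert (Bb := Bound b ltac:(nra)).
  assert (Ba' := Bound a' ltac:(nra)). assert (Bb' := Bound b' ltac:(nra)).
  assert (Hu : Rabs u <= 1 + Rabs c).
  { replace u with ((u + c) + - c) by ring. eapply Rle_trans; [apply Rabs_triang|]. rewrite Rabs_Ropp. lra. }
  assert (Hv : Rabs v <= 1 + Rabs c').
  { replace v with ((v + c') + - c') by ring. eapply Rle_trans; [apply Rabs_triang|]. rewrite Rabs_Ropp. lra. }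
  assert (Comb : forall k l, Rabs k <= 1 -> Rabs l <= 1 -> Rabs (k * u + l * v) <= 2 + Rabs c + Rabs c').
  { intros k l Hk Hl. eapply Rle_trans; [apply Rabs_triang|]. rewrite !Rabs_mult.
    pose proof (Rabs_pos u). pose proof (Rabs_pos v). pose proof (Rabs_pos k). pose proof (Rabs_pos l). nra. }
  assert (Hx : Rabs D0 * Rabs x <= 2 + Rabs c + Rabs c').
  { rewrite <- Rabs_mult. replace (D0 * x) with (- a' * u + a * v) by (unfold u, v, D0; ring).
    apply Comb; [rewrite Rabs_Ropp|]; assumption. }
  assert (Hy : Rabs D0 * Rabs y <= 2 + Rabs c + Rabs c').
  { rewrite <- Rabs_mult. replace (D0 * y) with (b' * u + - b * v) by (unfold u, v, D0; ring).
    apply Comb; [|rewrite Rabs_Ropp]; assumption. }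
  assert (Hg : Cmod (g t) <= Rabs x + Rabs y).
  { replace (g t) with (RtoC x + Ci * RtoC y)%C by (apply Ceq_ext; unfold x, y, Re, Im; simpl; ring).
    eapply Rle_trans; [apply Cmod_triangle|]. rewrite Cmod_mult, Cmod_Ci, !Cmod_R. lra. }
  assert (T0' : Rabs D0 * M < Rabs D0 * Cmod (g t)) by (apply Rmult_lt_compat_l; assumption).
  replace (Rabs D0 * M) with ((2 + Rabs c + Rabs c') * 4) in T0' by (unfold M; field; lra).
  pose proof (Rabs_pos c). pose proof (Rabs_pos c').
  assert (Rabs D0 * Cmod (g t) <= Rabs D0 * (Rabs x + Rabs y)) by (apply Rmult_le_compat_l; lra).
  lra.
Qed.

(** * The two ends of the boundary curve *)

Section Boundary.
Variable alpha : R.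
Hypothesis Ha : 0 < alpha < 1 / 2.
Let q := 1 - 2 * alpha.

Lemma boundary_curve_hk (t : R) : 0 < t < 2 * PI -> boundary_curve alpha t = hk (q + 1) (circ 1 t).
Proof.
intros Ht. unfold boundary_curve, h_. rewrite Cexp_circ. unfold hk, over_z.
destruct (Ceq_dec (circ 1 t) (RtoC 0)); [reflexivity|].
rewrite k_kk by (rewrite Re_circ; pose proof (cos_lt_1_2PI t Ht); lra).
unfold q. replace (1 - 2 * alpha + 1) with (2 - 2 * alpha) by ring. reflexivity.
Qed.

Lemma boundary_curve_conj (t : R) : 0 < t < 2 * PI ->
  boundary_curve alpha (2 * PI - t) = Cconj (boundary_curve alpha t).
Proof.
intros Ht. rewrite !boundary_curve_hk by lra. rewrite <- hk_conj. f_equal.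
apply Ceq_ext.
- change (Re (Cconj (circ 1 t))) with (Re (circ 1 t)). rewrite !Re_circ.
  rewrite cos_minus, cos_2PI, sin_2PI. ring.
- change (Im (Cconj (circ 1 t))) with (- Im (circ 1 t)). rewrite !Im_circ.
  rewrite sin_minus, cos_2PI, sin_2PI. ring.
Qed.

Lemma invpow_circ (t : R) : 0 < t < 2 * PI ->
  invpow q (circ 1 t) = (Rpower (2 * sin (t / 2)) (- q) * cos (q * ((PI - t) / 2)),
                    Rpower (2 * sin (t / 2)) (- q) * sin (q * ((PI - t) / 2))).
Proof.
intros Ht. unfold invpow, Cexp. rewrite Log_one_minus_circ by exact Ht. rewrite Re_scal, Im_scal. simpl.
replace (- q * - ((PI - t) / 2)) with (q * ((PI - t) / 2)) by ring. reflexivity.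
Qed.

Lemma hk_circ (t : R) : 0 < t < 2 * PI ->
  hk (q + 1) (circ 1 t) = (RtoC (/ q) * ((invpow q (circ 1 t) - RtoC 1) * circ 1 (- t)))%C.
Proof.
intros Ht. assert (Hn : circ 1 t <> RtoC 0) by (apply circ_neq0; lra).
assert (X : (circ 1 t * circ 1 (- t))%C = RtoC 1).
{ apply Ceq_ext.
  - change (Re (circ 1 t) * Re (circ 1 (- t)) - Im (circ 1 t) * Im (circ 1 (- t)) = 1).
    rewrite !Re_circ, !Im_circ, cos_neg, sin_neg. pose proof (sin2_cos2 t) as S. unfold Rsqr in S. lra.
  - change (Re (circ 1 t) * Im (circ 1 (- t)) + Im (circ 1 t) * Re (circ 1 (- t)) = 0).
    rewrite !Re_circ, !Im_circ, cos_neg, sin_neg. ring. }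
unfold hk. rewrite over_z_neq0 by exact Hn. unfold kk.
destruct (Req_dec_T (q + 1) 1) as [Y|_]; [unfold q in Y; lra|].
replace (q + 1 - 1) with q by ring. rewrite <- RtoC_inv by (unfold q; lra).
assert (Y : circ 1 (- t) = (/ circ 1 t)%C).
{ transitivity (circ 1 t * circ 1 (- t) * / circ 1 t)%C; [field; exact Hn|]. rewrite X. ring. }
rewrite Y. unfold Cdiv. ring.
Qed.

Let L1 (s : R) (w : C) : R := sin (PI * alpha) * Im w + (- s * cos (PI * alpha)) * Re w + s * cos (PI * alpha) / (2 * alpha - 1).

(** Since [PI alpha = PI/2 - q PI/2], projecting on the normal of the line turns the unbounded term
    [t^(-q)] into a multiple of [t^(-q) sin ((1+q/2) t)], which tends to 0 because [q < 1]. *)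
Lemma L1_boundary (t : R) : 0 < t < 2 * PI ->
  L1 1 (boundary_curve alpha t) =
  / q * (- (Rpower (2 * sin (t / 2)) (- q) * sin ((1 + q / 2) * t)) + (sin (t + q * PI / 2) - sin (q * PI / 2))).
Proof.
intros Ht. rewrite boundary_curve_hk, hk_circ, invpow_circ by exact Ht. unfold L1.
rewrite Re_scal, Im_scal.
assert (HA : PI * alpha = PI / 2 - q * PI / 2) by (unfold q; field).
rewrite HA, sin_shift, cos_shift.
replace (2 * alpha - 1) with (- q) by (unfold q; ring).
set (P := Rpower _ _). set (b := q * PI / 2). set (ph := q * ((PI - t) / 2)).
replace ((1 + q / 2) * t) with (- (ph - t - b)) by (unfold ph, b; field).
rewrite sin_neg, sin_minus, (sin_minus ph t), (cos_minus ph t), (sin_plus t b).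
assert (XR : Re ((((P * cos ph)%R, (P * sin ph)%R) - RtoC 1) * circ 1 (- t))%C = (P * cos ph - 1) * cos t + P * sin ph * sin t).
{ change ((P * cos ph + - (1)) * Re (circ 1 (- t)) - (P * sin ph + - 0) * Im (circ 1 (- t)) = (P * cos ph - 1) * cos t + P * sin ph * sin t).
  rewrite Re_circ, Im_circ, cos_neg, sin_neg. ring. }
assert (XI : Im ((((P * cos ph)%R, (P * sin ph)%R) - RtoC 1) * circ 1 (- t))%C = P * sin ph * cos t - (P * cos ph - 1) * sin t).
{ change ((P * cos ph + - (1)) * Im (circ 1 (- t)) + (P * sin ph + - 0) * Re (circ 1 (- t)) = P * sin ph * cos t - (P * cos ph - 1) * sin t).
  rewrite Re_circ, Im_circ, cos_neg, sin_neg. ring. }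
rewrite XR, XI. field. unfold q; lra.
Qed.

Lemma sin_ge_half (x : R) : 0 <= x <= 1 -> x / 2 <= sin x.
Proof.
intros Hx.
assert (H := derive_le (fun t => sin t - t / 2) (fun t => cos t - 1 / 2) 0 x ltac:(lra)).
cbv beta in H. rewrite sin_0 in H. enough (0 - 0 / 2 <= sin x - x / 2) by lra.
apply H; intros t Ht.
- auto_derive; [exact I|]. field.
- assert (Dc : cos t = 1 - 2 * sin (t / 2) * sin (t / 2)).
  { replace t with (2 * (t / 2)) at 1 by field. apply cos_2a_sin. }
  assert (0 <= sin (t / 2)) by (apply sin_ge_0; [lra|pose proof PI2_3_2; lra]).
  assert (sin (t / 2) <= t / 2).
  { destruct (Req_dec t 0) as [->|]; [replace (0 / 2) with 0 by field; rewrite sin_0; lra|].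
    left; apply sin_lt_x; lra. }
  assert (sin (t / 2) * sin (t / 2) <= (1 / 2) * (1 / 2)) by (apply Rmult_le_compat; lra). lra.
Qed.

Lemma Rabs_sin_le (x : R) : Rabs (sin x) <= Rabs x.
Proof.
assert (Hp : forall x, 0 < x -> Rabs (sin x) <= x).
{ intros y Hy. apply Rabs_le. split.
  - destruct (Rle_lt_dec y PI).
    + pose proof (sin_ge_0 y ltac:(lra) ltac:(lra)). lra.
    + pose proof (SIN_bound y). pose proof PI2_3_2. lra.
  - left. now apply sin_lt_x. }
destruct (Rtotal_order x 0) as [H|[->|H]].
- rewrite <- (Rabs_Ropp x), <- (Rabs_Ropp (sin x)), <- sin_neg, (Rabs_pos_eq (- x)) by lra. apply Hp; lra.
- rewrite sin_0, Rabs_R0. lra.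
- rewrite (Rabs_pos_eq x) by lra. now apply Hp.
Qed.

Lemma at_right_0_intro (P : R -> Prop) (d : R) : 0 < d -> (forall t, 0 < t < d -> P t) -> at_right 0 P.
Proof.
intros Hd H. exists (mkposreal d Hd). intros t Hb Ht. apply H. split; [exact Ht|].
assert (Hb' : Rabs (t - 0) < d) by exact Hb. apply Rabs_def2 in Hb'. lra.
Qed.

Lemma Rpower_small (m e : R) : 0 < m -> 0 < e -> exists d, 0 < d /\ forall x, 0 < x < d -> Rpower x m < e.
Proof.
intros Hm He. exists (Rpower e (/ m)). split; [apply exp_pos|]. intros x Hx.
replace e with (Rpower (Rpower e (/ m)) m) by (rewrite Rpower_mult, Rinv_l, Rpower_1; lra).
apply Rlt_Rpower_l; lra.
Qed.

Lemma asymptote_right : filterlim (fun t => Rabs (L1 1 (boundary_curve alpha t))) (at_right 0) (locally 0).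
Proof.
assert (Hq : 0 < q < 1) by (unfold q; lra).
apply filterlim_locally. intros eps.
(* The power term is at most [4 (t/2)^(1-q)], hence below [q eps / 2], and the difference of sines
   is at most [t < q eps / 4]. *)
destruct (Rpower_small (1 - q) (q * eps / 8)) as [d [Hd Hs]].
{ lra. } { apply Rdiv_lt_0_compat; [apply Rmult_lt_0_compat; [lra|apply eps]|lra]. }
assert (He : 0 < q * eps / 4) by (apply Rdiv_lt_0_compat; [apply Rmult_lt_0_compat; [lra|apply eps]|lra]).
apply (at_right_0_intro _ (Rmin 1 (Rmin d (q * eps / 4)))).
{ repeat apply Rmin_glb_lt; lra. }
intros t Ht.
assert (M1 := Rmin_l 1 (Rmin d (q * eps / 4))). assert (M2 := Rmin_r 1 (Rmin d (q * eps / 4))).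
assert (M3 := Rmin_l d (q * eps / 4)). assert (M4 := Rmin_r d (q * eps / 4)).
pose proof PI2_3_2 as Hpi.
change (Rabs (Rabs (L1 1 (boundary_curve alpha t)) - 0) < eps). rewrite Rminus_0_r, Rabs_Rabsolu.
rewrite L1_boundary by lra.
rewrite Rabs_mult, (Rabs_pos_eq (/ q)) by (left; apply Rinv_0_lt_compat; lra).
apply Rmult_lt_reg_l with q; [lra|]. rewrite <- Rmult_assoc, Rinv_r, Rmult_1_l by lra.
eapply Rle_lt_trans; [apply Rabs_triang|]. rewrite Rabs_Ropp, Rabs_mult.
assert (B1 : Rabs (sin (t + q * PI / 2) - sin (q * PI / 2)) <= t).
{ rewrite form4. replace ((t + q * PI / 2 - q * PI / 2) / 2) with (t / 2) by field.
  rewrite !Rabs_mult. rewrite (Rabs_pos_eq 2) by lra.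
  assert (C1 : Rabs (cos ((t + q * PI / 2 + q * PI / 2) / 2)) <= 1) by (apply Rabs_le, COS_bound).
  pose proof (Rabs_sin_le (t / 2)) as C2. rewrite (Rabs_pos_eq (t / 2)) in C2 by lra.
  pose proof (Rabs_pos (sin (t / 2))). pose proof (Rabs_pos (cos ((t + q * PI / 2 + q * PI / 2) / 2))). nra. }
assert (B2 : Rabs (sin ((1 + q / 2) * t)) <= 2 * t).
{ eapply Rle_trans; [apply Rabs_sin_le|]. rewrite Rabs_pos_eq by nra. nra. }
assert (Hst : t / 2 <= 2 * sin (t / 2)) by (pose proof (sin_ge_half (t / 2)); lra).
assert (B3 : Rabs (Rpower (2 * sin (t / 2)) (- q)) <= Rpower (t / 2) (- q)).
{ rewrite Rabs_pos_eq by (left; apply exp_pos). rewrite !Rpower_Ropp.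
  apply Rinv_le_contravar; [apply exp_pos|]. apply Rpower_le_mono; lra. }
assert (B4 : Rpower (t / 2) (- q) * (2 * t) = 4 * Rpower (t / 2) (1 - q)).
{ replace (1 - q) with (- q + 1) by ring. rewrite Rpower_plus, Rpower_1 by lra. field. }
assert (B5 : Rabs (Rpower (2 * sin (t / 2)) (- q)) * Rabs (sin ((1 + q / 2) * t)) <= 4 * Rpower (t / 2) (1 - q)).
{ rewrite <- B4. apply Rmult_le_compat; auto using Rabs_pos. }
specialize (Hs (t / 2) ltac:(lra)). lra.
Qed.

Lemma infinity_right : filterlim (fun t => Cmod (boundary_curve alpha t)) (at_right 0) (Rbar_locally p_infty).
Proof.
assert (Hq : 0 < q < 1) by (unfold q; lra).
intros P [M HM].
set (A := q * Rabs M + 2).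
assert (HA : 0 < A) by (unfold A; pose proof (Rabs_pos M); nra).
destruct (Rpower_small q (/ A) ltac:(lra) (Rinv_0_lt_compat _ HA)) as [d [Hd Hs]].
apply (at_right_0_intro _ (Rmin 1 d)); [apply Rmin_glb_lt; lra|].
intros t Ht. assert (M1 := Rmin_l 1 d). assert (M2 := Rmin_r 1 d).
pose proof PI2_3_2 as Hpi.
apply HM. rewrite boundary_curve_hk, hk_circ by lra.
assert (Hsin : 0 < sin (t / 2)) by (apply sin_gt_0; lra).
assert (Hsx : sin (t / 2) < t / 2) by (apply sin_lt_x; lra).
rewrite !Cmod_mult, Cmod_RtoC_pos, Cmod_circ by (try (left; apply Rinv_0_lt_compat); lra).
rewrite Rmult_1_r.
assert (HE : Cmod (invpow q (circ 1 t)) = Rpower (2 * sin (t / 2)) (- q)).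
{ unfold invpow. rewrite Cmod_Cexp, Re_scal, Log_one_minus_circ by lra. reflexivity. }
assert (HE1 : A < Rpower (2 * sin (t / 2)) (- q)).
{ rewrite Rpower_Ropp. rewrite <- (Rinv_inv A). apply Rinv_lt_contravar.
  - apply Rmult_lt_0_compat; [apply exp_pos|now apply Rinv_0_lt_compat].
  - apply Hs. lra. }
pose proof (Cmod_rev_triangle (invpow q (circ 1 t)) (RtoC 1)) as T. rewrite HE, Cmod_1 in T.
apply Rmult_lt_reg_l with q; [lra|]. rewrite <- Rmult_assoc, Rinv_r, Rmult_1_l by lra.
pose proof (Rle_abs M). unfold A in HE1. nra.
Qed.

(** The curve is symmetric under conjugation, which exchanges its ends through [t -> 2 PI - t]; the
    left end needs no computation of its own. *)
Lemma reflect_filter (P : R -> Prop) : at_right 0 P ->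
  at_left (2 * PI) (fun t => P (2 * PI - t) /\ 0 < 2 * PI - t < 2 * PI).
Proof.
intros [d Hd]. pose proof PI_RGT_0 as Hpi.
assert (Hp : 0 < Rmin d (2 * PI)) by (apply Rmin_glb_lt; [apply cond_pos|lra]).
exists (mkposreal _ Hp). intros t Hb Ht.
assert (Hb' : Rabs (t - 2 * PI) < Rmin d (2 * PI)) by exact Hb. apply Rabs_def2 in Hb'.
pose proof (Rmin_l d (2 * PI)). pose proof (Rmin_r d (2 * PI)).
split; [|lra]. apply Hd; [|lra].
change (Rabs (2 * PI - t - 0) < d). rewrite Rabs_pos_eq; lra.
Qed.

Lemma asymptote_left : filterlim (fun t => Rabs (L1 (-1) (boundary_curve alpha t))) (at_left (2 * PI)) (locally 0).
Proof.
intros P HP. apply asymptote_right in HP. unfold filtermap in *. apply reflect_filter in HP.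
eapply filter_imp; [|exact HP]. intros t [H1 H2].
replace t with (2 * PI - (2 * PI - t)) by ring. rewrite boundary_curve_conj by exact H2.
replace (Rabs (L1 (-1) (Cconj (boundary_curve alpha (2 * PI - t))))) with
  (Rabs (L1 1 (boundary_curve alpha (2 * PI - t)))); [exact H1|].
rewrite <- Rabs_Ropp. f_equal. unfold L1.
change (Re (Cconj ?z)) with (Re z). set (z := boundary_curve _ _).
change (Im (Cconj z)) with (- Im z). change (Re (Cconj z)) with (Re z). field. lra.
Qed.

Lemma infinity_left : filterlim (fun t => Cmod (boundary_curve alpha t)) (at_left (2 * PI)) (Rbar_locally p_infty).
Proof.
intros P HP. apply infinity_right in HP. unfold filtermap in *. apply reflect_filter in HP.
eapply filter_imp; [|exact HP]. intros t [H1 H2].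
replace t with (2 * PI - (2 * PI - t)) by ring. rewrite boundary_curve_conj by exact H2.
rewrite Cmod_conj. exact H1.
Qed.

Lemma sin_PI_alpha_pos : 0 < sin (PI * alpha).
Proof. pose proof PI_RGT_0. apply sin_gt_0; nra. Qed.

Lemma slope_normal_form (L : C -> Prop) (s : R) : s * s = 1 ->
  ((forall w, L w <-> Im w = s * cot (PI * alpha) * (Re w - 1 / (2 * alpha - 1))) <->
   normal_form L (sin (PI * alpha)) (- s * cos (PI * alpha)) (s * cos (PI * alpha) / (2 * alpha - 1))).
Proof.
intros Hs. pose proof sin_PI_alpha_pos as Hp.
assert (Heq : forall w : C, Im w = s * cot (PI * alpha) * (Re w - 1 / (2 * alpha - 1)) <-> L1 s w = 0).
{ intros w. unfold L1, cot.
  assert (X : sin (PI * alpha) * Im w + - s * cos (PI * alpha) * Re w + s * cos (PI * alpha) / (2 * alpha - 1) =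
    sin (PI * alpha) * (Im w - s * (cos (PI * alpha) / sin (PI * alpha)) * (Re w - 1 / (2 * alpha - 1)))) by (field; lra).
  rewrite X. split; intros Y.
  - rewrite <- Y. ring.
  - apply Rmult_integral in Y. lra. }
split.
- intros H. split.
  + replace (- s * cos (PI * alpha) * (- s * cos (PI * alpha))) with ((s * s) * (cos (PI * alpha) * cos (PI * alpha))) by ring.
    rewrite Hs. pose proof (sin2_cos2 (PI * alpha)) as S. unfold Rsqr in S. lra.
  + intros w. rewrite H. apply Heq.
- intros [_ H] w. rewrite H. symmetry. apply Heq.
Qed.

Lemma asymptotic_lines (L : C -> Prop) :
  is_asymptotic_line (boundary_curve alpha) L <->
  (forall w : C, L w <-> Im w = cot (PI * alpha) * (Re w - 1 / (2 * alpha - 1))) \/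
  (forall w : C, L w <-> Im w = - cot (PI * alpha) * (Re w - 1 / (2 * alpha - 1))).
Proof.
assert (Hunit : forall s, s * s = 1 -> sin (PI * alpha) * sin (PI * alpha) + (- s * cos (PI * alpha)) * (- s * cos (PI * alpha)) = 1).
{ intros s Hs. replace (- s * cos (PI * alpha) * (- s * cos (PI * alpha))) with ((s * s) * (cos (PI * alpha) * cos (PI * alpha))) by ring.
  rewrite Hs. pose proof (sin2_cos2 (PI * alpha)) as S. unfold Rsqr in S. lra. }
assert (S1 := slope_normal_form L 1 ltac:(ring)). assert (S2 := slope_normal_form L (-1) ltac:(ring)).
assert (R1 : (forall w : C, L w <-> Im w = cot (PI * alpha) * (Re w - 1 / (2 * alpha - 1))) <->
  (forall w : C, L w <-> Im w = 1 * cot (PI * alpha) * (Re w - 1 / (2 * alpha - 1)))).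
{ now rewrite Rmult_1_l. }
assert (R2 : (forall w : C, L w <-> Im w = - cot (PI * alpha) * (Re w - 1 / (2 * alpha - 1))) <->
  (forall w : C, L w <-> Im w = -1 * cot (PI * alpha) * (Re w - 1 / (2 * alpha - 1)))).
{ replace (-1 * cot (PI * alpha)) with (- cot (PI * alpha)) by ring. reflexivity. }
rewrite R1, R2, S1, S2. split.
- intros [HL Hasy]. destruct (line_normal_form L HL) as [a [b [c Hn]]].
  assert (Hdist : forall F, Filter F -> filterlim (fun t => dist_to L (boundary_curve alpha t)) F (locally 0) ->
     filterlim (fun t => Rabs (a * Im (boundary_curve alpha t) + b * Re (boundary_curve alpha t) + c)) F (locally 0)).
  { intros F FF HF. eapply filterlim_ext; [|exact HF]. intros t. cbv beta. now apply dist_to_normal_form. }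
  destruct Hasy as [[A1 A2]|[A1 A2]]; [left|right].
  + apply (normal_form_unique (at_right 0) (at_right_proper_filter 0) (boundary_curve alpha) L a b c); auto with typeclass_instances.
    * apply Hunit; ring.
    * exact asymptote_right.
  + apply (normal_form_unique (at_left (2 * PI)) (at_left_proper_filter (2 * PI)) (boundary_curve alpha) L a b c); auto with typeclass_instances.
    * apply Hunit; ring.
    * exact asymptote_left.
- intros [Hn|Hn]; (split; [now apply (normal_form_line L _ _ _ Hn)|]); [left|right].
  + split; [exact infinity_right|]. eapply filterlim_ext; [|exact asymptote_right].
    intros t. cbv beta. symmetry. now apply dist_to_normal_form.
  + split; [exact infinity_left|]. eapply filterlim_ext; [|exact asymptote_left].
    intros t. cbv beta. symmetry. now apply dist_to_normal_form.
Qed.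

End Boundary.

(** * Proof of the theorem *)


(** The hull estimate is available for radii [s > |z|] only; this carries a bound over to
    [s = |z|]. *)
Lemma continuous_le_right (g : R -> R) (r X : R) : r < 1 -> continuous g r ->
  (forall s, r < s < 1 -> g s <= X) -> g r <= X.
Proof.
intros Hr Hc H. apply Rnot_lt_le. intros Hlt.
assert (He : 0 < g r - X) by lra.
destruct (proj1 (filterlim_locally _ _) Hc (mkposreal _ He)) as [d Hd].
set (y := Rmin (d / 2) ((1 - r) / 2)).
assert (Hy : 0 < y) by (apply Rmin_glb_lt; [pose proof (cond_pos d)|]; lra).
assert (Hy1 : y <= d / 2) by apply Rmin_l. assert (Hy2 : y <= (1 - r) / 2) by apply Rmin_r.
assert (Hb : ball r d (r + y)).
{ change (Rabs (r + y - r) < d). replace (r + y - r) with y by ring.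
  rewrite Rabs_pos_eq by lra. pose proof (cond_pos d). lra. }
specialize (Hd _ Hb). assert (Hd' : Rabs (g (r + y) - g r) < g r - X) by exact Hd.
apply Rabs_def2 in Hd'. specialize (H (r + y) ltac:(lra)). lra.
Qed.

Lemma h_hk (alpha x : R) : x < 1 -> h_ alpha (RtoC x) = hk (2 - 2 * alpha) (RtoC x).
Proof.
intros Hx. unfold h_, hk, over_z. destruct (Ceq_dec _ _); [reflexivity|].
rewrite k_kk by exact Hx. reflexivity.
Qed.

Lemma Re_over_z_bounds (alpha : R) (f : C -> C) (z : C) : 0 <= alpha < 1 -> convex_of_order alpha f ->
  Cmod z < 1 ->
  Re (h_ alpha (RtoC (- Cmod z))) <= Re (over_z f z) <= Re (h_ alpha (RtoC (Cmod z))).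
Proof.
intros Ha Hf Hz. pose proof (Cmod_ge_0 z) as Hz0.
rewrite !h_hk by lra. set (p := 2 - 2 * alpha).
(* At the origin all three quantities are 1; the continuity along rays used below requires
   [|z| > 0]. *)
destruct (Ceq_dec z (RtoC 0)) as [->|Hn].
{ rewrite Cmod_0, Ropp_0. unfold hk. rewrite !over_z_0. lra. }
assert (Hzp : 0 < Cmod z) by now apply Cmod_gt_0.
assert (Hm1 : (- RtoC 1)%C <> RtoC 0).
{ intros E. apply (f_equal Re) in E. simpl in E. lra. }
assert (H1n : RtoC 1 <> RtoC 0) by (intros E; apply RtoC_inj in E; lra).
assert (X : forall w : C, Re (- RtoC 1 * w)%C = - Re w) by (intros; unfold Re; simpl; ring).
split.
- destruct (cder_hk_ray p (- RtoC 1)%C (Cmod z) Hzp Hm1) as [l Hl].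
  { rewrite Re_scal. simpl. lra. }
  apply cder_cont in Hl. destruct Hl as [Hl _].
  assert (Em : forall s : R, (RtoC s * - RtoC 1)%C = RtoC (- s)) by (intros; rewrite RtoC_opp; ring).
  assert (H := continuous_le_right (fun s => Re (hk p (RtoC s * - RtoC 1)%C)) (Cmod z) (Re (over_z f z)) Hz Hl).
  cbv beta in H. rewrite Em in H. apply H. intros s Hs. rewrite Em.
  enough (Re (- RtoC 1 * over_z f z)%C <= - Re (hk p (RtoC (- s)))) by (rewrite X in H0; lra).
  apply (hull_convex_of_order alpha f z _ s); [lra|exact Hf|lra|lra|].
  intros w Hw. rewrite X. apply Ropp_le_contravar. apply hk_lower; [unfold p; lra|lra|exact Hw].
- destruct (cder_hk_ray p (RtoC 1) (Cmod z) Hzp H1n) as [l Hl].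
  { rewrite Re_scal. simpl. lra. }
  apply cder_cont in Hl. destruct Hl as [Hl _].
  apply Ropp_le_cancel.
  assert (H := continuous_le_right (fun s => - Re (hk p (RtoC s * RtoC 1)%C)) (Cmod z) (- Re (over_z f z)) Hz).
  cbv beta in H. rewrite Cmult_1_r in H. apply H; [now apply continuous_Ropp|].
  intros s Hs. rewrite Cmult_1_r. apply Ropp_le_contravar.
  rewrite <- (Cmult_1_l (over_z f z)).
  apply (hull_convex_of_order alpha f z _ s); [lra|exact Hf|lra|lra|].
  intros w Hw. rewrite Cmult_1_l. apply hk_upper; [unfold p; lra|lra|exact Hw].
Qed.

(** A disk of radius [s > |z|] places [f(z)/z] in a closed sector with vertex [-1/q] and half-angle
    [b < q * PI / 2]. Strictness follows from [tan b < tan (q * PI / 2) = cot (PI * alpha)] and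
    [u + 1/q > 0]. *)
Lemma over_z_sector (alpha : R) (f : C -> C) (z : C) : 0 < alpha < 1 / 2 -> convex_of_order alpha f ->
  Cmod z < 1 ->
  Rabs (Im (over_z f z)) < cot (PI * alpha) * (Re (over_z f z) - 1 / (2 * alpha - 1)).
Proof.
intros Ha Hf Hz. pose proof (Cmod_ge_0 z) as Hz0.
set (q := 1 - 2 * alpha). assert (Hq : 0 < q < 1) by (unfold q; lra).
set (s := (1 + Cmod z) / 2). assert (Hs : Cmod z < s < 1) by (unfold s; lra).
set (b := q * atan ((1 + s) / (1 - s))).
assert (Hp : q + 1 = 2 - 2 * alpha) by (unfold q; ring).
assert (Hat : 0 < atan ((1 + s) / (1 - s)) < PI / 2).
{ split; [|apply atan_bound]. rewrite <- atan_0. apply atan_increasing. apply Rdiv_lt_0_compat; lra. }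
set (u := Re (over_z f z)). set (v := Im (over_z f z)).
assert (Hhull : forall d : R, (forall w, Cmod w <= s ->
    0 <= sin b * (Re (hk (q + 1) w) + / q) + d * Im (hk (q + 1) w)) ->
    0 <= sin b * (u + / q) + d * v).
{ intros d Hd.
  assert (X : forall w : C, Re (((- sin b)%R, d) * w)%C = - (sin b * Re w + d * Im w)) by (intros; unfold Re, Im; simpl; ring).
  assert (H : Re (((- sin b)%R, d) * over_z f z)%C <= sin b * / q).
  { apply (hull_convex_of_order alpha f z _ s); [lra|exact Hf|lra|lra|].
    intros w Hw. rewrite X. specialize (Hd w Hw). unfold hk in Hd. rewrite Hp in Hd. lra. }
  rewrite X in H. unfold u, v. lra. }
assert (B1 : 0 <= sin b * (u + / q) + cos b * v).
{ apply Hhull. intros w Hw. apply (hk_sector q s w Hq ltac:(lra) Hw). }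
assert (B2 : 0 <= sin b * (u + / q) + - cos b * v).
{ apply Hhull. intros w Hw. pose proof (proj2 (hk_sector q s w Hq ltac:(lra) Hw)) as T. fold b in T. lra. }
assert (Hu : 0 < u).
{ unfold u. eapply Rlt_le_trans; [|apply (Re_over_z_bounds alpha f z); [lra|exact Hf|exact Hz]].
  rewrite h_hk by lra. apply hk_real_pos. lra. }
assert (Hqi : 0 < / q) by (apply Rinv_0_lt_compat; lra).
assert (Hb : 0 < b < q * (PI / 2)).
{ unfold b. split; [apply Rmult_lt_0_compat; lra|apply Rmult_lt_compat_l; lra]. }
assert (Hb2 : q * (PI / 2) < PI / 2) by nra.
assert (Hcb : 0 < cos b) by (apply cos_gt_0; lra).
replace (cot (PI * alpha)) with (tan (q * (PI / 2))).
2:{ unfold cot, tan. replace (PI * alpha) with (PI / 2 - q * (PI / 2)) by (unfold q; field).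
    rewrite sin_shift, cos_shift. reflexivity. }
replace (u - 1 / (2 * alpha - 1)) with (u + / q) by (unfold q; field; lra).
apply Rle_lt_trans with (tan b * (u + / q)).
- assert (Et : tan b * (u + / q) = sin b * (u + / q) / cos b) by (unfold tan; field; lra).
  rewrite Et. apply Rmult_le_reg_r with (cos b); [exact Hcb|].
  replace (sin b * (u + / q) / cos b * cos b) with (sin b * (u + / q)) by (field; lra).
  assert (Rabs v * cos b = Rabs (v * cos b)) by (rewrite Rabs_mult, (Rabs_pos_eq (cos b)); lra).
  rewrite H. apply Rabs_le. lra.
- apply Rmult_lt_compat_r; [lra|]. apply tan_increasing; lra.
Qed.

Theorem theorem1p3 (alpha : R) (f : C -> C)
    (Halpha : 0 <= alpha < 1) (Hf : convex_of_order alpha f) :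
  (forall (z : C) (r : R), Cmod z = r -> r < 1 ->
     Re (h_ alpha (RtoC (- r))) <= Re (over_z f z) <= Re (h_ alpha (RtoC r)))
  /\
  (0 < alpha < 1 / 2 ->
     (forall L : C -> Prop,
        is_asymptotic_line (boundary_curve alpha) L <->
        (forall w : C, L w <->
           Im w = cot (PI * alpha) * (Re w - 1 / (2 * alpha - 1))) \/
        (forall w : C, L w <->
           Im w = - cot (PI * alpha) * (Re w - 1 / (2 * alpha - 1)))) /\
     (forall z : C, in_disk z ->
        Rabs (Im (over_z f z)) <
          cot (PI * alpha) * (Re (over_z f z) - 1 / (2 * alpha - 1))))
  /\
  (1 / 2 <= alpha ->
     (forall z : C, in_disk z ->
        Rbar_lt (Finite (Rabs (Im (over_z f z)))) (M_ alpha)) /\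
     Rbar_le (M_ alpha) (M_ (1 / 2)) /\
     M_ (1 / 2) = Finite (PI / 2) /\
     (forall c : R, Rbar_lt (Finite c) (M_ alpha) ->
        exists (g : C -> C) (z : C),
          convex_of_order alpha g /\ in_disk z /\
          c < Rabs (Im (over_z g z)))).
Proof.
split; [|split].
- intros z r <- Hr. now apply Re_over_z_bounds.
- intros Ha. split.
  + intros L. now apply asymptotic_lines.
  + intros z Hz. now apply over_z_sector.
- intros Ha. split; [|split; [|split]].
  + intros z Hz. apply Im_over_z_lt_M; [lra|exact Hf|exact Hz].
  + apply M_le_half. lra.
  + exact M_half.
  + intros c Hc. destruct (M_sharp alpha c ltac:(lra) Hc) as [z [Hz Hv]].
    exists (k_ alpha), z. split; [apply k_convex; lra|]. split; assumption.
Qed.
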